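(* Let $E$ and $F$ be Banach spaces over $\mathbb{K}$, let $n\in\mathbb{N}$, and let $P\in\mathcal{P}(^{n}E;F)$ be such that $P\notin\mathcal{P}_{w}(^{n}E;F)$. Suppose that $P$ admits a factorization $P=Q\circ T$ through a Banach space $G$ over $\mathbb{K}$ with an unconditional finite dimensional expansion of the identity, where $T\in\mathcal{L}(E;G)$ and $Q\in\mathcal{P}(^{n}G;F)$. Then $\mathcal{P}_{w}(^{n}E;F)$ contains an isomorphic copy of $c_{0}$, and thus $\mathcal{P}_{w}(^{n}E;F)$ is not complemented in $\mathcal{P}(^{n}E;F)$.
   Context: $\mathbb{K}$ is $\mathbb{R}$ or $\mathbb{C}$. $\mathcal{L}(E;G)$ is the space of bounded linear operators from $E$ into $G$. For Banach spaces $E,F$ and $n\in\mathbb{N}=\{1,2,\dots\}$, $\mathcal{P}(^{n}E;F)$ is the Banach space of all continuous $n$-homogeneous polynomials from $E$ into $F$, with norm $\|P\|=\sup_{\|x\|\le 1}\|P(x)\|$. $\mathcal{P}_{w}(^{n}E;F)$ is the subspace of all $P\in\mathcal{P}(^{n}E;F)$ which are weakly continuous on bounded sets, that is, for each bounded set $B\subset E$ the restriction $P|_{B}:B\to F$ is continuous when $B$ carries the (relative) weak topology and $F$ the norm topology. A Banach space $G$ has an unconditional finite dimensional expansion of the identity if there is a sequence of bounded finite rank linear operators $A_{i}:G\to G$ such that for every $x\in G$ the series $\sum_{i=1}^{\infty}A_{i}(x)$ converges unconditionally to $x$. A Banach space $X$ contains a (isomorphic) copy of $Y$ if some closed subspace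 of $X$ is linearly homeomorphic to $Y$. A subspace is complemented if it is the range of a bounded linear projection of the whole space. *)

(* Defs.v *)
From HB Require Import structures.
From mathcomp Require Import all_boot all_order all_algebra.
From mathcomp Require Import all_classical all_reals all_analysis.
From mathcomp Require Import complex.

Set Implicit Arguments.
Unset Strict Implicit.
Unset Printing Implicit Defensive.

Import Order.TTheory GRing.Theory Num.Theory.
Import numFieldNormedType.Exports.

Local Open Scope classical_set_scope.
Local Open Scope ring_scope.

Variant scalar_kind := RealScalars | ComplexScalars.

(* The field of scalars is the field of real numbers or of complex numbers.
   Note that the norms of spaces over R[i] take their (real, nonnegative)
   values in R[i], whose order is the partial one: x <= y means that y - x is a
   nonnegative real. *)
Definition scalars (R : realType) (k : scalar_kind) : numFieldType :=
  match k with RealScalars => R | ComplexScalars => R[i] end.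

Definition sup_norm (K : numFieldType) (V : normedModType K) (T : Type)
  (D : set T) (f : T -> V) : K := supremum 0 [set `|f x| | x in D].

Section sup_norm_theory.
Variables (R : realType) (k : scalar_kind).
Local Notation K := (scalars R k).

Lemma scalars_supremums (A : set K) : A !=set0 -> (forall x, A x -> 0 <= x) ->
  ubound A !=set0 -> supremums A !=set0.
Proof.
case: k A => A [x Ax] A0 [m Am].
  have hA : has_sup (A : set R) by split; [exists x|exists m].
  exists (sup (A : set R)); split; first by move=> y; apply: ub_le_sup; case: hA.
  by move=> y Ay; apply: ge_sup => //; case: hA.
have AR y : A y -> (complex.Re y)%:C%C = y.
  by move=> Ay; apply: RRe_real; apply: ger0_real; exact: A0.
pose B : set R := [set complex.Re y | y in A].
have mR : (complex.Re m)%:C%C = m.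
  by apply: RRe_real; apply: ger0_real; apply: le_trans (Am _ Ax); exact: A0.
have hB : has_sup B.
  split; first by exists (complex.Re x), x.
  by exists (complex.Re m) => _ [y Ay <-]; rewrite -lecR mR AR//; exact: Am.
exists (sup B)%:C%C; split.
  move=> y Ay; rewrite -(AR _ Ay) lecR; apply: ub_le_sup; first by case: hB.
  by exists y.
move=> y Ay.
have yR : (complex.Re y)%:C%C = y.
  by apply: RRe_real; apply: ger0_real; apply: le_trans (Ay _ Ax); exact: A0.
rewrite -yR lecR; apply: ge_sup; first by case: hB.
by move=> _ [z Az <-]; rewrite -lecR yR AR//; exact: Ay.
Qed.

Variables (V : normedModType K) (T : Type) (D : set T).
Hypothesis D0 : D !=set0.

Definition bounded_on (f : T -> V) := exists M : K, forall x, D x -> `|f x| <= M.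

Lemma sup_normP (f : T -> V) : bounded_on f ->
  (forall x, D x -> `|f x| <= sup_norm D f) /\
  (forall M, (forall x, D x -> `|f x| <= M) -> sup_norm D f <= M).
Proof.
move=> [M fM]; rewrite /sup_norm /supremum; case: ifPn => [/eqP A0|_].
  by case: D0 => x Dx; have : [set `|f x| | x in D] `|f x| by [exists x];
     rewrite A0.
have /cid [s [sub slb]] : supremums [set `|f x| | x in D] !=set0.
  apply: scalars_supremums.
  - by case: D0 => x Dx; exists `|f x|, x.
  - by move=> _ [x _ <-].
  - by exists M => _ [x Dx <-]; exact: fM.
case: xgetP => [y _ [yub ylb]|/(_ s) []//]; split.
  by move=> x Dx; apply: yub; exists x.
by move=> N fN; apply: ylb => _ [x Dx <-]; exact: fN.
Qed.

Lemma sup_norm_ge (f : T -> V) x : bounded_on f -> D x -> `|f x| <= sup_norm D f.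
Proof. by move=> /sup_normP [+ _]; exact. Qed.

Lemma sup_norm_le (f : T -> V) M : bounded_on f ->
  (forall x, D x -> `|f x| <= M) -> sup_norm D f <= M.
Proof. by move=> /sup_normP [_]; exact. Qed.

Lemma sup_normD (f g : T -> V) : bounded_on f -> bounded_on g ->
  sup_norm D (f + g) <= sup_norm D f + sup_norm D g.
Proof.
move=> fb gb; have le x : D x -> `|(f + g) x| <= sup_norm D f + sup_norm D g.
  by move=> Dx; apply: le_trans (ler_normD _ _) _; rewrite lerD// sup_norm_ge.
by apply: sup_norm_le => //; exists (sup_norm D f + sup_norm D g).
Qed.

Lemma sup_norm_ge0 (f : T -> V) : bounded_on f -> 0 <= sup_norm D f.
Proof. by case: D0 => x Dx fb; apply: le_trans (sup_norm_ge fb Dx). Qed.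

Lemma sup_normZ (a : K) (f : T -> V) : bounded_on f ->
  sup_norm D (a *: f) = `|a| * sup_norm D f.
Proof.
move=> fb; have le b g : bounded_on g -> bounded_on (b *: g) /\
    sup_norm D (b *: g) <= `|b| * sup_norm D g.
  move=> gb; have h x : D x -> `|(b *: g) x| <= `|b| * sup_norm D g.
    by move=> Dx; rewrite normrZ ler_wpM2l// sup_norm_ge.
  suff bb : bounded_on (b *: g) by split => //; exact: sup_norm_le.
  by exists (`|b| * sup_norm D g).
have [ab aleq] := le a f fb.
apply/eqP; rewrite eq_le aleq/=.
have [->|a0] := eqVneq a 0; first by rewrite normr0 mul0r scale0r sup_norm_ge0//;
  exists 0 => x _; rewrite normr0.
have [_] := le a^-1 _ ab; rewrite scalerA mulVf// scale1r normfV.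
by rewrite ler_pdivlMl// normr_gt0.
Qed.

Lemma sup_norm_eq0 (f : T -> V) : bounded_on f -> sup_norm D f = 0 ->
  forall x, D x -> f x = 0.
Proof.
move=> fb f0 x Dx; apply/eqP; rewrite -normr_le0 -f0.
exact: sup_norm_ge.
Qed.

End sup_norm_theory.

Section polynomials.
Variables (K : numFieldType) (E F : normedModType K) (n : nat).

Definition multilinear (A : ('I_n -> E) -> F) :=
  forall (i : 'I_n) (x : 'I_n -> E), linear (fun y => A (dfwith x i y)).

Definition homogeneous_polynomial (P : E -> F) :=
  exists2 A : ('I_n -> E) -> F, multilinear A & forall x, P x = A (fun=> x).

Definition continuous_hpoly : {pred E -> F} :=
  fun P => `[< homogeneous_polynomial P /\ continuous P >].

Lemma multilinearZ (A : ('I_n -> E) -> F) (c : K) (x : E) : multilinear A ->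
  A (fun=> c *: x) = c ^+ n *: A (fun=> x).
Proof.
move=> mA.
have step m : (m <= n)%N ->
    A (fun i : 'I_n => if (i < m)%N then c *: x else x) = c ^+ m *: A (fun=> x).
  elim: m => [_|m IH mn]; first by rewrite expr0 scale1r.
  pose i := Ordinal mn.
  pose z := fun i : 'I_n => if (i < m)%N then c *: x else x.
  have zE y : (fun j : 'I_n => if j == i then y else z j) = dfwith z i y.
    apply/funext => j; case: dfwithP => [|j' ij]; first by rewrite eqxx.
    by rewrite eq_sym (negbTE ij).
  have -> : (fun j : 'I_n => if (j < m.+1)%N then c *: x else x) =
      dfwith z i (c *: x).
    rewrite -zE; apply/funext => j; rewrite /z -val_eqE/= ltnS.
    by case: ltngtP.
  have zx : z = dfwith z i x.
    rewrite -zE; apply/funext => j; rewrite /z -val_eqE/=.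
    by case: ltngtP.
  have := mA i z c x 0; rewrite addr0.
  have := mA i z 0 x 0; rewrite !scale0r !add0r => h0 ->.
  have -> : A (dfwith z i 0) = 0.
    by have := mA i z 1 0 0; rewrite !scale1r addr0 -{1}[A _]addr0 => /addrI.
  by rewrite addr0 -zx IH ?(ltnW mn)// scalerA exprS.
have := step n (leqnn n).
by under eq_fun do rewrite ltn_ord.
Qed.

Lemma hpolyZ (P : E -> F) (c : K) (x : E) : homogeneous_polynomial P ->
  P (c *: x) = c ^+ n *: P x.
Proof. by move=> [A mA PA]; rewrite !PA multilinearZ. Qed.

Lemma continuous_hpoly_submod_closed : subsemimod_closed continuous_hpoly.
Proof.
have mZ (a : K) (A : ('I_n -> E) -> F) : multilinear A -> multilinear (a *: A).
  move=> mA i x c y z.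
  change (a *: A (dfwith x i (c *: y + z)) =
    c *: (a *: A (dfwith x i y)) + a *: A (dfwith x i z)).
  by rewrite mA scalerDr !scalerA mulrC.
split; [split|].
- apply/asboolP; split.
    exists (fun=> 0) => // i x c y z /=; by rewrite scaler0 addr0.
  exact: cst_continuous.
- move=> P Q /asboolP[[A mA PA] cP] /asboolP[[B mB QB] cQ]; apply/asboolP; split.
    exists (A \+ B) => [i x c y z|x]; last by rewrite /= -PA -QB.
    by rewrite /= mA mB scalerDr addrACA.
  by move=> x; apply: continuousD; [exact: cP|exact: cQ].
- move=> a P /asboolP[[A mA PA] cP]; apply/asboolP; split.
    exists (a *: A); first exact: mZ.
    by move=> x; change (a *: P x = a *: A (fun=> x)); rewrite PA.
  by move=> x; apply: cvgZ; [exact: cvg_cst|exact: cP].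
Qed.

HB.instance Definition _ := GRing.isSubmodClosed.Build K (E -> F) continuous_hpoly
  continuous_hpoly_submod_closed.

Record hpoly := HPoly {
  hpoly_fun :> E -> F ;
  hpoly_subproof : hpoly_fun \in continuous_hpoly }.

HB.instance Definition _ := [isSub for hpoly_fun].
HB.instance Definition _ := [Choice of hpoly by <:].
HB.instance Definition _ := [SubChoice_isSubLmodule of hpoly by <:].

Definition unit_ball : set E := [set x | `|x| <= 1].

Lemma unit_ball_neq0 : unit_ball !=set0.
Proof. by exists 0; rewrite /unit_ball/= normr0. Qed.

Lemma hpolyP (P : hpoly) : homogeneous_polynomial P /\ continuous P.
Proof. exact/asboolP/hpoly_subproof. Qed.

Lemma hpoly_bounded (P : hpoly) : exists M : K,
  forall x, unit_ball x -> `|P x| <= M.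
Proof.
have [hP cP] := hpolyP P.
have /cvgrPdist_le/(_ 1 ltr01)/nbhs_norm0P[/= d d0 Pd] := cP 0.
exists (`|((d / 2) ^+ n)^-1| * (1 + `|P 0|)) => x x1.
have d2 : 0 < d / 2 by rewrite divr_gt0.
have -> : P x = ((d / 2) ^+ n)^-1 *: P ((d / 2) *: x).
  by rewrite hpolyZ// scalerA mulVf ?scale1r// expf_neq0// gt_eqF.
rewrite normrZ ler_wpM2l//.
have : `|P 0 - P ((d / 2) *: x)| <= 1.
  apply: Pd => /=; rewrite normrZ gtr0_norm//.
  apply: (@le_lt_trans _ _ (d / 2)); first by rewrite ler_piMr// ltW.
  by rewrite ltr_pdivrMr// ltr_pMr// ltr1n.
move=> h; rewrite -[P (_ *: _)](subrK (P 0)).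
by apply: le_trans (ler_normD _ _) _; rewrite lerD2r distrC.
Qed.

Lemma hpoly_eq0 (P : hpoly) : (forall x, unit_ball x -> P x = 0) -> P = 0.
Proof.
have [hP _] := hpolyP P.
move=> P0; apply/val_inj/funext => x /=.
have [->|x0] := eqVneq x 0; first by rewrite P0// /unit_ball/= normr0.
rewrite -[x](@scalerKV _ _ `|x|) ?normr_eq0//.
rewrite hpolyZ// P0 ?scaler0//.
by rewrite /unit_ball/= normrZ normfV normr_id mulVf// normr_eq0.
Qed.

End polynomials.

Arguments unit_ball {K} E.

Section polynomial_space.
Variables (R : realType) (k : scalar_kind).
Local Notation K := (scalars R k).
Variables (E F : normedModType K) (n : nat).

Definition hpoly_norm (P : hpoly E F n) : K := sup_norm (unit_ball E) P.

Lemma hpoly_normD P Q : hpoly_norm (P + Q) <= hpoly_norm P + hpoly_norm Q.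
Proof. exact: (sup_normD (unit_ball_neq0 E) (hpoly_bounded P) (hpoly_bounded Q)). Qed.

Lemma hpoly_normZ a P : hpoly_norm (a *: P) = `|a| * hpoly_norm P.
Proof. exact: (sup_normZ (unit_ball_neq0 E) a (hpoly_bounded P)). Qed.

Lemma hpoly_norm_eq0 P : hpoly_norm P = 0 -> P = 0.
Proof.
move=> P0; apply: hpoly_eq0.
exact: (sup_norm_eq0 (unit_ball_neq0 E) (hpoly_bounded P)).
Qed.

HB.instance Definition _ := Lmodule_isNormed.Build K (hpoly E F n)
  hpoly_normD hpoly_normZ hpoly_norm_eq0.

End polynomial_space.

Section c0.
Variables (R : realType) (k : scalar_kind).
Local Notation K := (scalars R k).

Definition null_sequence : {pred nat -> K^o} := fun u => `[< u @ \oo --> 0 >].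

Lemma null_sequence_submod_closed : subsemimod_closed null_sequence.
Proof.
split; [split|].
- by apply/asboolP; exact: cvg_cst.
- move=> u v /asboolP u0 /asboolP v0; apply/asboolP.
  by rewrite -[X in _ --> X](addr0 0); exact: cvgD.
- move=> a u /asboolP u0; apply/asboolP.
  by rewrite -[X in _ --> X](scaler0 _ a); apply: cvgZ => //; exact: cvg_cst.
Qed.

HB.instance Definition _ := GRing.isSubmodClosed.Build K (nat -> K^o)
  null_sequence null_sequence_submod_closed.

Record c0 := C0Seq {
  c0_fun :> nat -> K^o ;
  c0_subproof : c0_fun \in null_sequence }.

HB.instance Definition _ := [isSub for c0_fun].
HB.instance Definition _ := [Choice of c0 by <:].
HB.instance Definition _ := [SubChoice_isSubLmodule of c0 by <:].

Definition c0_norm (u : c0) : K := sup_norm [set: nat] u.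

Lemma c0_bounded (u : c0) : bounded_on setT u.
Proof.
have /asboolP u0 := c0_subproof u.
have cu : cvgn (u : nat -> K^o) by apply/cvg_ex; exists 0.
have [M [Mr uM]] := cvg_seq_bounded cu.
exists (M + 1) => x _; apply: (uM (M + 1)) => //.
by rewrite ltrDl.
Qed.

Let natT0 : [set: nat] !=set0. Proof. by exists 0%N. Qed.

Lemma c0_normD u v : c0_norm (u + v) <= c0_norm u + c0_norm v.
Proof. exact: (sup_normD natT0 (c0_bounded u) (c0_bounded v)). Qed.

Lemma c0_normZ a u : c0_norm (a *: u) = `|a| * c0_norm u.
Proof. exact: (sup_normZ natT0 a (c0_bounded u)). Qed.

Lemma c0_norm_eq0 u : c0_norm u = 0 -> u = 0.
Proof.
move=> u0; apply/val_inj/funext => i /=.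
exact: (sup_norm_eq0 natT0 (c0_bounded u)).
Qed.

HB.instance Definition _ := Lmodule_isNormed.Build K c0
  c0_normD c0_normZ c0_norm_eq0.

End c0.

Section weak_topology.
Variables (K : numFieldType) (E : normedModType K).

Definition dual := {phi : {linear E -> K^o} | continuous phi}.

(* The coarsest topology on E for which all the elements of the dual are
   continuous. *)
Definition weak : topologicalType := sup_topology (fun phi : dual =>
  Topological.class (initial_topology (sval phi : E -> K^o))).

End weak_topology.

Definition weakly_continuous_on_bounded (K : numFieldType)
    (E F : normedModType K) (P : E -> F) :=
  forall B : set E, bounded_set B ->
    {within (B : set (weak E)), continuous (P : weak E -> F)}.

Definition Pw (R : realType) (k : scalar_kind)
    (E F : normedModType (scalars R k)) (n : nat) : set (hpoly E F n) :=
  [set P | weakly_continuous_on_bounded P].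

Definition finite_rank (K : numFieldType) (V W : lmodType K)
    (A : {linear V -> W}) :=
  exists (m : nat) (e : 'I_m -> W), forall x, exists c : 'I_m -> K,
    A x = \sum_(i < m) c i *: e i.

Definition unconditionally_converges (K : numFieldType) (V : normedModType K)
    (u : nat -> V) (l : V) :=
  forall s : nat -> nat, bijective s -> series (u \o s) @ \oo --> l.

Definition has_unconditional_fd_expansion (K : numFieldType)
    (G : normedModType K) :=
  exists A : nat -> {linear G -> G},
    [/\ forall i, continuous (A i), forall i, finite_rank (A i) &
        forall x, unconditionally_converges (fun i => A i x) x].

(* f is a linear homeomorphism of Y onto the closed subspace range f, which is
   contained in W. *)
Definition contains_copy (K : numFieldType) (X Y : normedModType K)
    (W : set X) :=
  exists f : {linear Y -> X},
    [/\ range f `<=` W, closed (range f), continuous f &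
        exists2 g : X -> Y, cancel f g & {within range f, continuous g}].
Arguments contains_copy {K X} Y W.

Definition complemented (K : numFieldType) (X : normedModType K) (W : set X) :=
  exists p : {linear X -> X},
    [/\ continuous p, p \o p =1 p & range p = W].

(* Main.v *)
Require Import Defs.
From HB Require Import structures.
From mathcomp Require Import all_boot all_order all_algebra.
From mathcomp Require Import all_classical all_reals all_analysis.
From mathcomp Require Import complex ring lra.

(* Write [P = Q \o T], let [S_m] be the partial sums of the expansion of the identity of [G],
   and let [M] be a polarization of [Q]. If [P] is weakly discontinuous at [xs] on a bounded
   set then, expanding [M (T xs + T h)], some term [d h] of degree [r > 0] in [T h] does not
   become small when [h] is bounded and weakly small; the slots of [T xs] may be filled with
   [S_N xs] for a large fixed [N]. A gliding hump then produces bounded [h_j] and consecutive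
   blocks [z_j] of the expansion such that [z_l (T h_j)] is close to [T h_j] if [l = j] and to
   [0] otherwise, while [d (h_j)] stays away from [0]. Let [P_j x] be [d x] with the [r]
   slots filled with [z_j (T x)] and the other ones with [S_N (T x)]: it has finite rank
   slots, so it is weakly continuous. Averaging over signs reduces the boundedness of
   [sum_j a_j P_j], for bounded scalars [a_j], to the unconditionality of the expansion.
   Evaluation at [xs + h_j] recovers [a_j d (h_j)] up to a small error, whence a copy of c0.

   Let [p] be a projection onto the weakly continuous polynomials. The difference of
   [a |-> sum_j a_j P_j] and of its composition with [p] is defined on bounded sequences and
   vanishes on the finitely supported ones. On an uncountable almost disjoint family of sets
   [B] of integers, it is therefore negligible at countably many prescribed tests for some
   [a = 1_B]. So [R = p (sum_(j in B) P_j)] is weakly continuous, but it is separated from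
   [R xs] at the points [xs + sum_t al_t h_(i_t)], where the [i_t] are three elements of [B]
   and the scalars [al_t] have sum zero; these points accumulate weakly at [xs]. *)

Set Implicit Arguments.
Unset Strict Implicit.
Unset Printing Implicit Defensive.

Import Order.TTheory GRing.Theory Num.Theory.
Import numFieldNormedType.Exports.

Local Open Scope classical_set_scope.
Local Open Scope ring_scope.

(** * Hahn-Banach theorem *)

Section HahnBanach.
Variables (R : realType) (K : nzRingType) (iota : {rmorphism R -> K}).
Variables (V : lmodType K) (p : V -> R).
Hypothesis pD : forall x y, p (x + y) <= p x + p y.
Hypothesis pZ : forall t x, 0 <= t -> p (iota t *: x) = t * p x.

Let dominated_graph (g : set (V * R)) :=
  [/\ forall u v, g u -> g v -> g (u.1 + v.1, u.2 + v.2),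
      forall t u, g u -> g (iota t *: u.1, t * u.2) &
      forall u, g u -> u.2 <= p u.1].

(** The graph contains [(0, t * (r - s))] for every real [t], and [p 0 = 0]; the values [1] and [-1]
    of [t] give both inequalities. *)
Let dominated_graph_fun g x r s :
  dominated_graph g -> g (x, r) -> g (x, s) -> r = s.
Proof.
move=> [gD gZ gp] gr gs.
have g0 t : t * (r - s) <= 0.
  have := gD _ _ (gZ t _ gr) (gZ (- t) _ gs); rewrite /= rmorphN scaleNr subrr.
  have p0 : p 0 = 0 by rewrite -(scale0r (0 : V)) -(rmorph0 iota) pZ// mul0r.
  by move=> /gp/=; rewrite p0 mulNr -mulrBr.
apply/eqP; rewrite -subr_eq0; apply/eqP; apply: le_anti.
have := g0 1; have := g0 (-1); rewrite mul1r mulN1r oppr_le0 => -> ->//.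
Qed.

Let dominated_graph_extend g x1 : dominated_graph g -> g !=set0 ->
  exists c, dominated_graph
    [set w | exists u t, g u /\ w = (u.1 + iota t *: x1, u.2 + t * c)].
Proof.
move=> [gD gZ gp] [u0 gu0].
have key u v : g u -> g v -> u.2 - p (u.1 - x1) <= p (v.1 + x1) - v.2.
  move=> gu gv; rewrite lerBlDr addrAC lerBrDr.
  apply: le_trans (gp _ (gD _ _ gu gv)) _.
  have -> : u.1 + v.1 = (v.1 + x1) + (u.1 - x1) by rewrite addrACA subrr addr0 addrC.
  exact: pD.
(* [key] separates these lower bounds for the value at [x1] from the upper bounds
   [p (v.1 + x1) - v.2]; their supremum is an admissible value. *)
pose S : set R := [set u.2 - p (u.1 - x1) | u in g].
have supS : has_sup S.
  split; first by exists (u0.2 - p (u0.1 - x1)), u0.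
  by exists (p (u0.1 + x1) - u0.2) => _ [u gu <-]; exact: key.
exists (sup S); split.
- move=> _ _ [u [t [gu ->]]] [v [s [gv ->]]] /=.
  exists (u.1 + v.1, u.2 + v.2), (t + s); split; first exact: gD.
  by rewrite /= rmorphD scalerDl mulrDl; congr (_, _); rewrite addrACA.
- move=> t _ [u [s [gu ->]]]; exists (iota t *: u.1, t * u.2), (t * s).
  by split; [exact: gZ|rewrite /= scalerDr mulrDr scalerA -rmorphM mulrA].
- move=> _ [u [t [gu ->]]] /=.
  have [t0|t0|<-] := ltgtP 0 t.
  + have : sup S <= p (iota t^-1 *: u.1 + x1) - t^-1 * u.2.
      apply: ge_sup; first by case: supS.
      by move=> _ [v gv <-]; have := key _ _ gv (gZ t^-1 _ gu).
    rewrite -(ler_pM2l t0) mulrBr -(pZ _ (ltW t0)) scalerDr scalerA -rmorphM.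
    by rewrite divff ?gt_eqF// rmorph1 scale1r mulrA divff ?gt_eqF// mul1r lerBrDl.
  + have nt0 : 0 < - t by rewrite oppr_gt0.
    have : - t^-1 * u.2 - p (iota (- t^-1) *: u.1 - x1) <= sup S.
      apply: ub_le_sup; first by case: supS.
      by eexists; first exact: (gZ (- t^-1) _ gu).
    rewrite -(ler_pM2l nt0) mulrBr -(pZ _ (ltW nt0)) scalerBr scalerA -rmorphM.
    rewrite mulrNN divff ?lt_eqF// rmorph1 scale1r mulrA mulrNN divff ?lt_eqF// mul1r.
    by rewrite lerBlDl mulNr lerBrDr rmorphN scaleNr opprK.
  + by rewrite mul0r rmorph0 scale0r !addr0; exact: gp.
Qed.

Lemma Hahn_Banach (y0 : V) : exists f : V -> R,
  [/\ forall x y, f (x + y) = f x + f y, forall t x, f (iota t *: x) = t * f x,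
      forall x, f x <= p x & f y0 = p y0].
Proof.
pose w0 := (y0, p y0).
(* The implication admits the empty graph, which is the union of the empty chain in Zorn's lemma.
   Maximality then forces [w0] into the graph, by comparison with the line through [w0]. *)
pose P (g : set (V * R)) := dominated_graph g /\ (g !=set0 -> g w0).
have [|A [[domA Aw0] maxA]] := @Zorn_bigcup _ P.
  move=> F FP totF; split; last first.
    by move=> [u [X FX Xu]]; exists X => //; apply: (FP _ FX).2; exists u.
  split.
  - move=> u v [X FX Xu] [Y FY Yv].
    have [XY|YX] := totF _ _ FX FY.
      by exists Y => //; have [[+ _ _] _] := FP _ FY; apply => //; exact: XY.
    by exists X => //; have [[+ _ _] _] := FP _ FX; apply => //; exact: YX.
  - by move=> t u [X FX Xu]; exists X => //; have [[_ + _] _] := FP _ FX; exact.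
  - by move=> u [X FX Xu]; have [[_ _ +] _] := FP _ FX; exact.
have p0 : p 0 = 0 by rewrite -(scale0r (0 : V)) -(rmorph0 iota) pZ// mul0r.
have {}Aw0 : A w0.
  apply: contrapT => nA.
  have A0 : A = set0 by have [//|/set0P/Aw0] := eqVneq A set0.
  pose g : set (V * R) := [set (iota t *: y0, t * p y0) | t in setT].
  apply: (maxA g); last first.
    split; last by move=> _; exists 1 => //; rewrite rmorph1 scale1r mul1r.
    split.
    - move=> _ _ [t _ <-] [s _ <-]; exists (t + s) => //=.
      by rewrite rmorphD scalerDl mulrDl.
    - by move=> s _ [t _ <-]; exists (s * t) => //=; rewrite rmorphM scalerA mulrA.
    - move=> _ [t _ <-] /=; have [t0|t0] := leP 0 t; first by rewrite pZ.
      have := pD (iota t *: y0) (iota (- t) *: y0).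
      rewrite rmorphN scaleNr subrr p0 -scaleNr -rmorphN (pZ (t := - t)) ?oppr_ge0; last exact: ltW.
      by rewrite mulNr subr_ge0.
  rewrite A0; split; first by move=> ? [].
  by move=> /(_ w0); apply; exists 1 => //; rewrite rmorph1 scale1r mul1r.
have /choice[f Af] : forall x, exists r, A (x, r).
  move=> x1; apply: contrapT => nA.
  have [|c domB] := dominated_graph_extend x1 domA; first by exists w0.
  apply: (maxA _ _ (conj domB _)) => [|_]; last first.
    by exists w0, 0; rewrite rmorph0 scale0r mul0r !addr0.
  split.
    by move=> [x r] Axr; exists (x, r), 0; rewrite rmorph0 scale0r mul0r !addr0.
  move=> /(_ (x1, c)) H; apply: nA; exists c; apply: H.
  exists (0, 0), 1; split; last by rewrite /= rmorph1 scale1r mul1r !add0r.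
  by have [_ /(_ 0 _ Aw0)] := domA; rewrite /= rmorph0 scale0r mul0r.
have uniqA := dominated_graph_fun domA.
have [AD AZ Ap] := domA.
exists f; split.
- by move=> x y; apply: uniqA (Af _) (AD _ _ (Af x) (Af y)).
- by move=> t x; apply: uniqA (Af _) (AZ _ _ (Af x)).
- by move=> x; exact: Ap (Af x).
- exact: uniqA (Af _) Aw0.
Qed.

End HahnBanach.

(** * Norms and scalars *)

Section NormEstimates.
Variable K : numFieldType.

Lemma linear_bound_continuous (V W : normedModType K) (f : {linear V -> W}) (C : K) :
  0 <= C -> (forall x, `|f x| <= C * `|x|) -> continuous f.
Proof.
move=> C0 fC x; apply/cvgrPdist_le => e e0.
(* [C + 1] replaces [C], which may vanish, as a divisor. *)
have C1 : 0 < C + 1 by rewrite ltr_wpDl.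
have d0 : 0 < e / (C + 1) by rewrite divr_gt0.
near=> y; rewrite -linearB (le_trans (fC _))//.
have : `|x - y| <= e / (C + 1) by near: y; apply: cvgr_dist_le => //; exact: cvg_id.
rewrite ler_pdivlMr// => /(le_trans _); apply.
by rewrite mulrC ler_wpM2l// lerDl.
Unshelve. all: by end_near. Qed.

Lemma continuous_linear_bound (V W : normedModType K) (f : {linear V -> W}) :
  continuous f -> exists2 C, 0 < C & forall x, `|f x| <= C * `|x|.
Proof.
move=> cf; have /cvgrPdist_le/(_ 1 ltr01)/nbhs_norm0P[/= d d0 fd] := cf 0.
have d2 : 0 < d / 2 by rewrite divr_gt0.
exists (d / 2)^-1 => [|x]; first by rewrite invr_gt0.
have [->|x0] := eqVneq x 0; first by rewrite linear0 !normr0 mulr0.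
have nx0 : 0 < `|x| by rewrite normr_gt0.
pose c := d / 2 / `|x|; have c0 : 0 < c by rewrite divr_gt0.
have : `|f (c *: x)| <= 1.
  have := fd (c *: x); rewrite /= linear0 sub0r normrN; apply.
  rewrite normrZ gtr0_norm// divfK ?gt_eqF//.
  by rewrite ltr_pdivrMr// ltr_pMr// ltr1n.
rewrite linearZ normrZ gtr0_norm// /c mulrAC ler_pdivrMr// mul1r => h.
by rewrite ler_pdivlMl.
Qed.

Lemma cvgn_distP (V : normedModType K) (u : nat -> V) (l : V) :
  u @ \oo --> l <->
  (forall e, 0 < e -> exists N, forall n, (N <= n)%N -> `|u n - l| <= e).
Proof.
split=> [/cvgrPdist_le ul e /ul[N _ uN]|ul].
  by exists N => n Nn; rewrite distrC; exact: uN.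
apply/cvgrPdist_le => e /ul[N uN]; exists N => // n Nn.
by rewrite distrC; exact: uN.
Qed.

Lemma complete_cvgn (V : completeNormedModType K) (u : nat -> V) :
  (forall e, 0 < e -> exists N, forall m n, (N <= m)%N -> (m <= n)%N ->
     `|u n - u m| <= e) ->
  cvgn u.
Proof.
move=> cu; apply/cauchy_cvgP/cauchy_exP => e e0.
have e2 : 0 < e / 2 by rewrite divr_gt0.
have [N uN] := cu _ e2.
exists (u N); exists N => // n Nn; rewrite -ball_normE/= distrC.
by apply: le_lt_trans (uN _ _ _ Nn) _ => //; rewrite ltr_pdivrMr// ltr_pMr// ltr1n.
Qed.

Lemma cvgn_norm_le (V : normedModType K) (u : nat -> V) (l a : V) (C : K) (N : nat) :
  u @ \oo --> l -> (forall n, (N <= n)%N -> `|u n - a| <= C) -> `|l - a| <= C.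
Proof.
move=> ul uC.
(* The order on complex scalars is partial: [C] is comparable with a norm because it is real, being
   above a norm. *)
have Cr : C \is Num.real by apply: ger0_real; exact: le_trans (normr_ge0 _) (uC N (leqnn N)).
have [//|lC] := real_leP (normr_real (l - a)) Cr.
have e0 : 0 < (`|l - a| - C) / 2 by rewrite divr_gt0// subr_gt0.
have /cvgn_distP/(_ _ e0)[M uM] := ul.
have /= h := uM _ (leq_maxl M N); have h' := uC _ (leq_maxr M N).
have : `|l - a| <= (`|l - a| - C) / 2 + C.
  apply: le_trans (lerD h h'); rewrite (distrC (u _) l); apply: le_trans (ler_normD _ _).
  by rewrite addrA subrK.
rewrite -lerBlDr ler_pdivlMr// mulrDr mulr1 gerDl.
by rewrite subr_le0 => /(lt_le_trans lC); rewrite ltxx.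
Qed.

End NormEstimates.

Lemma normc_i (R : rcfType) : `|'i%C : R[i]| = 1.
Proof. by rewrite normc_def /= expr0n expr1n add0r sqrtr1. Qed.

Lemma normc_ge_Im (R : rcfType) (x : R[i]) : `|complex.Im x|%:C%C <= `|x|.
Proof.
by have := normc_ge_Re (x * 'i%C); rewrite ReiNIm normrN normrM normc_i mulr1.
Qed.

Lemma normc_le_ReIm (R : rcfType) (x : R[i]) :
  `|x| <= (`|complex.Re x| + `|complex.Im x|)%:C%C.
Proof.
rewrite {1}[x]complexE (le_trans (ler_normD _ _))// normrM normc_i mul1r.
by rewrite rmorphD !normc_def /= !expr0n !addr0 !sqrtr_sqr.
Qed.

Section Scalars.
Variables (R : realType) (k : scalar_kind).
Local Notation K := (scalars R k).

Lemma scalars_archi (x y : K) : 0 < x -> exists N : nat, `|y| <= N%:R * x.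
Proof.
case: k x y => /= x y x0.
  exists (Num.truncn (`|y| / x)).+1.
  by rewrite -ler_pdivrMr// ltW// truncnS_gt.
have xr : x = (complex.Re x)%:C%C.
  by rewrite RRe_real//; apply: ger0_real; exact: ltW.
have rx0 : 0 < complex.Re x by rewrite -ltcR -xr.
exists (Num.truncn (Num.sqrt (complex.Re y ^+ 2 + complex.Im y ^+ 2) / complex.Re x)).+1.
rewrite normc_def xr -(rmorph_nat (real_complex R)) -rmorphM/= lecR.
by rewrite -ler_pdivrMr// ltW// truncnS_gt.
Qed.

Lemma pow2_archi (x : K) : 0 < x -> exists N : nat, 2^-1 ^+ N <= x.
Proof.
move=> x0; have [N] := scalars_archi 1 x0; rewrite normr1 => N1.
have N2 : (N <= 2 ^ N)%N by rewrite ltnW// ltn_expl.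
exists N; rewrite exprVn invf_ple ?posrE ?exprn_gt0//.
rewrite -[x^-1]mul1r ler_pdivrMr// (le_trans N1)// ler_wpM2r//; first exact: ltW.
by rewrite -natrX ler_nat.
Qed.

Lemma scalars_cauchy_cvg (u : nat -> K^o) :
  (forall e : K, 0 < e -> exists N, forall m n, (N <= m)%N -> (m <= n)%N ->
     `|u n - u m| <= e) ->
  exists l : K^o, u @ \oo --> l.
Proof.
case: k u => /= u cu.
  by apply/cvg_ex; apply: (@complete_cvgn R R^o).
have [a ua] : exists a : R, (fun n => complex.Re (u n) : R^o) @ \oo --> a.
  apply/cvg_ex; apply: (@complete_cvgn R R^o) => e e0.
  have [|N uN] := cu e%:C%C; first by rewrite ltcR.
  exists N => m n Nm mn; have := uN _ _ Nm mn.
  by move=> /(le_trans (normc_ge_Re _)); rewrite lecR raddfB.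
have [b ub] : exists a : R, (fun n => complex.Im (u n) : R^o) @ \oo --> a.
  apply/cvg_ex; apply: (@complete_cvgn R R^o) => e e0.
  have [|N uN] := cu e%:C%C; first by rewrite ltcR.
  exists N => m n Nm mn; have := uN _ _ Nm mn.
  by move=> /(le_trans (normc_ge_Im _)); rewrite lecR raddfB.
exists (Complex a b); apply/cvgn_distP => e e0.
have er : e = (complex.Re e)%:C%C by rewrite RRe_real//; apply: ger0_real; exact: ltW.
have e2 : 0 < complex.Re e / 2 by rewrite divr_gt0// -ltcR -er.
have [N1 h1] := (cvgn_distP _ _).1 ua _ e2.
have [N2 h2] := (cvgn_distP _ _).1 ub _ e2.
exists (maxn N1 N2) => n; rewrite geq_max => /andP[/h1 {}h1 /h2 {}h2].
rewrite (le_trans (normc_le_ReIm _))// er lecR [complex.Re e]splitr lerD//.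
  by move: h1; rewrite raddfB.
by move: h2; rewrite raddfB.
Qed.

End Scalars.

Lemma infinite_pigeonhole (M : set nat) (f : nat -> nat) (N : nat) :
  infinite_set M -> (forall i, M i -> (f i < N)%N) ->
  exists m, infinite_set (M `&` [set i | f i = m]).
Proof.
move=> Minf fN; apply: contrapT => /forallNP fin; apply: Minf.
have -> : M = \bigcup_(m in `I_N) (M `&` [set i | f i = m]).
  apply/seteqP; split=> [i Mi|i [m _ []//]].
  by exists (f i) => //; exact: fN.
apply: bigcup_finite; first exact: finite_II.
by move=> m _; apply: contrapT; exact: fin.
Qed.

(** The interval [[-C, C]] is cut into finitely many cells of length [d]; some cell contains [u i]
    for infinitely many [i]. *)
Lemma realType_clustering (R : realType) (M : set nat) (u : nat -> R) (C d : R) :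
  infinite_set M -> (forall i, M i -> `|u i| <= C) -> 0 < d ->
  exists M', [/\ infinite_set M', M' `<=` M &
    forall i j, M' i -> M' j -> `|u i - u j| <= d].
Proof.
move=> Minf uC d0; pose f i := Num.truncn ((u i + C) / d).
have uf i : M i -> 0 <= (u i + C) / d <= (C + C) / d.
  move=> Mi; have := uC _ Mi; rewrite ler_norml => /andP[lo hi].
  by rewrite divr_ge0 ?(ltW d0)//= -?lerBlDr ?sub0r// ler_pM2r ?invr_gt0// lerD2r.
have [|m fm] := @infinite_pigeonhole M f (Num.truncn ((C + C) / d)).+1 Minf.
  by move=> i /uf/andP[_]; rewrite /f ltnS; exact: le_truncn.
exists (M `&` [set i | f i = m]); split=> // i j [Mi fi] [Mj fj].
have [/andP[i0 _] /andP[j0 _]] := (uf _ Mi, uf _ Mj).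
have /andP[] := truncn_itv i0; have /andP[] := truncn_itv j0.
rewrite -/(f i) -/(f j) fi fj !ler_pdivlMr// !ltr_pdivrMr// -natr1 mulrDl mul1r.
by move=> *; rewrite ler_norml; apply/andP; split; lra.
Qed.

Section Scalars.
Variables (R : realType) (k : scalar_kind).
Local Notation K := (scalars R k).

Lemma scalars_clustering (M : set nat) (u : nat -> K) (C d : K) :
  infinite_set M -> (forall i, M i -> `|u i| <= C) -> 0 < d ->
  exists M', [/\ infinite_set M', M' `<=` M &
    forall i j, M' i -> M' j -> `|u i - u j| <= d].
Proof.
case: k u C d => /= u C d Minf uC d0; first exact: (realType_clustering Minf uC d0).
have dr : d = (complex.Re d)%:C%C by rewrite RRe_real//; apply: ger0_real; exact: ltW.
have d2 : 0 < complex.Re d / 2 by rewrite divr_gt0// -ltcR -dr.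
have [i0 Mi0] := infinite_setN0 Minf.
have Cr : C = (complex.Re C)%:C%C.
  by rewrite RRe_real//; apply: ger0_real; apply: le_trans (uC _ Mi0).
have [|M1 [M1inf M1M h1]] :=
    @realType_clustering R M (fun i => complex.Re (u i)) (complex.Re C) _ Minf _ d2.
  by move=> i Mi; rewrite -lecR -Cr (le_trans (normc_ge_Re _))// uC.
have [|M2 [M2inf M2M h2]] :=
    @realType_clustering R M1 (fun i => complex.Im (u i)) (complex.Re C) _ M1inf _ d2.
  by move=> i /M1M Mi; rewrite -lecR -Cr (le_trans (normc_ge_Im _))// uC.
exists M2; split=> //; first exact: subset_trans M1M.
move=> i j Mi Mj; rewrite (le_trans (normc_le_ReIm _))// dr lecR.
rewrite [complex.Re d]splitr raddfB raddfB.
by apply: lerD; [apply: h1; exact: M2M|exact: h2].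
Qed.

(** Reduces coefficients bounded by 1 to coefficients in [[0, 1]], for which convexity is available.
    The scalar [c] is [0] over the reals and the imaginary unit over the complex numbers. *)
Lemma scalars_decomposition : exists2 c : K, `|c| <= 1 &
  forall t : K, `|t| <= 1 -> exists t1 t2 t3 t4 : K, t = (t1 - t2) + c * (t3 - t4) /\
    [/\ 0 <= t1 <= 1, 0 <= t2 <= 1, 0 <= t3 <= 1 & 0 <= t4 <= 1].
Proof.
have real_decomp (x : R) : `|x| <= 1 ->
    exists a b : R, [/\ x = a - b, 0 <= a <= 1 & 0 <= b <= 1].
  rewrite ler_norml => /andP[x1 x2]; have [x0|/ltW x0] := leP 0 x.
    by exists x, 0; rewrite subr0 x0 x2 lexx ler01.
  by exists 0, (- x); rewrite sub0r opprK lexx ler01 oppr_ge0 x0 lerNl.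
case: k => /=.
  exists 0 => [|t t1]; first by rewrite normr0.
  have [a [b [-> ? ?]]] := real_decomp t t1.
  by exists a, b, 0, 0; rewrite mul0r addr0 ler01 lexx.
exists 'i%C => [|t t1]; first by rewrite normc_i.
have [|a [b [ta a1 b1]]] := real_decomp (complex.Re t).
  by rewrite -lecR (le_trans (normc_ge_Re _)).
have [|c [d [tc c1 d1]]] := real_decomp (complex.Im t).
  by rewrite -lecR (le_trans (normc_ge_Im _)).
exists a%:C%C, b%:C%C, c%:C%C, d%:C%C; rewrite {1}[t]complexE ta tc !rmorphB; split=> //.
by split; rewrite !lecR.
Qed.

End Scalars.

Lemma norming_functional (R : realType) (k : scalar_kind)
    (E : normedModType (scalars R k)) (y0 : E) :
  exists psi : {linear E -> (scalars R k)^o},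
    [/\ continuous psi, forall x, `|psi x| <= `|x| & `|psi y0| = `|y0|].
Proof.
suff [psi [lpsi psi1 psiy]] : exists psi : E -> (scalars R k)^o,
    [/\ linear psi, forall x, `|psi x| <= `|x| & `|psi y0| = `|y0|].
  pose psiL : {linear E -> (scalars R k)^o} :=
    HB.pack psi (GRing.isLinear.Build _ _ _ _ _ lpsi).
  exists psiL; split=> //; apply: (@linear_bound_continuous _ _ _ psiL 1) => // x.
  by rewrite mul1r psi1.
case: k E y0 => /= E y0.
  have [|t x t0|f [fD fZ fp fy]] :=
      @Hahn_Banach R R idfun E (fun x : E => `|x|) _ _ y0.
  - exact: ler_normD.
  - by rewrite normrZ ger0_norm.
  have f1 x : `|f x| <= `|x|.
    have fN : f (- x) = - f x by rewrite -scaleN1r fZ mulN1r.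
    by rewrite ler_norml fp andbT lerNl -fN -(normrN x) fp.
  exists f; split=> //; first by move=> a x y; rewrite fD fZ.
  by rewrite fy normr_id.
pose p (x : E) := complex.Re `|x|.
have pE x : (p x)%:C%C = `|x| by rewrite RRe_real// normr_real.
have [x y|t x t0|g [gD gZ gp gy]] := @Hahn_Banach R R[i] (real_complex R) E p _ _ y0.
- by have := ler_normD x y; rewrite -!pE -rmorphD lecR.
- by apply: complexI; rewrite rmorphM pE normrZ ger0_norm ?ler0c -?pE.
have gN x : g (- x) = - g x.
  by rewrite -scaleN1r -(rmorphN1 (real_complex R)) gZ mulN1r.
(* The complex-linear functional whose real part is the real-linear functional [g]. *)
pose psi (x : E) : R[i]^o := Complex (g x) (- g ('i%C *: x)).
have psiD x y : psi (x + y) = psi x + psi y.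
  by rewrite /psi scalerDr !gD opprD.
have psii x : psi ('i%C *: x) = 'i%C * psi x.
  rewrite /psi scalerA -expr2 sqr_i scaleN1r gN opprK; apply/eqP.
  by rewrite eq_complex /=; apply/andP; split; apply/eqP; ring.
have psiR t x : psi (t%:C%C *: x) = t%:C%C * psi x.
  rewrite /psi scalerA mulrC -scalerA !gZ; apply/eqP.
  by rewrite eq_complex /=; apply/andP; split; apply/eqP; ring.
have lpsi : linear psi.
  move=> a x y; rewrite psiD [in LHS](complexE a) scalerDl psiD -scalerA psii !psiR.
  by rewrite mulrA -mulrDl -complexE.
have psi1 x : `|psi x| <= `|x|.
  have [->|px0] := eqVneq (psi x) 0; first by rewrite normr0.
  (* Multiplying [x] by the unimodular [c] makes [psi (c *: x)] real, hence equal to [g (c *: x)],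
     which is dominated by [p]. *)
  pose c := `|psi x| / psi x.
  have c1 : `|c| = 1 by rewrite normrM normfV normr_id divff// normr_eq0.
  have psic : psi (c *: x) = `|psi x|.
    have psi0 : psi 0 = 0 by rewrite -(scale0r (0 : E)) (psiR 0) rmorph0 mul0r.
    by have := lpsi c x 0; rewrite psi0 !addr0 => ->; rewrite /GRing.scale/= divfK.
  rewrite -psic.
  have -> : psi (c *: x) = (g (c *: x))%:C%C.
    by rewrite -[psi _]RRe_real// psic normr_real.
  by rewrite -[`|x|]mul1r -c1 -normrZ -pE lecR.
exists psi; split=> //; apply: le_anti; rewrite psi1/=.
rewrite -pE -gy (le_trans _ (normc_ge_Re _))// lecR.
exact: ler_norm.
Qed.

(** * Weak topology *)

Section WeakTopology.
Variables (K : numFieldType) (E : normedModType K).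

Lemma weak_cvgP (F : set_system E) (x : E) : Filter F ->
  F --> (x : weak E) <-> forall phi : dual E, sval phi @ F --> sval phi x.
Proof.
move=> FF; rewrite cvg_sup; split=> Fx phi.
  apply: cvg_trans; last exact: (@initial_continuous _ _ (sval phi : E -> K^o) x).
  move=> A /= A1; exact: (Fx phi).
move=> A; rewrite nbhsE => -[B [[C oC <-] Cx] BA].
rewrite nbhs_filterE; apply: filterS BA _.
by apply: (Fx phi); exact: open_nbhs_nbhs.
Qed.

Lemma dual_weak_continuous (phi : dual E) :
  continuous (sval phi : weak E -> K^o).
Proof. by move=> x; exact: ((weak_cvgP x (nbhs_filter (x : weak E))).1 _ phi). Qed.

Lemma dual_of_bound (phi : E -> K^o) (C : K) : linear phi -> 0 <= C ->
  (forall x, `|phi x| <= C * `|x|) -> exists psi : dual E, sval psi = phi :> (E -> K^o).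
Proof.
move=> lphi C0 phiC.
pose phiL : {linear E -> K^o} := HB.pack phi (GRing.isLinear.Build _ _ _ _ _ lphi).
have cphi : continuous phiL by exact: (linear_bound_continuous C0).
by exists (exist _ phiL cphi).
Qed.

End WeakTopology.

Section FiniteRank.
Variables (R : realType) (k : scalar_kind).
Local Notation K := (scalars R k).
Variables (E G : normedModType K).

(** Induction on the number of spanning vectors. If the last one is needed in the expansion of some
    [y1 = V x1], then [V] is the sum of the rank one operator [chi (V x) *: y1], with [chi y1 = 1],
    and of an operator [V'] with values in a span of [m] vectors. *)
Let finite_span_weak_continuous (m : nat) (e : 'I_m -> G) (V : E -> G) (C : K) :
  linear V -> 0 <= C -> (forall x, `|V x| <= C * `|x|) ->
  (forall x, exists c : 'I_m -> K, V x = \sum_(i < m) c i *: e i) ->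
  continuous (V : weak E -> G).
Proof.
elim: m e V C => [|m IH] e V C lV C0 VC Ve.
  have -> : V = cst 0 by apply/funext => x; have [c ->] := Ve x; rewrite big_ord0.
  exact: cst_continuous.
have [small|] := pselect (forall x, exists c : 'I_m -> K,
    V x = \sum_(i < m) c i *: e (widen_ord (leqnSn m) i)).
  exact: (IH _ V C lV C0 VC small).
move=> /existsNP[x1 nx1]; have [c1 Vx1] := Ve x1; set y1 := V x1 in Vx1 nx1.
have c1m : c1 ord_max != 0.
  apply/eqP => c10; apply: nx1; exists (c1 \o widen_ord (leqnSn m)).
  by rewrite Vx1 big_ord_recr/= c10 scale0r addr0.
have y10 : y1 != 0.
  apply/eqP => y10; apply: nx1; exists (fun=> 0).
  by rewrite y10 big1// => i _; rewrite scale0r.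
have [psi [_ psi1 psiy]] := norming_functional y1.
have psiy0 : psi y1 != 0 by rewrite -normr_eq0 psiy normr_eq0.
pose chi (y : G) : K^o := (psi y1)^-1 *: psi y.
have chiy : chi y1 = 1 by rewrite /chi /GRing.scale/= mulVf.
have lchi : linear chi.
  by move=> a x y; rewrite /chi linearP scalerDr !scalerA mulrC.
have chiB y : `|chi y| <= `|(psi y1)^-1| * `|y| by rewrite normrZ ler_wpM2l.
pose e' i := e i - chi (e i) *: y1.
have chi0 : chi 0 = 0 by rewrite /chi linear0 scaler0.
have chiD a b : chi (a + b) = chi a + chi b.
  by have := lchi 1 a b; rewrite !scale1r.
have chiZ a b : chi (a *: b) = a * chi b.
  by have := lchi a b 0; rewrite chi0 !addr0.
have proj_sum (c : 'I_m.+1 -> K) y : y = \sum_i c i *: e i ->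
    y - chi y *: y1 = \sum_i c i *: e' i.
  move=> ->; rewrite (big_morph chi chiD chi0) scaler_suml -sumrB.
  by apply: eq_bigr => i _; rewrite chiZ scalerBr scalerA.
pose V' x := V x - chi (V x) *: y1.
have lchiV : linear (chi \o V) by move=> a x y /=; rewrite lV lchi.
have cV' : continuous (V' : weak E -> G).
  apply: (IH (e' \o widen_ord (leqnSn m)) V' (C + `|(psi y1)^-1| * C * `|y1|)).
  - move=> a x y; rewrite /V' lV chiD chiZ scalerDl scalerBr scalerA.
    by rewrite opprD addrACA.
  - by rewrite addr_ge0// !mulr_ge0.
  - move=> x; rewrite /V' (le_trans (ler_normB _ _))// mulrDl lerD//.
    rewrite normrZ mulrAC ler_wpM2r// (le_trans (chiB _))// -mulrA ler_wpM2l//.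
  - move=> x; have [c Vx] := Ve x.
    exists (fun i => let j := widen_ord (leqnSn m) i in
              c j - c ord_max / c1 ord_max * c1 j).
    (* The projection along [y1] kills [y1]; since [c1 ord_max] is nonzero, this relation eliminates
       the last projected vector. *)
    have e'm : c1 ord_max *: e' ord_max =
        - \sum_(i < m) c1 (widen_ord (leqnSn m) i) *: e' (widen_ord (leqnSn m) i).
      apply/eqP; rewrite -addr_eq0 addrC -(@big_ord_recr _ _ _ _ (fun i => c1 i *: e' i)).
      by rewrite -(proj_sum _ _ Vx1) chiy scale1r subrr.
    rewrite /V' (proj_sum _ _ Vx) big_ord_recr/=.
    rewrite -[c ord_max](divfK c1m) -[(_ * c1 ord_max) *: _]scalerA e'm.
    rewrite scalerN scaler_sumr -sumrB; apply: eq_bigr => i _.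
    by rewrite divfK// scalerBl scalerA.
have -> : V = fun x => V' x + chi (V x) *: y1 by apply/funext => x; rewrite subrK.
have [phi phiE] : exists phi : dual E, sval phi = chi \o V :> (E -> K^o).
  apply: (@dual_of_bound _ _ _ (`|(psi y1)^-1| * C)) => //; first by rewrite mulr_ge0.
  by move=> x; rewrite (le_trans (chiB _))// -mulrA ler_wpM2l.
move=> x; apply: continuousD; first exact: cV'.
have H := @dual_weak_continuous _ _ phi x; rewrite phiE in H.
exact: (@cvgZr_tmp K G _ _ (nbhs_filter (x : weak E)) _ _ _ H).
Qed.

Lemma finite_rank_weak_continuous (V : {linear E -> G}) :
  continuous V -> finite_rank V -> continuous (V : weak E -> G).
Proof.
move=> /continuous_linear_bound[C C0 VC] [m [e Ve]].
by apply: (finite_span_weak_continuous (linearP V) (ltW C0) VC Ve).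
Qed.

End FiniteRank.

(** * Multilinear forms *)

Section Multilinear.
Variables (K : numFieldType) (E F : normedModType K).

Section Slots.
Variables (n : nat) (A : ('I_n -> E) -> F).
Hypothesis mA : multilinear A.

Lemma multilinearD x i y z :
  A (dfwith x i (y + z)) = A (dfwith x i y) + A (dfwith x i z).
Proof. by have := mA i x 1 y z; rewrite !scale1r. Qed.

Lemma multilinear_slot0 x i : A (dfwith x i 0) = 0.
Proof.
by have := multilinearD x i 0 0; rewrite addr0 => /eqP; rewrite addrC -subr_eq subrr => /eqP.
Qed.

Lemma multilinear_slotZ x i a y : A (dfwith x i (a *: y)) = a *: A (dfwith x i y).
Proof. by have := mA i x a y 0; rewrite multilinear_slot0 !addr0. Qed.

Lemma multilinear_slotB x i y z :
  A (dfwith x i (y - z)) = A (dfwith x i y) - A (dfwith x i z).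
Proof. by rewrite multilinearD -scaleN1r multilinear_slotZ scaleN1r. Qed.

Lemma multilinear_slot_sum (I : Type) (r : seq I) (P : pred I) (v : I -> E) x i :
  A (dfwith x i (\sum_(t <- r | P t) v t)) = \sum_(t <- r | P t) A (dfwith x i (v t)).
Proof.
exact: (big_morph (fun y => A (dfwith x i y)) (multilinearD x i) (multilinear_slot0 x i)).
Qed.

Lemma dfwith_id (x : 'I_n -> E) i : dfwith x i (x i) = x.
Proof. by apply/funext => j; case: dfwithP. Qed.

Lemma multilinear_eq0 x i : x i = 0 -> A x = 0.
Proof. by move=> xi0; rewrite -(dfwith_id x i) xi0 multilinear_slot0. Qed.

End Slots.

Let fcons n (y : E) (x : 'I_n -> E) : 'I_n.+1 -> E :=
  fun i => if unlift ord0 i is Some j then x j else y.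

Let fconsE n (x : 'I_n.+1 -> E) : fcons (x ord0) (x \o lift ord0) = x.
Proof. by apply/funext => i; rewrite /fcons; case: unliftP => [j ->|->]. Qed.

Let fcons_dfwith n y (x : 'I_n -> E) i z :
  fcons y (dfwith x i z) = dfwith (fcons y x) (lift ord0 i) z.
Proof.
apply/funext => j; rewrite /fcons; case: unliftP => [j' ->|->].
  have [->|ij] := eqVneq i j'; first by rewrite !dfwithin.
  by rewrite !dfwithout// ?liftK.
by rewrite dfwithout ?unlift_none// eq_sym neq_lift.
Qed.

Let fcons_ord0 n y (x : 'I_n -> E) z : fcons z x = dfwith (fcons y x) ord0 z.
Proof.
apply/funext => j; rewrite /fcons; case: unliftP => [j' ->|->]; last by rewrite dfwithin.
by rewrite dfwithout ?liftK// neq_lift.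
Qed.

Lemma multilinear_expand n (A : ('I_n -> E) -> F) (T : finType) (v : 'I_n -> T -> E) :
  multilinear A ->
  A (fun i => \sum_t v i t) = \sum_(f : {ffun 'I_n -> T}) A (fun i => v i (f i)).
Proof.
elim: n A v => [|n IH] A v mA.
  have h (x y : 'I_0 -> E) : A x = A y by congr A; apply/funext; case.
  under eq_bigr do rewrite (h _ (fun i => \sum_t v i t)).
  by rewrite sumr_const card_ffun card_ord expn0.
pose w := fun i : 'I_n => v (lift ord0 i).
have mA' y : multilinear (A \o fcons y).
  by move=> i x a z z' /=; rewrite !fcons_dfwith mA.
rewrite -[X in A X]fconsE (fcons_ord0 0) (multilinear_slot_sum mA).
under eq_bigr => t _.
  rewrite -fcons_ord0 [A _](_ : _ = (A \o fcons (v ord0 t)) (fun i => \sum_s w i s))//.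
  rewrite (IH _ w (mA' _)); over.
rewrite pair_big/=.
pose h (p : T * {ffun 'I_n -> T}) : {ffun 'I_n.+1 -> T} :=
  [ffun i => if unlift ord0 i is Some j then p.2 j else p.1].
pose h' (g : {ffun 'I_n.+1 -> T}) : T * {ffun 'I_n -> T} :=
  (g ord0, [ffun j => g (lift ord0 j)]).
rewrite [RHS](reindex h) /=; last first.
  exists h' => [[t f] _|g _]; rewrite /h /h' /=.
    congr (_, _); first by rewrite ffunE unlift_none.
    by apply/ffunP => j; rewrite !ffunE liftK.
  by apply/ffunP => i; rewrite ffunE; case: unliftP => [j ->|->]; rewrite ?ffunE.
apply: eq_bigr => -[t f] _ /=; congr A; apply/funext => i.
by rewrite /fcons /h ffunE; case: unliftP => [j ->|->].
Qed.

Lemma multilinear_expandD n (A : ('I_n -> E) -> F) (y e : 'I_n -> E) : multilinear A ->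
  A (fun i => y i + e i) =
  \sum_(f : {ffun 'I_n -> bool}) A (fun i => if f i then e i else y i).
Proof.
move=> mA; rewrite -(multilinear_expand (fun i (b : bool) => if b then e i else y i) mA).
by congr A; apply/funext => i; rewrite big_bool addrC.
Qed.

Section Polarization.
Variables (n : nat) (A : ('I_n -> E) -> F).
Hypothesis mA : multilinear A.

(** The permutations of the slots are given as injective functions, which places them in the index
    set of [multilinear_expand]. There is no division by the factorial; it is kept as the nonzero
    scalar of [hpoly_polarization]. *)
Definition symmetrization (x : 'I_n -> E) : F :=
  \sum_(f : {ffun 'I_n -> 'I_n} | injectiveb f) A (x \o f).

Lemma symmetrization_multilinear : multilinear symmetrization.
Proof.
move=> i x a y z; rewrite /symmetrization scaler_sumr -big_split/=.
apply: eq_bigr => f /injectiveP finj.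
have xf w : dfwith x i w \o f = dfwith (x \o f) (invF finj i) w.
  apply/funext => j /=; have [<-|ij] := eqVneq (invF finj i) j.
    by rewrite f_invF !dfwithin.
  by rewrite !dfwithout//; apply: contra_neq ij => ->; rewrite invF_f.
by rewrite !xf mA.
Qed.

Lemma symmetrization_diag (x : E) :
  symmetrization (fun=> x) =
  #|[pred f : {ffun 'I_n -> 'I_n} | injectiveb f]|%:R *: A (fun=> x).
Proof. by rewrite scaler_nat -sumr_const; apply: eq_bigl => f; rewrite inE. Qed.

Lemma card_inj_ffun_neq0 :
  #|[pred f : {ffun 'I_n -> 'I_n} | injectiveb f]|%:R != 0 :> K.
Proof.
rewrite pnatr_eq0 -lt0n; apply/card_gt0P; exists [ffun i => i].
by rewrite inE; apply/injectiveP => i j; rewrite !ffunE.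
Qed.

(** If [f] is injective, it is onto and only the full set contributes. Otherwise [f] misses some
    [t], and toggling the membership of [t] in [S] is an involution which reverses signs. *)
Let alternating_sum (f : {ffun 'I_n -> 'I_n}) :
  \sum_(S : {set 'I_n} | [forall i, f i \in S]) (-1) ^+ #|~: S| =
  (injectiveb f)%:R :> K.
Proof.
case: injectiveP => [finj|ninj].
  rewrite (big_pred1 [set: 'I_n]%SET) ?finset.setCT ?cards0// => S /=.
  apply/forallP/eqP => [fS|->]; last by move=> i; rewrite inE.
  by apply/finset.setP => i; rewrite inE -(f_invF finj i) fS.
have [t tf] : exists t, t \notin codom f.
  apply: contrapT => /forallNP h; apply: ninj; apply/injectiveP/card_uniqP.
  have cf : [seq f x | x in 'I_n] =i 'I_n by move=> j; apply/negPn/negP => /h.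
  by rewrite (eq_card cf) size_map -cardE.
pose toggle (S : {set 'I_n}) := if t \in S then S :\ t else t |: S.
have toggleK : involutive toggle.
  move=> S; rewrite /toggle; have [tS|tS] := boolP (t \in S).
    by rewrite finset.setD11 finset.setD1K.
  by rewrite finset.setU11 finset.setU1K.
set s := LHS.
have : s = - s.
  rewrite {1}/s (reindex_inj (inv_inj toggleK)) /s -sumrN.
  apply: eq_big => [S|S _].
    apply: eq_forallb => i; have fit : f i != t.
      by apply: contraNneq tf => <-; exact: codom_f.
    by rewrite /toggle; case: ifP => _; rewrite !inE (negbTE fit).
  rewrite /toggle; case: ifP => tS.
    by rewrite finset.setCD finset.setUC (cardsU1 t) inE tS/= exprS mulN1r.
  by rewrite [in RHS](cardsD1 t) inE tS/= exprS mulN1r opprK finset.setCU finset.setIC -finset.setDE.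
by move=> /eqP; rewrite -addr_eq0 -mulr2n mulrn_eq0 => /eqP.
Qed.

(** Each diagonal value is expanded over all functions [f]; after exchanging the sums,
    [alternating_sum] leaves the injective ones. The formula bounds the symmetrization by values of
    the polynomial alone. *)
Lemma polarization (x : 'I_n -> E) : symmetrization x =
  \sum_(S : {set 'I_n}) (-1) ^+ #|~: S| *: A (fun=> \sum_(i in S) x i).
Proof.
under [RHS]eq_bigr => S _.
  have -> : (fun=> \sum_(i in S) x i) = fun _ : 'I_n => \sum_i (i \in S)%:R *: x i.
    apply/funext => _; rewrite big_mkcond; apply: eq_bigr => i _.
    by case: (i \in S); rewrite ?scale1r ?scale0r.
  rewrite (multilinear_expand (fun=> fun i => (i \in S)%:R *: x i) mA) scaler_sumr.
  over.
rewrite exchange_big /symmetrization big_mkcond; apply: eq_bigr => f _ /=.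
transitivity ((injectiveb f)%:R *: A (x \o f)).
  by case: ifP; rewrite ?scale1r ?scale0r.
rewrite -alternating_sum scaler_suml big_mkcond; apply: eq_bigr => S _.
case: ifPn => [/forallP fS|].
  by congr (_ *: A _); apply/funext => i /=; rewrite fS scale1r.
rewrite negb_forall => /existsP[i fiS].
by rewrite (@multilinear_eq0 _ _ mA _ i) ?scaler0// (negbTE fiS) scale0r.
Qed.

End Polarization.

End Multilinear.

Section BoundedMultilinear.
Variables (K : numFieldType) (E F : normedModType K) (n : nat).

(** For multilinear maps this serves as joint continuity, see [multilinear_cvg], without a topology
    on the space of tuples. *)
Definition bounded_on_balls (A : ('I_n -> E) -> F) := forall rho : K, 0 < rho ->
  exists C, forall x, (forall i, `|x i| <= rho) -> `|A x| <= C.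

Section Estimates.
Variable A : ('I_n -> E) -> F.
Hypotheses (mA : multilinear A) (bA : bounded_on_balls A).

Lemma multilinear_bound_slot (rho C : K) : 0 < rho ->
  (forall x, (forall i, `|x i| <= rho) -> `|A x| <= C) ->
  forall x i0 y eta, (forall i, `|x i| <= rho) -> `|y| <= eta ->
  `|A (dfwith x i0 y)| <= C / rho * eta.
Proof.
move=> rho0 AC x i0 y eta xrho yeta.
have [y0|y0] := eqVneq y 0.
  rewrite y0 (multilinear_slot0 mA) normr0 mulr_ge0//; last exact: le_trans yeta.
  by rewrite divr_ge0// ?(ltW rho0)// (le_trans (normr_ge0 _) (AC (fun=> 0) _))//
    => i; rewrite normr0 ltW.
have ny0 : 0 < `|y| by rewrite normr_gt0.
rewrite -[y](@scalerKV _ _ (`|y| / rho)); last by rewrite mulf_neq0 ?invr_eq0 ?gt_eqF.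
set z := _ *: y.
have zrho : `|z| = rho.
  rewrite /z normrZ normfV ger0_norm ?divr_ge0 ?(ltW rho0)// invf_div.
  by rewrite divfK// gt_eqF.
rewrite (multilinear_slotZ mA) normrZ ger0_norm ?divr_ge0 ?(ltW rho0)//.
have Az : `|A (dfwith x i0 z)| <= C.
  apply: AC => i; have [<-|ii0] := eqVneq i0 i; first by rewrite dfwithin zrho.
  by rewrite dfwithout.
rewrite mulrC mulrA mulrAC; apply: ler_pM => //; first by rewrite divr_ge0// ltW.
by rewrite ler_pM2r// invr_gt0.
Qed.

Lemma multilinear_lipschitz (rho : K) : 0 < rho -> exists2 C, 0 <= C &
  forall y y' eta, 0 <= eta -> (forall i, `|y i| <= rho) -> (forall i, `|y' i| <= rho) ->
  (forall i, `|y i - y' i| <= eta) -> `|A y - A y'| <= C * eta.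
Proof.
move=> rho0; have [C AC] := bA rho0.
have C0 : 0 <= C.
  by rewrite (le_trans (normr_ge0 _) (AC (fun=> 0) _))// => i; rewrite normr0 ltW.
have Cr0 : 0 <= C / rho by rewrite divr_ge0// ltW.
exists (n%:R * (C / rho)) => [|y y' eta eta0 yr y'r yy']; first by rewrite mulr_ge0.
(* The slots of [y] are replaced by those of [y'] one at a time; each replacement costs at most
   [C / rho * eta]. *)
pose w m := fun i : 'I_n => if (i < m)%N then y' i else y i.
have wr m i : `|w m i| <= rho by rewrite /w; case: ifP.
have step m : (m <= n)%N -> `|A y - A (w m)| <= m%:R * (C / rho) * eta.
  elim: m => [_|m IH mn]; first by rewrite /w/= subrr normr0 !mul0r.
  rewrite -[A y](subrK (A (w m))) -addrA (le_trans (ler_normD _ _))//.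
  rewrite -natr1 mulrDl mulrDl mul1r lerD ?IH 1?ltnW//.
  pose i := Ordinal mn.
  have wS : w m.+1 = dfwith (w m) i (y' i).
    apply/funext => j; have [<-|ij] := eqVneq i j.
      by rewrite dfwithin /w ltnSn.
    rewrite dfwithout// /w ltnS leq_eqVlt -[(j == m :> nat)]/(j == i).
    by rewrite eq_sym (negbTE ij).
  have wi : w m i = y i by rewrite /w ltnn.
  rewrite wS -{1}(dfwith_id (w m) i) wi -(multilinear_slotB mA).
  exact: multilinear_bound_slot.
have wn : w n = y' by apply/funext => i; rewrite /w ltn_ord.
by rewrite -{1}wn step.
Qed.

Lemma multilinear_cvg (T : Type) (H : set_system T) (g : T -> 'I_n -> E) (l : 'I_n -> E) :
  Filter H -> (forall i, (fun t => g t i) @ H --> l i) -> (A \o g) @ H --> A l.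
Proof.
move=> FH gl; apply/cvgrPdist_le => e e0.
pose rho := 1 + \sum_i `|l i|.
have rho0 : 0 < rho by rewrite ltr_pwDl// sumr_ge0.
have [C C0 AC] := multilinear_lipschitz rho0.
have C1 : 0 < C + 1 by rewrite ltr_wpDl.
pose d := Num.min 1 (e / (C + 1)).
have e1 : 0 < e / (C + 1) by rewrite divr_gt0.
have lrho i : `|l i| + 1 <= rho.
  by rewrite addrC lerD2l (bigD1 i)//= lerDl sumr_ge0.
have near_small (d' : K) : 0 < d' -> \forall t \near H, forall i, `|l i - g t i| <= d'.
  move=> d'0; apply: filter_forall => i.
  by have /cvgrPdist_le/(_ _ d'0) := gl i.
near=> t.
have h1 i : `|l i - g t i| <= 1 by move: i; near: t; exact: near_small.
have h2 i : `|l i - g t i| <= e / (C + 1) by move: i; near: t; exact: near_small.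
rewrite (le_trans (AC _ _ _ (ltW e1) _ _ h2))//.
- by move=> i; rewrite (le_trans _ (lrho i))// lerDl.
- move=> i; rewrite (le_trans _ (lrho i))// -[g t i](subKr (l i)).
  by rewrite (le_trans (ler_normB _ _))// lerD2l.
- by rewrite mulrA ler_pdivrMr// mulrC ler_wpM2l ?(ltW e0)// lerDl.
Unshelve. all: by end_near. Qed.

Lemma bounded_multilinear_hpoly : exists P : hpoly E F n, forall x, P x = A (fun=> x).
Proof.
have hP : (fun x : E => A (fun=> x)) \in @continuous_hpoly K E F n.
  apply/asboolP; split; first by exists A.
  move=> x; apply: (@multilinear_cvg _ (nbhs x) (fun y _ => y) (fun=> x)) => i.
  exact: cvg_id.
by exists (HPoly hP).
Qed.

End Estimates.

Lemma hpoly_addE (P Q : hpoly E F n) x : (P + Q) x = P x + Q x.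
Proof. by []. Qed.

Lemma hpoly_scaleE c (P : hpoly E F n) x : (c *: P) x = c *: P x.
Proof. by []. Qed.

Lemma hpoly_ext (P Q : hpoly E F n) : (forall x, P x = Q x) -> P = Q.
Proof. by move=> PQ; apply/val_inj/funext. Qed.

Lemma hpoly_bounded_ball (P : hpoly E F n) (rho : K) : 0 < rho ->
  exists C, forall x, `|x| <= rho -> `|P x| <= C.
Proof.
move=> rho0; have [M PM] := hpoly_bounded P; have [hP _] := hpolyP P.
exists (rho ^+ n * M) => x xr; rewrite -[x](@scalerKV _ _ rho) ?gt_eqF//.
rewrite (hpolyZ _ _ hP) normrZ ger0_norm ?exprn_ge0 ?(ltW rho0)// ler_wpM2l ?exprn_ge0 ?(ltW rho0)//.
by apply: PM; rewrite /unit_ball/= normrZ normfV gtr0_norm// ler_pdivrMl// mulr1.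
Qed.

(** The multilinear map behind a polynomial may be unbounded off the diagonal. Its symmetrization is
    bounded on balls, since by polarization it is a combination of values of the continuous [P]. *)
Lemma hpoly_polarization (P : hpoly E F n) : exists (M : ('I_n -> E) -> F) (c : K),
  [/\ multilinear M, bounded_on_balls M, c != 0 & forall x, M (fun=> x) = c *: P x].
Proof.
have [[A mA PA] _] := hpolyP P.
exists (symmetrization A), (#|[pred f : {ffun 'I_n -> 'I_n} | injectiveb f]|%:R).
split; first exact: symmetrization_multilinear.
(* The radius allows for a sum of at most [n] vectors of norm at most [rho]; [n.+1] keeps it
   positive when [n = 0]. *)
- move=> rho rho0; have r0 : 0 < n.+1%:R * rho by rewrite mulr_gt0.
  have [C PC] := hpoly_bounded_ball P r0.
  exists (\sum_(S : {set 'I_n}) C) => x xr; rewrite polarization//.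
  rewrite (le_trans (ler_norm_sum _ _ _))// ler_sum// => S _.
  rewrite normrZ normrX normrN1 expr1n mul1r -PA PC// (le_trans (ler_norm_sum _ _ _))//.
  rewrite (@le_trans _ _ (\sum_(i in S) rho)) ?ler_sum// sumr_const -[rho *+ _]mulr_natl.
  rewrite ler_wpM2r ?(ltW rho0)// ler_nat (leq_trans (max_card _))// card_ord.
  exact: leqnSn.
- exact: card_inj_ffun_neq0.
- by move=> x; rewrite symmetrization_diag PA.
Qed.

End BoundedMultilinear.

(** * Sign and diagonal bounds *)

Section VertexBounds.
Variables (K : numFieldType) (V : normedModType K) (I : eqType).

(** A point of the cube is a convex combination of vertices, one coordinate at a time; [c]
    accumulates the coordinates already fixed at a vertex. *)
Lemma subsum_convex_bound (r : seq I) (v : I -> V) (c : V) (B : K) : uniq r ->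
  (forall D : pred I, `|c + \sum_(i <- r | D i) v i| <= B) ->
  forall t : I -> K, (forall i, 0 <= t i <= 1) -> `|c + \sum_(i <- r) t i *: v i| <= B.
Proof.
elim: r c => [|a r IH] c /=.
  by move=> _ h t _; have := h predT; rewrite !big_nil.
move=> /andP[ar ur] h t t01.
have ext (b : bool) D : `|c + (if b then v a else 0) + \sum_(i <- r | D i) v i| <= B.
  have := h (fun i => if i == a then b else D i); rewrite big_cons eqxx.
  have -> : \sum_(j <- r | if j == a then b else D j) v j = \sum_(i <- r | D i) v i.
    rewrite big_seq_cond [RHS]big_seq_cond; apply: eq_bigl => i.
    by case: (i =P a) => [->|//]; rewrite (negbTE ar).
  by case: b; rewrite ?addr0 ?addrA.
have := IH _ ur (ext false) t t01; have := IH _ ur (ext true) t t01.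
rewrite /= addr0; set S := \sum_(i <- r) _ => h1 h0.
have /andP[ta0 ta1] := t01 a.
have -> : c + \sum_(i <- a :: r) t i *: v i =
    t a *: (c + v a + S) + (1 - t a) *: (c + S).
  have -> : c + v a + S = v a + (c + S) by rewrite addrAC addrC.
  by rewrite big_cons -/S scalerBl scale1r [t a *: (v a + _)]scalerDr
    [RHS]addrACA subrr addr0 addrCA.
rewrite (le_trans (ler_normD _ _))// !normrZ !ger0_norm ?subr_ge0//.
rewrite (@le_trans _ _ (t a * B + (1 - t a) * B))//.
  by rewrite lerD// ler_wpM2l// subr_ge0.
by rewrite -mulrDl addrCA subrr addr0 mul1r.
Qed.

(** Averaging [B (x0 + e x) (y0 + e y)] over the signs [e = 1] and [e = -1] cancels the cross terms
    and leaves [B x0 y0 + B x y]. The induction treats one pair at a time. *)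
Lemma bilinear_sign_bound (X Y : lmodType K) (B : X -> Y -> V) (r : seq I)
    (x : I -> X) (y : I -> Y) (x0 : X) (y0 : Y) (C : K) :
  (forall y, linear (B^~ y)) -> (forall x, linear (B x)) -> uniq r ->
  (forall s : I -> K, (forall i, `|s i| <= 1) ->
    `|B (x0 + \sum_(i <- r) s i *: x i) (y0 + \sum_(i <- r) s i *: y i)| <= C) ->
  `|B x0 y0 + \sum_(i <- r) B (x i) (y i)| <= C.
Proof.
move=> Bl Br; elim: r x0 y0 => [|a r IH] x0 y0 /=.
  move=> _ /(_ (fun=> 0)); rewrite !big_nil !addr0; apply=> _.
  by rewrite normr0.
move=> /andP[ar ur] h.
have ext (e : K) : `|e| <= 1 ->
    `|B (x0 + e *: x a) (y0 + e *: y a) + \sum_(i <- r) B (x i) (y i)| <= C.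
  move=> e1; apply: IH => // s s1.
  have := h (fun i => if i == a then e else s i); rewrite !big_cons eqxx !addrA.
  have upd (Z : lmodType K) (z : I -> Z) :
      \sum_(j <- r) (if j == a then e else s j) *: z j = \sum_(j <- r) s j *: z j.
    rewrite big_seq [RHS]big_seq; apply: eq_bigr => i ir.
    by case: (i =P a) ir => // ->; rewrite (negbTE ar).
  by rewrite !upd; apply=> i; case: ifP.
have BDl u v w : B (u + v) w = B u w + B v w.
  by have := Bl w 1 u v; rewrite !scale1r.
have BDr u v w : B u (v + w) = B u v + B u w.
  by have := Br u 1 v w; rewrite !scale1r.
have BNl u w : B (- u) w = - B u w.
  have B0 : B 0 w = 0 
    by have /eqP := BDl 0 0 w; rewrite addr0 addrC -subr_eq subrr => /eqP.
  by have := Bl w (-1) u 0; rewrite !scaleN1r B0 !addr0.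
have BNr u w : B u (- w) = - B u w.
  have B0 : B u 0 = 0 
    by have /eqP := BDr u 0 0; rewrite addr0 addrC -subr_eq subrr => /eqP.
  by have := Br u (-1) w 0; rewrite !scaleN1r B0 !addr0.
have := ext 1; have := ext (-1); rewrite normrN1 normr1 => /(_ (lexx _)) hm /(_ (lexx _)) hp.
rewrite big_cons; move: hm hp; set S := \sum_(i <- r) _.
rewrite !scaleN1r !scale1r !BDl !BDr !BNl !BNr opprK => hm hp.
rewrite -(@ler_pM2l _ 2)// -[2 in X in X <= _]ger0_norm// -normrZ.
rewrite (_ : 2 *: _ = (B x0 y0 + B x0 (y a) + (B (x a) y0 + B (x a) (y a)) + S) +
  (B x0 y0 - B x0 (y a) + (- B (x a) y0 + B (x a) (y a)) + S)).
  by rewrite mulr_natl mulr2n (le_trans (ler_normD _ _))// lerD.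
rewrite [RHS]addrACA [X in _ = X + _]addrACA [X in _ = X + _ + _]addrACA.
rewrite [X in _ = _ + X + _]addrACA !subrr addr0 add0r -!mulr2n scaler_nat.
by rewrite !mulrnDl addrA.
Qed.

End VertexBounds.

(** By [scalars_decomposition] the coefficients are combinations of four families in [[0, 1]], each
    controlled by its vertices: hence the factor 4. *)
Lemma subsum_scalar_bound (R : realType) (k : scalar_kind)
    (V : normedModType (scalars R k)) (I : eqType) (r : seq I) (v : I -> V)
    (B : scalars R k) : uniq r ->
  (forall D : pred I, `|\sum_(i <- r | D i) v i| <= B) ->
  forall t : I -> scalars R k, (forall i, `|t i| <= 1) ->
  `|\sum_(i <- r) t i *: v i| <= 4 * B.
Proof.
move=> ur vB t t1.
have B0 : 0 <= B by rewrite (le_trans _ (vB pred0)).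
have cB s : (forall i, 0 <= s i <= 1) -> `|\sum_(i <- r) s i *: v i| <= B.
  move=> s01; rewrite -[X in `|X|]add0r; apply: subsum_convex_bound => // D.
  by rewrite add0r.
have [c c1 dec] := scalars_decomposition R k.
have /choice[t1' /choice[t2 /choice[t3 /choice[t4 {}dec]]]] := fun i => dec _ (t1 i).
have -> : \sum_(i <- r) t i *: v i =
    (\sum_(i <- r) t1' i *: v i - \sum_(i <- r) t2 i *: v i) +
    c *: (\sum_(i <- r) t3 i *: v i - \sum_(i <- r) t4 i *: v i).
  rewrite -!sumrB scaler_sumr -big_split; apply: eq_bigr => i _ /=.
  by rewrite {1}(dec i).1 scalerDl -scalerA !scalerBl.
have {}dec i : [/\ 0 <= t1' i <= 1, 0 <= t2 i <= 1, 0 <= t3 i <= 1 & 0 <= t4 i <= 1].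
  exact: (dec i).2.
have -> : 4 * B = (B + B) + 1 * (B + B) by rewrite mul1r -!mulr2n -mulrnA mulr_natl.
rewrite (le_trans (ler_normD _ _))// normrZ lerD//.
  by rewrite (le_trans (ler_normB _ _))// lerD// cB// => i; case: (dec i).
rewrite ler_pM// (le_trans (ler_normB _ _))// lerD// cB// => i; by case: (dec i).
Qed.

(** Induction on the number of slots which depend on [j]. Sign averaging decouples one slot [i0],
    which receives a signed sum bounded by [rho], from the remaining ones; the last slot is summed
    by linearity. *)
Lemma multilinear_diagonal_bound (R : realType) (k : scalar_kind)
    (V W : normedModType (scalars R k)) (n : nat) (M : ('I_n -> V) -> W)
    (rho C : scalars R k) (r : seq nat) :
  multilinear M -> (forall x, (forall i, `|x i| <= rho) -> `|M x| <= C) -> uniq r ->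
  forall (J : {set 'I_n}) (w : 'I_n -> V) (g : nat -> 'I_n -> V), (0 < #|J|)%N ->
  (forall i, i \notin J -> `|w i| <= rho) ->
  (forall i, i \in J -> forall t : nat -> scalars R k, (forall j, `|t j| <= 1) ->
     `|\sum_(j <- r) t j *: g j i| <= rho) ->
  forall a : nat -> scalars R k, (forall j, `|a j| <= 1) ->
  `|\sum_(j <- r) a j *: M (fun i => if i \in J then g j i else w i)| <= C.
Proof.
move=> mM MC ur J; move Jm : #|J| => m; elim: m J Jm => // m IH J Jm w g _ wr gr a a1.
have [i0 i0J] : exists i0, i0 \in J by apply/set0Pn; rewrite -card_gt0 Jm.
have JD i : (i \in J) = (i == i0) || (i \in J :\ i0)%SET.
  by rewrite in_setD1; have [->|] := eqVneq i i0.
have Mg j : (fun i => if i \in J then g j i else w i) =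
    dfwith (fun i => if i \in (J :\ i0)%SET then g j i else w i) i0 (g j i0).
  apply/funext => i; have [<-|ii0] := eqVneq i0 i; first by rewrite dfwithin i0J.
  by rewrite dfwithout// JD eq_sym (negbTE ii0).
have /eqP := Jm; rewrite (cardsD1 i0) i0J add1n eqSS => /eqP J'm.
under eq_bigr do rewrite Mg.
case: (posnP m) => [m0|m0].
  have J'0 i : i \in (J :\ i0)%SET = false.
    by move: J'm; rewrite m0 => /eqP; rewrite cards_eq0 => /eqP ->; rewrite inE.
  under eq_bigr => j _.
    rewrite (_ : (fun i => _) = w); last by apply/funext => i; rewrite J'0.
    rewrite -(multilinear_slotZ mM); over.
  rewrite -(multilinear_slot_sum mM) MC// => i.
  have [<-|ii0] := eqVneq i0 i; first by rewrite dfwithin gr.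
  by rewrite dfwithout// wr// JD eq_sym (negbTE ii0) J'0.
(* The sum is viewed as a bilinear function of the vector in slot [i0] and of the coefficient
   sequence. The sequence [y j] carries [a j] at [j] only, so that signed sums of the [y j] remain
   bounded by 1. *)
pose B (X : V) (al : nat -> (scalars R k)^o) := \sum_(j <- r) al j *:
  M (dfwith (fun i => if i \in (J :\ i0)%SET then g j i else w i) i0 X).
pose y j : nat -> (scalars R k)^o := fun j' => if j' == j then a j else 0.
have Bl al : linear (B^~ al).
  move=> c u v; rewrite /B scaler_sumr -big_split; apply: eq_bigr => j _ /=.
  by rewrite (multilinearD mM) (multilinear_slotZ mM) scalerDr !scalerA mulrC.
have Br X : linear (B X).
  move=> c u v; rewrite /B scaler_sumr -big_split; apply: eq_bigr => j _ /=.
  by rewrite scalerDl scalerA.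
have B0 : B 0 0 = 0.
  by rewrite /B big1// => j _; rewrite scale0r.
have -> : \sum_(j <- r) a j *: M (dfwith
      (fun i => if i \in (J :\ i0)%SET then g j i else w i) i0 (g j i0)) =
    B 0 0 + \sum_(j <- r) B (g j i0) (y j).
  rewrite B0 add0r big_seq [RHS]big_seq; apply: eq_bigr => j jr.
  rewrite /B (bigD1_seq j)//= /y eqxx big1 ?addr0// => j' /negbTE ->.
  by rewrite scale0r.
apply: bilinear_sign_bound => // s s1; rewrite !add0r.
set X := \sum_(i <- r) s i *: g i i0.
have XJ j i : j \in r ->
    dfwith (fun i => if i \in (J :\ i0)%SET then g j i else w i) i0 X i =
    (if i \in (J :\ i0)%SET then g j i else dfwith w i0 X i).
  move=> jr; have [<-|ii0] := eqVneq i0 i; first by rewrite !dfwithin in_setD1 eqxx.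
  by rewrite !dfwithout.
rewrite /B big_seq.
under eq_bigr => j jr do rewrite (funext (fun i => XJ j i jr)).
rewrite -big_seq; apply: IH => //.
- move=> i iJ'; have [<-|ii0] := eqVneq i0 i; first by rewrite dfwithin gr.
  by rewrite dfwithout// wr// JD eq_sym (negbTE ii0).
- by move=> i iJ' t t1; apply: gr => //; rewrite JD iJ' orbT.
- move=> j; rewrite fct_sumE.
  have [jr|jr] := boolP (j \in r).
    rewrite (bigD1_seq j)//= big1 ?addr0 => [|i ij]; last first.
      by rewrite /y -[(_ *: _) _]/(s i *: _) eq_sym (negbTE ij) scaler0.
    rewrite -[(_ *: _) _]/(s j * _) /y eqxx normrM -[1]mulr1.
    by rewrite ler_pM.
  rewrite big1_seq ?normr0// => i /andP[_ ir].
  rewrite -[(_ *: _) _]/(s i * _) /y; case: eqP => [ji|_]; last by rewrite mulr0.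
  by rewrite ji ir in jr.
Qed.

(** * Unconditional expansions *)

Section Blocks.
Variable k : nat -> nat.
Hypothesis kS : forall j, (k j < k j.+1)%N.

Lemma block_mono i j : (i <= j)%N -> (k i <= k j)%N.
Proof.
move=> /subnKC <-; elim: (j - i)%N => [|d IH]; first by rewrite addn0.
by rewrite addnS (leq_trans IH)// ltnW.
Qed.

Lemma block_ge j : (j <= k j)%N.
Proof. by elim: j => // j IH; exact: leq_ltn_trans IH (kS j). Qed.

Definition block_index (i : nat) : nat := get [set j | (k j <= i < k j.+1)%N].

Lemma block_indexE i j : (k j <= i < k j.+1)%N -> block_index i = j.
Proof.
move=> kij; rewrite /block_index; case: xgetP => [j' _ /= kij'|/(_ j)//].
have lt a b : (k a <= i < k a.+1)%N -> (k b <= i < k b.+1)%N -> (a < b)%N -> False.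
  move=> /andP[_ ia] /andP[ib _] /block_mono ab.
  by have := leq_trans ia (leq_trans ab ib); rewrite ltnn.
by case: (ltngtP j' j) => // /lt; [move=> /(_ kij' kij)|move=> /(_ kij kij')].
Qed.

Lemma block_indexP i : (k 0 <= i)%N -> (k (block_index i) <= i < k (block_index i).+1)%N.
Proof.
move=> k0i; have [j kij] : exists j, (k j <= i < k j.+1)%N.
  have ex : exists j, (i < k j.+1)%N by exists i; exact: block_ge.
  case: (ex_minnP ex) => j ij mj; exists j; rewrite ij andbT.
  case: j ij mj => // j _ mj; rewrite leqNgt; apply/negP => /mj.
  by rewrite ltnn.
by rewrite (block_indexE kij).
Qed.

Lemma block_sum (K : numFieldType) (V : normedModType K) (t : nat -> K) (v : nat -> V)
    p q : (p <= q)%N ->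
  \sum_(p <= j < q) t j *: (\sum_(k j <= i < k j.+1) v i) =
  \sum_(k p <= i < k q) t (block_index i) *: v i.
Proof.
move=> /subnKC <-; elim: (q - p)%N => [|d IH]; first by rewrite addn0 !big_geq.
rewrite addnS big_nat_recr ?leq_addr//= IH [RHS](@big_cat_nat _ _ _ (k (p + d)%N) (k p))/=.
- congr (_ + _); rewrite scaler_sumr; apply: eq_big_nat => i kij.
  by rewrite (block_indexE kij).
- by apply: block_mono; rewrite leq_addr.
- exact/ltnW.
Qed.

(** Within each block, [s] lists the indices of [D] first. The sum of the rearranged series over the
    start of a block is thus the subsum over [D], which the Cauchy criterion controls. *)
Lemma block_rearrangement (D : pred nat) : k 0 = 0%N ->
  exists2 s : nat -> nat, bijective s &
  forall (K : numFieldType) (V : normedModType K) (v : nat -> V) j, exists2 m,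
    (k j <= m)%N &
    \sum_(k j <= i < m) v (s i) = \sum_(k j <= i < k j.+1 | D i) v i.
Proof.
move=> k0.
pose B j := iota (k j) (k j.+1 - k j).
pose L j := [seq i <- B j | D i] ++ [seq i <- B j | ~~ D i].
have perm_L j : perm_eq (L j) (B j) by rewrite perm_filterC.
have mem_L i j : i \in L j = (k j <= i < k j.+1)%N.
  by rewrite (perm_mem (perm_L j)) mem_iota subnKC// ltnW.
have size_L j : size (L j) = (k j.+1 - k j)%N by rewrite (perm_size (perm_L j)) size_iota.
have uniq_L j : uniq (L j) by rewrite (perm_uniq (perm_L j)) iota_uniq.
have idxP i : (k (block_index i) <= i < k (block_index i).+1)%N.
  by apply: block_indexP; rewrite k0.
pose s i := nth 0%N (L (block_index i)) (i - k (block_index i)).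
pose s' i := (k (block_index i) + index i (L (block_index i)))%N.
have sE i j : (k j <= i < k j.+1)%N -> s i = nth 0%N (L j) (i - k j).
  by move=> kij; rewrite /s (block_indexE kij).
exists s.
  exists s' => i; have /andP[lo hi] := idxP i; set j := block_index i in lo hi.
    have lt : (i - k j < size (L j))%N by rewrite size_L ltn_sub2r// (leq_ltn_trans lo).
    have sL : s i \in L j by apply: mem_nth.
    rewrite /s' (@block_indexE (s i) j) -?mem_L// /s -/j index_uniq//.
    by rewrite subnKC.
  have iL : i \in L j by rewrite mem_L lo.
  have ib : (index i (L j) < k j.+1 - k j)%N by rewrite -size_L index_mem.
  rewrite (@sE _ j) /s' -/j ?addKn ?nth_index// leq_addr/=.
  by rewrite -ltn_subRL.
move=> K V v j; pose F := [seq i <- B j | D i].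
have sF : (size F <= k j.+1 - k j)%N by rewrite -size_L size_cat leq_addr.
exists (k j + size F)%N; first exact: leq_addr.
rewrite -[RHS]big_filter -/F (big_nth 0%N).
have := big_addn 0 (k j + size F) (k j) xpredT (fun i => v (s i)).
rewrite add0n addKn => ->; apply: eq_big_nat => i /= iF.
rewrite (@sE _ j) ?addnK; first by rewrite nth_cat iF.
by rewrite leq_addl/= addnC -ltn_subRL (leq_trans iF).
Qed.

End Blocks.

Section Unconditional.
Variables (K : numFieldType) (V : normedModType K).

(** If arbitrarily late subsums were large, consecutive blocks containing them would give, by
    [block_rearrangement], a rearranged series that is not Cauchy. *)
Lemma unconditional_tail (u : nat -> V) (l : V) (e : K) :
  unconditionally_converges u l -> 0 < e ->
  exists N, forall p q (D : pred nat), (N <= p)%N ->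
    `|\sum_(p <= i < q | D i) u i| <= e.
Proof.
move=> ul e0; apply: contrapT => /forallNP bad.
have {}bad N : exists qD : nat * pred nat,
    [/\ (N < qD.1)%N & ~ `|\sum_(N <= i < qD.1 | qD.2 i) u i| <= e].
  have /existsNP[p /existsNP[q /existsNP[D /not_implyP[Np npq]]]] := bad N.
  have pq : (p < q)%N.
    rewrite ltnNge; apply/negP => qp; apply: npq.
    by rewrite big_geq// normr0 ltW.
  (* The range of the bad subsum is extended down to [N] with no new terms, so that the blocks
     become consecutive. *)
  exists (q, fun i => (p <= i)%N && D i); split; first exact: leq_ltn_trans pq.
  suff -> : \sum_(N <= i < q | (p <= i)%N && D i) u i = \sum_(p <= i < q | D i) u i by [].
  rewrite (@big_cat_nat _ _ _ p)//=; last exact: ltnW.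
  rewrite big_nat_cond big1 ?add0r => [|i]; last first.
    by case/andP => /andP[_ ip] /andP[]; rewrite leqNgt ip.
  rewrite big_nat_cond [RHS]big_nat_cond; apply: eq_bigl => i.
  by case: (leqP p i).
have [qD qDP] := choice bad.
pose k := fix k j := if j is j'.+1 then (qD (k j')).1 else 0%N.
have kS j : (k j < k j.+1)%N by have [] := qDP (k j).
pose D i := (qD (k (block_index k i))).2 i.
have [s sbij sD] := block_rearrangement kS D erefl.
have e2 : 0 < e / 2 by rewrite divr_gt0.
have /cvgn_distP/(_ _ e2)[N uN] := ul s sbij.
have [m km sE] := sD _ _ u N.
have [_] := qDP (k N); apply.
have -> : \sum_(k N <= i < (qD (k N)).1 | (qD (k N)).2 i) u i =
    series (u \o s) m - series (u \o s) (k N).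
  rewrite sub_series_geq// [RHS]sE big_nat_cond [RHS]big_nat_cond.
  apply: eq_bigl => i; case: (boolP (k N <= i < _)%N) => //= kNi.
  by rewrite /D (block_indexE kS kNi).
have kN : (N <= k N)%N by exact: block_ge.
rewrite (splitr e) -(subrKA l) (le_trans (ler_normD _ _))// lerD// ?uN//.
  by rewrite (leq_trans kN).
by rewrite distrC uN.
Qed.

End Unconditional.

Section UniformBoundedness.
Variables (R : realType) (k : scalar_kind).
Local Notation K := (scalars R k).

(* Every ball contains a point where some [f i] is large, since [2 f i y] is the
   difference of the values of [f i] at [x + y] and [x - y]: nest such balls. *)
Lemma uniform_boundedness (V : completeNormedModType K) (W : normedModType K)
    (I : Type) (f : I -> V -> W) :
  (forall i, linear (f i)) ->
  (forall i, exists2 C, 0 <= C & forall x, `|f i x| <= C * `|x|) ->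
  (forall x, exists C, forall i, `|f i x| <= C) ->
  exists2 C, 0 < C & forall i x, `|f i x| <= C * `|x|.
Proof.
move=> lf bf pf; apply: contrapT => unb.
have fD i x y : f i (x + y) = f i x + f i y by have := lf i 1 x y; rewrite !scale1r.
have f0 i : f i 0 = 0.
  by have /eqP := fD i 0 0; rewrite addr0 addrC -subr_eq subrr => /eqP.
have fZ i a x : f i (a *: x) = a *: f i x by have := lf i a x 0; rewrite f0 !addr0.
have fB i x y : f i (x - y) = f i x - f i y by rewrite fD -scaleN1r fZ scaleN1r.
have large (r c : K) : 0 < r -> 0 < c -> exists i y, `|y| <= r /\ c <= `|f i y|.
  move=> r0 c0; apply: contrapT => small; apply: unb; exists (c / r).
    by rewrite divr_gt0.
  move=> i x; have [->|x0] := eqVneq x 0; first by rewrite f0 !normr0 mulr0.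
  have nx : 0 < `|x| by rewrite normr_gt0.
  pose y := (r / `|x|) *: x.
  have yr : `|y| = r by rewrite normrZ ger0_norm ?divr_ge0 ?(ltW r0)// divfK ?gt_eqF.
  have : `|f i y| <= c.
    rewrite real_leNgt ?normr_real ?gtr0_real//; apply/negP => /ltW h.
    by apply: small; exists i, y; rewrite yr.
  rewrite fZ normrZ ger0_norm ?divr_ge0 ?(ltW r0)//.
  rewrite mulrAC ler_pdivrMr// -ler_pdivlMl// => /le_trans; apply.
  by rewrite mulrA (mulrC c).
pose good (m : nat) (xr yr : V * K) := [/\ 0 < yr.2, yr.2 <= xr.2 / 2,
  `|yr.1 - xr.1| <= xr.2 / 2 &
  exists i, forall z, `|z - yr.1| <= yr.2 -> m%:R <= `|f i z|].
have /choice[nxt nxtP] : forall p : nat * (V * K), exists yr,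
    0 < p.2.2 -> good p.1 p.2 yr.
  move=> [m [x r]]; case: (pselect (0 < r)) => /= r0; last by exists (0, 0) => /r0.
  have r2 : 0 < r / 2 by rewrite divr_gt0.
  have [|i [y [yr fy]]] := @large (r / 2) m.+1%:R r2; first by rewrite ltr0n.
  have [s s1 fs] : exists2 s : K, `|s| <= 1 & m.+1%:R <= `|f i (x + s *: y)|.
    apply: contrapT => h.
    have lt (s : K) : `|s| <= 1 -> `|f i (x + s *: y)| < m.+1%:R.
      move=> s1; rewrite real_ltNge ?normr_real ?realn//; apply/negP => ?.
      by apply: h; exists s.
    have : 2 * m.+1%:R <= `|f i (x + 1 *: y)| + `|f i (x + (-1) *: y)|.
      rewrite (le_trans _ (ler_normB _ _))// -fB opprD addrACA subrr add0r.
      rewrite -scalerBl opprK -[1 + 1]/(2%:R) fZ normrZ normr_nat ler_pM2l//.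
    have := ltrD (lt 1 _) (lt (-1) _); rewrite normrN1 normr1 lexx.
    by move=> /(_ isT isT); rewrite mulr_natl mulr2n => /le_lt_trans h' /h'; rewrite ltxx.
  have [C C0 fC] := bf i.
  have C1 : 0 < 1 + C * (r / 2) by rewrite ltr_pwDl// mulr_ge0// ltW.
  (* The radius is small enough for [f i] to vary by at most 1 on the new ball, whence [m.+1] above
     and [m] in [good]. *)
  exists (x + s *: y, r / 2 / (1 + C * (r / 2))) => _; split => /=.
  - by rewrite divr_gt0.
  - by rewrite ler_pdivrMr// ler_peMr ?(ltW r2)// lerDl mulr_ge0// ltW.
  - by rewrite addrC addKr normrZ (le_trans _ yr)// ler_piMl.
  - exists i => z zy; rewrite -[m%:R](addrK 1) natr1 lerBlDr.
    rewrite (le_trans fs)// -[X in f i X](subrK z) fD (le_trans (ler_normD _ _))// addrC.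
    rewrite lerD2l (le_trans (fC _))// distrC (le_trans (ler_wpM2l C0 zy))//.
    by rewrite mulrA ler_pdivrMr// mul1r lerDr.
pose xr := fix xr m := if m is m'.+1 then nxt (m', xr m') else (0 : V, 1 : K).
have xr0 m : 0 < (xr m).2.
  by elim: m => [|m IH] /=; [exact: ltr01|have [] := nxtP (m, xr m) IH].
have step m : good m (xr m) (xr m.+1) := nxtP (m, xr m) (xr0 m).
have nested m d : `|(xr (m + d)%N).1 - (xr m).1| <= (xr m).2 - (xr (m + d)%N).2.
  elim: d => [|d IH]; first by rewrite addn0 !subrr normr0.
  rewrite addnS -(subrKA (xr (m + d)%N).1) (le_trans (ler_normD _ _))//.
  have [_ h1 h2 _] := step (m + d)%N.
  rewrite addrC (le_trans (lerD IH h2))// -addrA lerD2l.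
  set r := (xr (m + d)%N).2 in h1 *.
  by have -> : - r + r / 2 = - (r / 2); [rewrite {1}[r]splitr opprD subrK|rewrite lerN2].
have rpow m : (xr m).2 <= 2^-1 ^+ m.
  elim: m => [|m IH]; first by rewrite expr0.
  have [_ h _ _] := step m; rewrite (le_trans h)// exprSr ler_wpM2r//.
have cx : cvgn (fun m => (xr m).1).
  apply: complete_cvgn => e e0; have [N Ne] := pow2_archi e0.
  exists N => m n Nm /subnKC <-; rewrite (le_trans (nested _ _))//.
  rewrite lerBlDr (le_trans (rpow m))// ler_wpDr//; first exact/ltW/xr0.
  rewrite (le_trans _ Ne)// ler_wiXn2l// invf_le1//.
  by rewrite ler1n.
have /cvg_ex[/= z xz] := cx.
have zm m : `|z - (xr m).1| <= (xr m).2.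
  apply: (cvgn_norm_le xz (N := m)) => n /subnKC <-.
  by rewrite (le_trans (nested _ _))// gerBl ltW.
have [C fzC] := pf z; have [N CN] := scalars_archi C ltr01.
have [_ _ _ [i fi]] := step N.+1.
have := le_trans (fi z (zm _)) (fzC i).
have C0 : 0 <= C by exact: le_trans (fzC i).
by rewrite -[C]ger0_norm// => /le_trans/(_ CN); rewrite mulr1 ler_nat ltnn.
Qed.

(** The sums of the [A i] over the indices of a predicate [D] in an interval are pointwise bounded
    by unconditional convergence, hence uniformly bounded; arbitrary coefficients then cost a factor
    4. *)
Lemma unconditional_expansion_bound (G : completeNormedModType K)
    (A : nat -> {linear G -> G}) :
  (forall i, continuous (A i)) ->
  (forall x, unconditionally_converges (fun i => A i x) x) ->
  exists2 C, 0 < C & forall p q (t : nat -> K) x, (forall i, `|t i| <= 1) ->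
    `|\sum_(p <= i < q) t i *: A i x| <= C * `|x|.
Proof.
move=> cA uA.
pose f (D : nat * nat * pred nat) (x : G) := \sum_(D.1.1 <= i < D.1.2 | D.2 i) A i x.
have [|D|x|C C0 fC] := @uniform_boundedness G G _ f.
- move=> D a x y; rewrite /f scaler_sumr -big_split; apply: eq_bigr => i _ /=.
  by rewrite linearP.
- have /choice[c cP] : forall i, exists c, 0 < c /\ forall x, `|A i x| <= c * `|x|.
    by move=> i; have [c c0 cx] := continuous_linear_bound (cA i); exists c.
  exists (\sum_(D.1.1 <= i < D.1.2 | D.2 i) c i).
    by apply: sumr_ge0 => i _; apply: ltW; exact: (cP i).1.
  move=> x; rewrite (le_trans (ler_norm_sum _ _ _))// mulr_suml ler_sum// => i _.
  exact: (cP i).2.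
- have [N xN] := unconditional_tail (uA x) ltr01.
  exists (\sum_(0 <= i < N) `|A i x| + 1) => -[[p q] D]; rewrite /f/=.
  have [pN|pN] := leqP N p; first by rewrite (le_trans (xN _ _ _ pN))// lerDr sumr_ge0.
  have le_sum m n : (n <= N)%N -> `|\sum_(m <= i < n | D i) A i x| <=
      \sum_(0 <= i < N) `|A i x|.
    move=> nN; rewrite (le_trans (ler_norm_sum _ _ _))// big_nat_cond.
    rewrite (big_nat_widen _ _ _ _ _ nN) (big_nat_widenl _ _ _ _ _ (leq0n m)).
    rewrite big_mkcond ler_sum// => i _.
    by case: ifP.
  have [qN|/ltnW qN] := leqP q N.
    by rewrite (le_trans (le_sum _ _ qN))// lerDl.
  rewrite (@big_cat_nat _ _ _ N)//=; last exact: ltnW.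
  by rewrite (le_trans (ler_normD _ _))// lerD// ?le_sum// xN.
exists (4 * C) => [|p q t x t1]; first by rewrite mulr_gt0.
rewrite -mulrA; apply: subsum_scalar_bound => //; first exact: iota_uniq.
by move=> D; exact: (fC (p, q, D)).
Qed.

Lemma unconditional_scalar_tail (V : normedModType K) (u : nat -> V) (l : V) (e : K) :
  unconditionally_converges u l -> 0 < e ->
  exists N, forall p q (t : nat -> K), (N <= p)%N -> (forall i, `|t i| <= 1) ->
    `|\sum_(p <= i < q) t i *: u i| <= e.
Proof.
move=> ul e0; have e4 : 0 < e / 4 by rewrite divr_gt0.
have [N uN] := unconditional_tail ul e4; exists N => p q t Np t1.
have -> : e = 4 * (e / 4) by rewrite mulrC divfK.
by apply: subsum_scalar_bound => // [|D]; [exact: iota_uniq|exact: uN].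
Qed.

End UniformBoundedness.

(** * Block polynomials *)

Section BlockPolynomials.
Variables (R : realType) (kd : scalar_kind).
Local Notation K := (scalars R kd).
Variables (E : normedModType K) (F G : completeNormedModType K) (n : nat).
Variables (M : ('I_n -> G) -> F) (T : {linear E -> G}) (A : nat -> {linear G -> G}).
Hypotheses (mM : multilinear M) (bM : bounded_on_balls M).
Hypothesis cT : continuous T.
Hypotheses (cA : forall i, continuous (A i)) (fA : forall i, finite_rank (A i)).
Hypothesis uA : forall x, unconditionally_converges (fun i => A i x) x.

Definition partial_expansion (p q : nat) (y : G) : G := \sum_(p <= i < q) A i y.

Lemma partial_expansion_linear p q : linear (partial_expansion p q).
Proof.
move=> a x y; rewrite /partial_expansion scaler_sumr -big_split.
by apply: eq_bigr => i _ /=; rewrite linearP.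
Qed.

Lemma partial_expansion_bound : exists2 C, 0 < C &
  forall p q x, `|partial_expansion p q (T x)| <= C * `|x|.
Proof.
have [C C0 AC] := unconditional_expansion_bound cA uA.
have [D D0 TD] := continuous_linear_bound cT.
exists (C * D) => [|p q x]; first by rewrite mulr_gt0.
rewrite -mulrA (le_trans _ (ler_wpM2l (ltW C0) (TD x)))//.
have := AC p q (fun=> 1) (T x); under eq_bigr do rewrite scale1r; apply=> i.
by rewrite normr1.
Qed.

Lemma partial_expansion_weak_continuous p q :
  continuous (partial_expansion p q \o T : weak E -> G).
Proof.
have cAT i : continuous (A i \o T : weak E -> G).
  have cAT0 : continuous (A i \o T : {linear E -> G}).
    by move=> x; apply: continuous_comp; [exact: cT|exact: cA].
  apply: (finite_rank_weak_continuous cAT0).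
  by have [m [e Ae]] := fA i; exists m, e => x; exact: Ae.
have -> : partial_expansion p q \o T = fun x => \sum_(p <= i < q) (A i \o T) x by [].
elim: (index_iota p q) => [|i s IH].
  by under eq_fun do rewrite big_nil; exact: cst_continuous.
under eq_fun do rewrite big_cons.
by move=> x; apply: continuousD; [exact: cAT|exact: IH].
Qed.

Lemma partial_expansion_cvg y : partial_expansion 0 ^~ y @ \oo --> y.
Proof.
by apply: (uA (x := y) (s := id)); exact: (Bijective (g := id) (fun=> erefl) (fun=> erefl)).
Qed.

Variables (J : {set 'I_n}) (N0 : nat).
Hypothesis J0 : (0 < #|J|)%N.

Definition block_tuple (p q : nat) (x : 'I_n -> E) (i : 'I_n) : G :=
  if i \in J then partial_expansion p q (T (x i)) else partial_expansion 0 N0 (T (x i)).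

Lemma block_tuple_multilinear p q : multilinear (M \o block_tuple p q).
Proof.
move=> i x a y z /=.
pose L w := if i \in J then partial_expansion p q (T w)
            else partial_expansion 0 N0 (T w).
have btE w : block_tuple p q (dfwith x i w) = dfwith (block_tuple p q x) i (L w).
  apply/funext => j; have [<-|ij] := eqVneq i j.
    by rewrite dfwithin /block_tuple dfwithin.
  by rewrite dfwithout// /block_tuple dfwithout.
rewrite !btE -mM; congr (M (dfwith _ _ _)).
by rewrite /L; case: ifP => _; rewrite linearP partial_expansion_linear.
Qed.

Variable kk : nat -> nat.
Hypothesis kkS : forall j, (kk j < kk j.+1)%N.

Definition block (l : nat) (x : 'I_n -> E) : F := M (block_tuple (kk l) (kk l.+1) x).

(** By [block_sum], sums of consecutive blocks with coefficients are sums over the expansion itself,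
    with coefficients constant on each block; dividing [a] by [B] then reduces to
    [multilinear_diagonal_bound]. The vectors [y] are arbitrary so that one slot can be rescaled in
    [block_sum_tail]. *)
Let scaled_diag_bound p q (rho C : K) (a : nat -> K) (B : K) (w : 'I_n -> G)
    (y : 'I_n -> G) :
  (forall x, (forall i, `|x i| <= rho) -> `|M x| <= C) ->
  (forall j, (p <= j < q)%N -> `|a j| <= B) ->
  (forall i, i \notin J -> `|w i| <= rho) ->
  (forall i, i \in J -> forall t : nat -> K, (forall j, `|t j| <= 1) ->
     `|\sum_(kk p <= j < kk q) t j *: A j (y i)| <= rho) ->
  0 <= B -> 0 <= C ->
  `|\sum_(p <= j < q) a j *:
     M (fun i => if i \in J then partial_expansion (kk j) (kk j.+1) (y i) else w i)|
  <= C * B.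
Proof.
move=> MC aB wr yr B0 C0.
have [qp|/ltnW pq] := leqP q p; first by rewrite big_geq// normr0 mulr_ge0.
have [BE|Bn0] := eqVneq B 0.
  rewrite big_nat big1 ?normr0 ?BE ?mulr0// => j /aB.
  by rewrite BE normr_le0 => /eqP ->; rewrite scale0r.
have Bp : 0 < B by rewrite lt0r Bn0.
pose a' j := if (p <= j < q)%N then a j / B else 0.
have -> : \sum_(p <= j < q) a j *: M (fun i =>
      if i \in J then partial_expansion (kk j) (kk j.+1) (y i) else w i) =
    B *: \sum_(p <= j < q) a' j *: M (fun i =>
      if i \in J then partial_expansion (kk j) (kk j.+1) (y i) else w i).
  rewrite scaler_sumr; apply: eq_big_nat => j pj.
  by rewrite /a' pj scalerA mulrC divfK.
rewrite normrZ ger0_norm// mulrC ler_wpM2r//.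
apply: (@multilinear_diagonal_bound _ _ _ _ _ _ rho C _ mM MC (iota_uniq _ _) J w
  (fun j i => partial_expansion (kk j) (kk j.+1) (y i)) J0 wr) => [i iJ t t1|j].
  by rewrite block_sum// yr.
rewrite /a'; case: ifP => [pj|]; last by rewrite normr0.
by rewrite normrM normfV (ger0_norm B0) ler_pdivrMr// mul1r aB.
Qed.

Lemma block_sum_bound (rho : K) : 0 < rho -> exists2 C, 0 <= C &
  forall p q (a : nat -> K) B x, 0 <= B -> (forall j, (p <= j < q)%N -> `|a j| <= B) ->
  (forall i, `|x i| <= rho) -> `|\sum_(p <= j < q) a j *: block j x| <= C * B.
Proof.
move=> rho0; have [C1 C10 AC1] := unconditional_expansion_bound cA uA.
have [D D0 TD] := continuous_linear_bound cT.
have [C2 C20 SC2] := partial_expansion_bound.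
pose rho' := C1 * (D * rho) + C2 * rho.
have rho'0 : 0 < rho' by rewrite addr_gt0// !mulr_gt0.
have [C MC] := bM rho'0.
have C0 : 0 <= C.
  by rewrite (le_trans (normr_ge0 _) (MC (fun=> 0) _))// => i; rewrite normr0 ltW.
exists C => // p q a B x B0 aB xr.
apply: (@scaled_diag_bound _ _ rho' _ _ _ (fun i => partial_expansion 0 N0 (T (x i)))
  (fun i => T (x i))) => // [i iJ|i iJ t t1].
- rewrite (le_trans (SC2 _ _ _))// /rho' ler_wpDl ?mulr_ge0 ?(ltW C10) ?(ltW D0) ?(ltW rho0)//.
  by rewrite ler_pM2l.
- rewrite (le_trans (AC1 _ _ _ _ t1))// /rho' ler_wpDr ?mulr_ge0 ?(ltW C20) ?(ltW rho0)//.
  by rewrite ler_pM2l// (le_trans (TD _))// ler_pM2l.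
Qed.

(** Smallness in one slot suffices: late sums of the expansion of [T (x i0)] are at most [d], so
    this slot can be multiplied by [d^-1] and still stay within [rho], which gains the factor
    [d]. *)
Lemma block_sum_tail (a : nat -> K) (B e : K) (x : 'I_n -> E) :
  (forall j, `|a j| <= B) -> 0 < e ->
  exists N, forall p q, (N <= p)%N -> `|\sum_(p <= j < q) a j *: block j x| <= e.
Proof.
move=> aB e0; have B0 : 0 <= B by exact: le_trans (aB 0%N).
have [i0 i0J] : exists i0, i0 \in J by apply/set0Pn; rewrite -card_gt0.
have [C1 C10 AC1] := unconditional_expansion_bound cA uA.
pose rho := 1 + \sum_i (C1 * `|T (x i)| + `|partial_expansion 0 N0 (T (x i))|).
have term_ge0 i : 0 <= C1 * `|T (x i)| + `|partial_expansion 0 N0 (T (x i))|.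
  by rewrite addr_ge0// mulr_ge0// ltW.
have rho1 : 1 <= rho by rewrite lerDl sumr_ge0.
have rho0 : 0 < rho by exact: lt_le_trans rho1.
have rhoi i : C1 * `|T (x i)| + `|partial_expansion 0 N0 (T (x i))| <= rho.
  by rewrite /rho (bigD1 i)//= addrCA lerDl addr_ge0// sumr_ge0.
have [C MC] := bM rho0.
have C0 : 0 <= C.
  by rewrite (le_trans (normr_ge0 _) (MC (fun=> 0) _))// => i; rewrite normr0 ltW.
pose d := e / (C * B + 1).
have CB0 : 0 < C * B + 1 by rewrite ltr_wpDl// mulr_ge0.
have d0 : 0 < d by rewrite divr_gt0.
have [N xN] := unconditional_scalar_tail (@uA (T (x i0))) d0.
exists N => p q Np.
pose y i := if i == i0 then d^-1 *: T (x i0) else T (x i).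
have -> : \sum_(p <= j < q) a j *: block j x = d *: \sum_(p <= j < q) a j *:
    M (fun i => if i \in J then partial_expansion (kk j) (kk j.+1) (y i)
                else partial_expansion 0 N0 (T (x i))).
  rewrite scaler_sumr; apply: eq_bigr => j _; rewrite scalerA mulrC -scalerA.
  congr (_ *: _); set w := (X in _ = _ *: M X).
  rewrite -(dfwith_id w i0) -(multilinear_slotZ mM) /block; congr M.
  apply/funext => i; have [<-|ii0] := eqVneq i0 i.
    rewrite dfwithin /w /block_tuple i0J /y eqxx.
    rewrite /partial_expansion scaler_sumr; apply: eq_bigr => m _.
    by rewrite linearZ scalerA divff ?gt_eqF// scale1r.
  by rewrite dfwithout// /w /block_tuple /y eq_sym (negbTE ii0).
rewrite normrZ gtr0_norm// (@le_trans _ _ (d * (C * B)))//; last first.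
  by rewrite /d mulrAC ler_pdivrMr// ler_pM2l// lerDl.
rewrite ler_pM2l//; apply: (@scaled_diag_bound _ _ rho) => // [i iJ|i iJ t t1].
  by rewrite (le_trans _ (rhoi i))// lerDr mulr_ge0// ltW.
rewrite /y; case: eqP => [_|_]; last first.
  by rewrite (le_trans (AC1 _ _ _ _ t1))// (le_trans _ (rhoi i))// lerDl.
under eq_bigr do rewrite linearZ scalerA mulrC -scalerA.
rewrite -scaler_sumr normrZ normfV gtr0_norm// ler_pdivrMl//.
rewrite (le_trans (xN _ _ _ _ t1)) ?(leq_trans Np (block_ge kkS _))//.
by rewrite ler_peMr// ltW.
Qed.

Lemma block_poly_exists (a : nat -> K) (B : K) : (forall j, `|a j| <= B) ->
  exists P : hpoly E F n, forall x,
    (fun m => \sum_(0 <= j < m) a j *: block j (fun=> x)) @ \oo --> P x.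
Proof.
move=> aB; have B0 : 0 <= B by exact: le_trans (aB 0%N).
(* Convergence is proved for tuples with different entries, so that the limit is itself a
   multilinear map. *)
have /choice[L Lx] : forall x, exists l : F,
    (fun m => \sum_(0 <= j < m) a j *: block j x) @ \oo --> l.
  move=> x; apply/cvg_ex/complete_cvgn => e e0.
  have [N xN] := block_sum_tail x aB e0.
  exists N => p q Np pq; have := xN p q Np.
  by rewrite (@big_cat_nat _ _ _ p 0 q)//= addrAC subrr add0r; exact.
have mL : multilinear L.
  move=> i x c y z; apply: (cvg_unique _ (Lx _)) => //.
  have -> : (fun m => \sum_(0 <= j < m) a j *: block j (dfwith x i (c *: y + z))) =
      fun m => c *: (\sum_(0 <= j < m) a j *: block j (dfwith x i y)) +
        \sum_(0 <= j < m) a j *: block j (dfwith x i z).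
    apply/funext => m; rewrite scaler_sumr -big_split; apply: eq_bigr => j _ /=.
    rewrite -[block j (dfwith x i (_ + _))]/((M \o block_tuple _ _) _).
    by rewrite (block_tuple_multilinear _ _ i x c) scalerDr !scalerA mulrC.
  by apply: cvgD; [apply: cvgZr|]; exact: Lx.
have bL : bounded_on_balls L.
  move=> rho rho0; have [C C0 SC] := block_sum_bound rho0.
  exists (C * B) => x xr; rewrite -[L x]subr0.
  apply: (cvgn_norm_le (Lx x) (N := 0)) => m _.
  by rewrite subr0 SC.
have [P PL] := bounded_multilinear_hpoly mL bL.
by exists P => x; rewrite PL; exact: Lx.
Qed.

(** The polynomial [sum_j a_j P_j], with default value [0] when the series does not define one;
    [block_poly_exists] rules this out for bounded [a]. *)
Definition block_poly (a : nat -> K) : hpoly E F n :=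
  xget 0 [set P : hpoly E F n | forall x,
    (fun m => \sum_(0 <= j < m) a j *: block j (fun=> x)) @ \oo --> P x].

Lemma block_poly_cvg (a : nat -> K) (B : K) : (forall j, `|a j| <= B) ->
  forall x, (fun m => \sum_(0 <= j < m) a j *: block j (fun=> x)) @ \oo --> block_poly a x.
Proof.
move=> aB; have [P Px] := block_poly_exists aB.
by rewrite /block_poly; case: xgetP => [Q _ //|/(_ P)]; exact.
Qed.

Lemma block_poly_linear (c : K) (a b : nat -> K) (B B' : K) :
  (forall j, `|a j| <= B) -> (forall j, `|b j| <= B') ->
  block_poly (fun j => c * a j + b j) = c *: block_poly a + block_poly b.
Proof.
move=> aB bB'; have cab j : `|c * a j + b j| <= `|c| * B + B'.
  by rewrite (le_trans (ler_normD _ _))// lerD// normrM ler_wpM2l.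
apply: hpoly_ext => x; rewrite hpoly_addE hpoly_scaleE.
apply: (cvg_unique _ (@block_poly_cvg _ _ cab x)) => //.
have -> : (fun m => \sum_(0 <= j < m) (c * a j + b j) *: block j (fun=> x)) =
    fun m => c *: (\sum_(0 <= j < m) a j *: block j (fun=> x)) +
      \sum_(0 <= j < m) b j *: block j (fun=> x).
  apply/funext => m; rewrite scaler_sumr -big_split; apply: eq_bigr => j _ /=.
  by rewrite scalerDl scalerA.
apply: cvgD; last exact: (@block_poly_cvg _ _ bB' x).
by apply: cvgZr; exact: (@block_poly_cvg _ _ aB x).
Qed.

(** The estimate involves the bound [B] of the tail and not the global bound [B']. With [m = 0] it
    controls the norm; for null sequences and large [m] it gives a uniform approximation on balls by
    finite sums. *)
Lemma block_poly_bound (rho : K) : 0 < rho -> exists2 C, 0 <= C &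
  forall (a : nat -> K) B B' x m, (forall j, `|a j| <= B') ->
    (forall j, (m <= j)%N -> `|a j| <= B) -> `|x| <= rho ->
    `|block_poly a x - \sum_(0 <= j < m) a j *: block j (fun=> x)| <= C * B.
Proof.
move=> rho0; have [C C0 SC] := block_sum_bound rho0; exists C => // a B B' x m aB' aB xr.
apply: (cvgn_norm_le (@block_poly_cvg _ _ aB' x) (N := m)) => q mq.
rewrite (@big_cat_nat _ _ _ m 0 q)//= addrAC subrr add0r SC//.
- exact: le_trans (aB m (leqnn m)).
- by move=> j /andP[mj _]; exact: aB.
Qed.

Lemma block_weak_continuous l : continuous ((fun x => block l (fun=> x)) : weak E -> F).
Proof.
move=> x; apply: (multilinear_cvg mM bM (H := nbhs (x : weak E))
  (g := fun y => block_tuple (kk l) (kk l.+1) (fun=> y))) => i.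
rewrite /block_tuple; case: ifP => _; exact: partial_expansion_weak_continuous.
Qed.

Lemma bounded_set_ball (V : normedModType K) (B : set V) : bounded_set B ->
  exists2 rho, 0 < rho & forall x, B x -> `|x| <= rho.
Proof.
move=> [N [Nr NB]]; exists (`|N| + 1); first by rewrite ltr_wpDl.
by move=> x Bx; apply: NB => //; rewrite (le_lt_trans (real_ler_norm Nr))// ltrDl.
Qed.

(** On bounded sets the polynomial is a uniform limit of the finite sums [g], which are weakly
    continuous because their slots have finite rank. *)
Lemma block_poly_Pw (a : nat -> K) (a0 : (a : nat -> K^o) @ \oo --> (0 : K^o)) :
  Pw (block_poly a).
Proof.
have [B aB] : exists B, forall j, `|a j| <= B.
  have /cvgn_distP/(_ 1 ltr01)[N aN] := a0.
  exists (1 + \sum_(0 <= j < N) `|a j|) => j; have [jN|jN] := leqP N j.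
    by rewrite (le_trans (_ : _ <= 1))// ?lerDl ?sumr_ge0// -[a j]subr0 aN.
  rewrite (bigD1_seq j) ?mem_index_iota ?iota_uniq//= addrCA lerDl.
  by rewrite addr_ge0// sumr_ge0.
move=> D /bounded_set_ball[rho rho0 Dr]; apply/subspace_continuousP => x Dx.
have [C C0 SC] := block_poly_bound rho0.
apply/cvgrPdist_le => e e0.
have e3 : 0 < e / 3 by rewrite divr_gt0.
have C1 : 0 < C + 1 by rewrite ltr_wpDl.
have /cvgn_distP/(_ (e / 3 / (C + 1)))[|N aN] := a0; first by rewrite divr_gt0.
pose g y := \sum_(0 <= j < N) a j *: block j (fun=> y).
have fg y : D y -> `|block_poly a y - g y| <= e / 3.
  move=> /Dr yr; rewrite (le_trans (SC _ (e / 3 / (C + 1)) _ _ _ aB _ yr))//.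
    by move=> j Nj; rewrite -[a j]subr0 aN.
  by rewrite mulrA ler_pdivrMr// mulrC ler_pM2l// lerDl.
have cg : continuous (g : weak E -> F).
  rewrite /g; elim: (index_iota 0 N) => [|j s IH].
    by under eq_fun do rewrite big_nil; exact: cst_continuous.
  under eq_fun do rewrite big_cons.
  move=> y; have Fy := nbhs_filter (y : weak E).
  exact: (cvgD (FF := Fy) (cvgZr (FF := Fy) (@block_weak_continuous j y)) (IH y)).
have /cvgrPdist_le/(_ _ e3) gx := cg x.
rewrite near_withinE; near=> y => Dy.
have h : `|g x - g y| <= e / 3 by near: y.
rewrite -(subrKA (g x)) -(subrKA (g y) (g x)).
have -> : e = e / 3 + (e / 3 + e / 3) by field.
rewrite (le_trans (ler_normD _ _))// lerD ?fg// (le_trans (ler_normD _ _))// lerD//.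
by rewrite distrC fg.
Unshelve. all: by end_near. Qed.

End BlockPolynomials.

Lemma multilinear_scale_on (K : numFieldType) (V W : normedModType K) (n : nat)
    (M : ('I_n -> V) -> W) (J : {set 'I_n}) (c : K) (v w : 'I_n -> V) :
  multilinear M ->
  M (fun i => if i \in J then c *: v i else w i) =
  c ^+ #|J| *: M (fun i => if i \in J then v i else w i).
Proof.
move=> mM; move Jm : #|J| => m; elim: m J Jm w => [|m IH] J Jm w.
  move/eqP: Jm; rewrite cards_eq0 => /eqP ->; rewrite expr0 scale1r.
  by congr M; apply/funext => i; rewrite inE.
have [i0 i0J] : exists i0, i0 \in J by apply/set0Pn; rewrite -card_gt0 Jm.
have /eqP := Jm; rewrite (cardsD1 i0) i0J add1n eqSS => /eqP J'm.
have slotE (u : 'I_n -> V) y : (fun i => if i \in J then u i else w i) =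
    dfwith (fun i => if i \in (J :\ i0)%SET then u i else (dfwith w i0 y) i) i0 (u i0).
  apply/funext => i; have [<-|ii0] := eqVneq i0 i; first by rewrite dfwithin i0J.
  by rewrite !dfwithout// in_setD1 eq_sym ii0.
rewrite (slotE _ (v i0)) (multilinear_slotZ mM).
have fixed (u : 'I_n -> V) :
    dfwith (fun i => if i \in (J :\ i0)%SET then u i else (dfwith w i0 (v i0)) i)
      i0 (v i0) =
    fun i => if i \in (J :\ i0)%SET then u i else (dfwith w i0 (v i0)) i.
  apply/funext => i; have [<-|ii0] := eqVneq i0 i.
    by rewrite !dfwithin in_setD1 eqxx.
  by rewrite dfwithout.
by rewrite fixed IH// scalerA -exprS (slotE v (v i0)) fixed.
Qed.

Lemma sum_pow2_le (K : numFieldType) m : \sum_(0 <= l < m) 2^-1 ^+ l <= 2 :> K.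
Proof.
suff -> : \sum_(0 <= l < m) 2^-1 ^+ l = 2 - 2 * 2^-1 ^+ m :> K.
  by rewrite gerBl mulr_ge0// exprn_ge0// invr_ge0.
elim: m => [|m IH]; first by rewrite big_geq// expr0 mulr1 subrr.
by rewrite big_nat_recr//= IH exprS; field.
Qed.

(** * Values of block polynomials at perturbations of [xs] *)

Section TestEstimate.
Variables (R : realType) (kd : scalar_kind).
Local Notation K := (scalars R kd).
Variables (E : normedModType K) (F G : completeNormedModType K) (n : nat).
Variables (M : ('I_n -> G) -> F) (T : {linear E -> G}) (A : nat -> {linear G -> G}).
Hypotheses (mM : multilinear M) (bM : bounded_on_balls M).
Hypothesis cT : continuous T.
Hypotheses (cA : forall i, continuous (A i)) (fA : forall i, finite_rank (A i)).
Hypothesis uA : forall x, unconditionally_converges (fun i => A i x) x.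
Variables (J : {set 'I_n}) (N0 : nat).
Hypothesis J0 : (0 < #|J|)%N.
Local Notation S := (partial_expansion A).

Definition slot_form (xs h : E) : F :=
  M (fun i => if i \in J then T h else S 0 N0 (T xs)).

(** At the test point the block [l] of the expansion is close to [al l *: T (h l)] if [l] is in [I]
    and to [0] otherwise. The Lipschitz estimate for [M] turns this into an error for each block,
    and the errors are summable. *)
Lemma block_poly_test (rho : K) : 0 < rho -> exists2 C, 0 <= C &
  forall (kk : nat -> nat) (xs : E) (h : nat -> E) (tau : K),
  (forall j, (kk j < kk j.+1)%N) -> 0 <= tau -> `|xs| <= rho ->
  (forall i, `|h i| <= rho) ->
  (forall l, `|S (kk l) (kk l.+1) (T xs)| <= tau * 2^-1 ^+ l) ->
  (forall l i, `|S (kk l) (kk l.+1) (T (h i)) - (if l == i then T (h i) else 0)| <=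
     tau * 2^-1 ^+ l) ->
  (forall i, `|S 0 N0 (T (h i))| <= tau) ->
  forall (a : nat -> K) (B : K), (forall j, `|a j| <= B) ->
  forall (I : seq nat) (al : nat -> K), uniq I -> (size I <= 3)%N ->
  (forall i, `|al i| <= 2) ->
  `|block_poly M T A J N0 kk a (xs + \sum_(i <- I) al i *: h i) -
    \sum_(i <- I) (a i * al i ^+ #|J|) *: slot_form xs (h i)| <= C * tau * B.
Proof.
move=> rho0; have [C2 C20 SC] := partial_expansion_bound cT cA uA.
have [D D0 TD] := continuous_linear_bound cT.
pose rho2 := C2 * (7 * rho) + D * (2 * rho).
have rho20 : 0 < rho2 by rewrite addr_gt0// !mulr_gt0.
have [CL CL0 lipM] := multilinear_lipschitz mM bM rho20.
exists (CL * 35) => [|kk xs h tau kkS tau0 xsr hr Sxs Sh S0h a B aB I al uI sI al2].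
  by rewrite mulr_ge0.
have B0 : 0 <= B by exact: le_trans (aB 0%N).
have sumI (v : nat -> G) (c : K) : 0 <= c -> (forall i, `|v i| <= c) ->
    `|\sum_(i <- I) al i *: v i| <= 6 * c.
  move=> c0 vc; rewrite (le_trans (ler_norm_sum _ _ _))//.
  rewrite (@le_trans _ _ (\sum_(i <- I) 2 * c))//.
    by apply: ler_sum => i _; rewrite normrZ ler_pM.
  rewrite big_const_seq count_predT iter_addr_0 -[_ *+ size I]mulr_natl mulrA ler_wpM2r//.
  by rewrite -natrM ler_nat; exact: (leq_mul sI (leqnn 2)).
set y := \sum_(i <- I) al i *: h i.
(* At most three terms with coefficients of norm at most 2 give [6]; adding [xs] gives [7]. *)
have yr : `|y| <= 6 * rho.
  rewrite (le_trans (ler_norm_sum _ _ _))//.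
  rewrite (@le_trans _ _ (\sum_(i <- I) 2 * rho))//.
    by apply: ler_sum => i _; rewrite normrZ ler_pM.
  rewrite big_const_seq count_predT iter_addr_0 -[_ *+ size I]mulr_natl mulrA ler_wpM2r ?(ltW rho0)//.
  by rewrite -natrM ler_nat; exact: (leq_mul sI (leqnn 2)).
set x := xs + y.
have xr : `|x| <= 7 * rho.
  by rewrite (le_trans (ler_normD _ _))// (_ : 7 = 1 + 6)// mulrDl mul1r lerD.
have Srho2 p q z : `|z| <= 7 * rho -> `|S p q (T z)| <= rho2.
  move=> zr; rewrite (le_trans (SC _ _ _))// /rho2 ler_wpDr//.
    by rewrite !mulr_ge0// ltW.
  by rewrite ler_pM2l.
have xs7 : `|xs| <= 7 * rho by rewrite (le_trans xsr)// ler_peMl ?(ltW rho0)// ler1n.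
have SD p q z : S p q (T (xs + \sum_(i <- I) al i *: z i)) =
    S p q (T xs) + \sum_(i <- I) al i *: S p q (T (z i)).
  have SL := partial_expansion_linear A p q.
  have S1 u v : S p q (u + v) = S p q u + S p q v by have := SL 1 u v; rewrite !scale1r.
  have S00 : S p q 0 = 0.
    by have /eqP := S1 0 0; rewrite addr0 addrC -subr_eq subrr => /eqP.
  rewrite linearD S1; congr (_ + _); rewrite linear_sum (big_morph _ S1 S00).
  by apply: eq_bigr => i _; rewrite linearZ -[X in S _ _ X]addr0 SL S00 addr0.
pose b l := if l \in I then al l ^+ #|J| *: slot_form xs (h l) else 0.
(* For [l] in [I] the slots outside [J] contribute an error of order [tau] without decay, but at
   most three times. For the other [l] they are compared with [S 0 N0 (T x)] itself, since a zero in
   a slot of [J] already makes [M w] vanish; the error then decays geometrically. *)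
pose eta l := if l \in I then 7 * tau else 7 * tau * 2^-1 ^+ l.
have pow_le1 l : 2^-1 ^+ l <= 1 :> K.
  by rewrite exprn_ile1// ?invr_ge0// invf_le1// ler1n.
have eta0 l : 0 <= eta l.
  by rewrite /eta; case: ifP => _; rewrite !mulr_ge0// exprn_ge0// invr_ge0.
have blockb l : `|block M T A J N0 kk l (fun=> x) - b l| <= CL * eta l.
  pose w i : G := if i \in J then (if l \in I then al l *: T (h l) else 0)
    else if l \in I then S 0 N0 (T xs) else S 0 N0 (T x).
  have Mw : M w = b l.
    rewrite /b /w; case: (l \in I); first exact: multilinear_scale_on.
    have [i0 i0J] : exists i0, i0 \in J by apply/set0Pn; rewrite -card_gt0.
    by rewrite (multilinear_eq0 mM (i := i0))// i0J.
  rewrite -Mw; apply: lipM => // [i|i|i].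
  - by rewrite /block_tuple; case: ifP => _; exact: Srho2.
  - rewrite /w; case: ifP => _; case: ifP => _; rewrite ?Srho2//.
    + rewrite normrZ /rho2 ler_wpDl//; first by rewrite !mulr_ge0// ltW.
      rewrite mulrCA ler_pM// (le_trans (TD _))// ler_pM2l//.
    + by rewrite normr0 ltW.
  - rewrite /block_tuple /w; case: ifP => _; last first.
      rewrite /eta; case: ifP => _; last by rewrite subrr normr0 !mulr_ge0// exprn_ge0// invr_ge0.
      rewrite SD addrC addKr (le_trans (sumI _ _ tau0 S0h))// ler_wpM2r// ler_nat//.
    have -> : (if l \in I then al l *: T (h l) else 0) =
        \sum_(i <- I) al i *: (if l == i then T (h i) else 0).
      case: ifPn => lI.
        rewrite (bigD1_seq l)//= eqxx big1 ?addr0// => j; rewrite eq_sym => /negbTE ->.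
        by rewrite scaler0.
      rewrite big1_seq// => j /andP[_ iI]; case: eqP => [li|_]; last by rewrite scaler0.
      by rewrite li iI in lI.
    rewrite SD -addrA -sumrB; under eq_bigr do rewrite -scalerBr.
    have t0 : 0 <= tau * 2^-1 ^+ l by rewrite mulr_ge0// exprn_ge0// invr_ge0.
    have h7 : `|S (kk l) (kk l.+1) (T xs) + \sum_(i <- I) al i *:
        (S (kk l) (kk l.+1) (T (h i)) - (if l == i then T (h i) else 0))| <=
        7 * (tau * 2^-1 ^+ l).
      rewrite (le_trans (ler_normD _ _))// (_ : 7 = 1 + 6)// mulrDl mul1r lerD//.
      exact: sumI.
    rewrite (le_trans h7)// /eta mulrA; case: ifP => // _.
    by rewrite ler_piMr// mulr_ge0.
have sumeta m : \sum_(0 <= l < m) eta l <= 35 * tau.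
  rewrite (@le_trans _ _ (\sum_(0 <= l < m) 7 * tau * 2^-1 ^+ l +
      \sum_(0 <= l < m | l \in I) 7 * tau))//.
    rewrite [X in _ + X]big_mkcond -big_split ler_sum// => l _ /=; rewrite /eta.
    by case: ifP => _; rewrite ?addr0// lerDr !mulr_ge0// exprn_ge0// invr_ge0.
  (* The geometric series contributes at most [2], the indices of [I] at most [3]. *)
  have -> : 35 * tau = 7 * tau * 2 + 7 * tau * 3 by ring.
  have tau7 : 0 <= 7 * tau by rewrite mulr_ge0.
  apply: lerD; first by rewrite -mulr_sumr ler_wpM2l// sum_pow2_le.
  rewrite -big_filter big_const_seq count_predT iter_addr_0 -[_ *+ size _]mulr_natr.
  rewrite ler_wpM2l// ler_nat (leq_trans _ sI)//.
  apply: uniq_leq_size; first exact: filter_uniq (iota_uniq _ _).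
  by move=> i; rewrite mem_filter => /andP[].
pose m0 := (\max_(i <- I) i).+1.
apply: (cvgn_norm_le
  (@block_poly_cvg _ _ _ _ _ _ _ _ _ mM bM cT cA uA _ N0 J0 kk kkS a B aB x) (N := m0)) => m m0m.
have -> : \sum_(i <- I) (a i * al i ^+ #|J|) *: slot_form xs (h i) =
    \sum_(0 <= l < m) a l *: b l.
  have -> : \sum_(0 <= l < m) a l *: b l =
      \sum_(0 <= l < m | l \in I) (a l * al l ^+ #|J|) *: slot_form xs (h l).
    rewrite [RHS]big_mkcond; apply: eq_bigr => l _; rewrite /b.
    by case: ifP => _; rewrite ?scaler0// scalerA.
  rewrite -[RHS]big_filter; apply: perm_big; apply: uniq_perm => //.
    exact: filter_uniq (iota_uniq _ _).
  move=> i; rewrite mem_filter mem_index_iota; case: (boolP (i \in I)) => //= iI.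
  by apply/esym; rewrite (leq_trans _ m0m)// ltnS leq_bigmax_seq.
rewrite -sumrB (le_trans (ler_norm_sum _ _ _))//.
rewrite (@le_trans _ _ (\sum_(0 <= l < m) B * (CL * eta l)))//.
  by apply: ler_sum => l _; rewrite -scalerBr normrZ ler_pM.
rewrite -!mulr_sumr mulrC ler_wpM2r// -mulrA ler_wpM2l//.
Qed.

End TestEstimate.

(** * Gliding hump *)

Lemma not_weakly_continuous (R : realType) (kd : scalar_kind)
    (E F : normedModType (scalars R kd)) (n : nat) (P : hpoly E F n) : ~ Pw P ->
  exists (xs : E) (rho eps : scalars R kd), [/\ 0 < rho, 0 < eps, `|xs| <= rho &
    forall W : set E, nbhs (xs : weak E) W ->
      exists x, [/\ W x, `|x| <= rho & eps <= `|P x - P xs|]].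
Proof.
move=> /existsNP[B /not_implyP[/bounded_set_ball[rho rho0 Br]]].
move=> /subspace_continuousP/existsNP[xs /not_implyP[Bxs ncvg]].
have [eps [eps0 neps]] : exists eps : scalars R kd, 0 < eps /\
    ~ \forall x \near within B (nbhs (xs : weak E)), `|P xs - P x| < eps.
  apply: contrapT => /forallNP h; apply: ncvg; apply/cvgrPdist_lt => e e0.
  by apply: contrapT => ne; apply: (h e).
exists xs, rho, eps; split=> //; first exact: Br.
move=> W xsW; apply: contrapT => /forallNP h; apply: neps.
rewrite near_withinE; apply: filterS xsW => x Wx Bx.
rewrite real_ltNge ?normr_real ?gtr0_real//; apply/negP => hx.
by apply: (h x); split=> //; [exact: Br|rewrite distrC].
Qed.

Section Gliding.
Variables (R : realType) (kd : scalar_kind).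
Local Notation K := (scalars R kd).
Variables (E : normedModType K) (F G : completeNormedModType K) (n : nat).
Variables (M : ('I_n -> G) -> F) (T : {linear E -> G}) (A : nat -> {linear G -> G}).
Hypotheses (mM : multilinear M) (bM : bounded_on_balls M).
Hypothesis cT : continuous T.
Hypotheses (cA : forall i, continuous (A i)) (fA : forall i, finite_rank (A i)).
Hypothesis uA : forall x, unconditionally_converges (fun i => A i x) x.
Local Notation S := (partial_expansion A).

Lemma discontinuous_slots (P : hpoly E F n) (c : K) : c != 0 ->
  (forall x, M (fun=> T x) = c *: P x) -> ~ Pw P ->
  exists (J : {set 'I_n}) (N0 : nat) (xs : E) (rho eps : K),
    [/\ (0 < #|J|)%N, 0 < rho, 0 < eps, `|xs| <= rho &
    forall W : set E, nbhs (xs : weak E) W ->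
      exists h, [/\ W (xs + h), `|h| <= rho & eps <= `|slot_form M T A J N0 xs h|]].
Proof.
move=> c0 MP /not_weakly_continuous[xs [rho [eps [rho0 eps0 xsr Pxs]]]].
have [D D0 TD] := continuous_linear_bound cT.
pose term (f : {ffun 'I_n -> bool}) (u h : E) : F :=
  M (fun i => if f i then T h else T u).
pose f0 : {ffun 'I_n -> bool} := [ffun=> false].
have nc0 : 0 < `|c| by rewrite normr_gt0.
pose N := #|{: {ffun 'I_n -> bool}}|.
(* [N] terms of size at most [eps1] cannot add up to [|c| * eps], so some term other than the
   constant one [f0] must be large. *)
pose eps1 := `|c| * eps / N.+1%:R.
have eps10 : 0 < eps1 by rewrite divr_gt0// mulr_gt0.
have [f f_neq0 termf] : exists2 f, f != f0 &
    forall W : set E, nbhs (xs : weak E) W ->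
    exists h, [/\ W (xs + h), `|xs + h| <= rho & eps1 <= `|term f xs h|].
  apply: contrapT => nf.
  have small f : f != f0 -> \forall x \near nbhs (xs : weak E),
      `|x| <= rho -> `|term f xs (x - xs)| < eps1.
    move=> ff0; apply: contrapT => nW; apply: nf; exists f => // W xsW.
    apply: contrapT => /forallNP h; apply: nW; apply: filterS xsW => x Wx xr.
    rewrite real_ltNge ?normr_real ?gtr0_real//; apply/negP => hx.
    by apply: (h (x - xs)); rewrite addrC subrK.
  have /Pxs[x [Wx xr]] : \forall x \near nbhs (xs : weak E),
      forall f, f != f0 -> `|x| <= rho -> `|term f xs (x - xs)| < eps1.
    apply: filter_forall => f; have [->|ff0] := eqVneq f f0.
      by apply: filterE.
    by apply: filterS (small f ff0) => x h _; exact: h.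
  have : `|c| * `|P x - P xs| <= N%:R * eps1.
    rewrite -normrZ scalerBr -!MP.
    have -> : M (fun=> T x) = \sum_f term f xs (x - xs).
      rewrite -(multilinear_expandD (fun=> T xs) (fun=> T (x - xs)) mM).
      by congr M; apply/funext => i; rewrite -linearD addrC subrK.
    rewrite (bigD1 f0)//= addrC.
    have -> : term f0 xs (x - xs) = M (fun=> T xs).
      by congr M; apply/funext => i; rewrite ffunE.
    rewrite addrK (le_trans (ler_norm_sum _ _ _))//.
    rewrite (@le_trans _ _ (\sum_(f : {ffun 'I_n -> bool} | f != f0) eps1))//.
      by apply: ler_sum => f ff0; apply: ltW; exact: Wx.
    rewrite (@le_trans _ _ (\sum_(f : {ffun 'I_n -> bool}) eps1))//.
      by rewrite [X in _ <= X](bigD1 f0)//= lerDr ltW.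
    by rewrite sumr_const mulr_natl.
  move=> h1 h2; have := le_trans (ler_wpM2l (ltW nc0) h2) h1.
  have <- : N.+1%:R * eps1 = `|c| * eps by rewrite mulrC divfK.
  by rewrite -natr1 mulrDl mul1r gerDl => /(lt_le_trans eps10); rewrite ltxx.
pose J : {set 'I_n} := [set i | f i]%SET.
have [C2 C20 SC] := partial_expansion_bound cT cA uA.
pose r := D * (2 * rho) + (D * rho + C2 * rho).
have r0 : 0 < r by rewrite !addr_gt0// !mulr_gt0.
have [CL CL0 lipM] := multilinear_lipschitz mM bM r0.
have CL1 : 0 < CL + 1 by rewrite ltr_wpDl.
pose eta := eps1 / 2 / (CL + 1).
have eta0 : 0 < eta by rewrite divr_gt0// divr_gt0.
(* [N0] is so large that replacing [T xs] by its truncation in the slots outside [J] costs at most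
   half of [eps1]. *)
have /cvgn_distP/(_ _ eta0)[N0 SN0] := @partial_expansion_cvg _ _ _ _ uA (T xs).
exists J, N0, xs, (2 * rho), (eps1 / 2); split.
- rewrite card_gt0; apply: contra_neq f_neq0 => J0; apply/ffunP => i.
  by have := finset.in_set0 i; rewrite -J0 inE ffunE.
- by rewrite mulr_gt0.
- by rewrite divr_gt0.
- by rewrite (le_trans xsr)// ler_peMl ?ler1n ?(ltW rho0).
move=> W /termf[h [Wh hr termh]]; have {}hr : `|h| <= 2 * rho.
  rewrite -(addKr xs h) (le_trans (ler_normD _ _))// normrN addrC.
  by rewrite mulr_natl mulr2n lerD.
exists h; split=> //.
have : `|term f xs h - slot_form M T A J N0 xs h| <= eps1 / 2.
  have Th : `|T h| <= r.
    rewrite (le_trans (TD _))// (@le_trans _ _ (D * (2 * rho)))// ?ler_pM2l//.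
    by rewrite lerDl addr_ge0// mulr_ge0 ?(ltW D0) ?(ltW C20) ?(ltW rho0).
  have rD : D * rho + C2 * rho <= r by rewrite lerDr !mulr_ge0 ?(ltW D0) ?(ltW rho0).
  rewrite (@le_trans _ _ (CL * eta))//.
    apply: lipM => [|i|i|i]; rewrite ?inE; first exact: ltW.
    - case: ifP => // _; rewrite (le_trans (TD _))// (le_trans _ rD)//.
      by rewrite ler_wpDr ?ler_pM2l// mulr_ge0 ?(ltW C20) ?(ltW rho0).
    - case: ifP => // _; rewrite (le_trans (SC _ _ _))// (le_trans _ rD)//.
      by rewrite ler_wpDl ?ler_pM2l// mulr_ge0 ?(ltW D0) ?(ltW rho0).
    - case: ifP => // _; first by rewrite subrr normr0 ltW.
      by rewrite distrC SN0.
  by rewrite /eta mulrA ler_pdivrMr// mulrC ler_pM2l ?lerDl// divr_gt0.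
move=> h1.
have tri : `|term f xs h| <= `|term f xs h - slot_form M T A J N0 xs h| +
    `|slot_form M T A J N0 xs h|.
  by rewrite -{1}(subrK (slot_form M T A J N0 xs h) (term f xs h)) ler_normD.
have := le_trans termh (le_trans tri (lerD h1 (lexx _))).
by rewrite {1}[eps1]splitr lerD2l.
Qed.

End Gliding.

(** Dependent choice with memory: in the gliding hump each new vector is compared with all its
    predecessors. *)
Lemma sequence_choice (X : Type) (P : nat -> seq X -> X -> Prop) :
  (forall k s, exists x, P k s x) -> exists f : nat -> X, forall k, P k (mkseq f k) (f k).
Proof.
move=> Pex; have /choice[g gP] : forall ks : nat * seq X, exists x, P ks.1 ks.2 x.
  by move=> [k s]; exact: Pex.
pose s := fix s k := if k is k'.+1 then rcons (s k') (g (k', s k')) else [::].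
exists (fun k => g (k, s k)) => k.
suff -> : mkseq (fun k => g (k, s k)) k = s k by exact: (gP (k, s k)).
by elim: k => // k IH; rewrite mkseqS IH.
Qed.

Section GlidingHump.
Variables (R : realType) (kd : scalar_kind).
Local Notation K := (scalars R kd).
Variables (E : normedModType K) (F G : completeNormedModType K) (n : nat).
Variables (M : ('I_n -> G) -> F) (T : {linear E -> G}) (A : nat -> {linear G -> G}).
Hypotheses (mM : multilinear M) (bM : bounded_on_balls M).
Hypothesis cT : continuous T.
Hypotheses (cA : forall i, continuous (A i)) (fA : forall i, finite_rank (A i)).
Hypothesis uA : forall x, unconditionally_converges (fun i => A i x) x.
Local Notation S := (partial_expansion A).
Variables (J : {set 'I_n}) (N0 : nat) (xs : E) (rho eps : K).
Hypotheses (rho0 : 0 < rho) (eps0 : 0 < eps).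
Local Notation d := (slot_form M T A J N0 xs).
Hypothesis discont : forall W : set E, nbhs (xs : weak E) W ->
  exists h, [/\ W (xs + h), `|h| <= rho & eps <= `|d h|].

(** With a single slot in [J], [slot_form] is linear and bounded in [h], so that weak neighbourhoods
    control [psi (d h)]; this separates the values of [d] in [gliding_step]. *)
Lemma slot_form_dual (psi : {linear F -> K^o}) : #|J| = 1%N -> continuous psi ->
  exists phi : dual E, sval phi = psi \o d :> (E -> K^o).
Proof.
move=> /eqP/cards1P[i0 Ji0] /continuous_linear_bound[C C0 psiC].
have [D D0 TD] := continuous_linear_bound cT.
pose w : 'I_n -> G := fun=> S 0 N0 (T xs).
have dE h : d h = M (dfwith w i0 (T h)).
  congr M; apply/funext => i; have [<-|ii0] := eqVneq i0 i.
    by rewrite dfwithin Ji0 set11.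
  by rewrite dfwithout// Ji0 finset.in_set1 eq_sym (negbTE ii0).
pose r := `|S 0 N0 (T xs)| + 1.
have r0 : 0 < r by rewrite ltr_wpDl.
have [CM MC] := bM r0.
have CM0 : 0 <= CM.
  by rewrite (le_trans (normr_ge0 _) (MC (fun=> 0) _))// => i; rewrite normr0 ltW.
apply: (@dual_of_bound _ _ _ (C * (CM / r * D))).
- by move=> a x y /=; rewrite !dE linearP mM linearP.
- by rewrite !mulr_ge0 ?invr_ge0 ?(ltW C0) ?(ltW r0) ?(ltW D0).
- move=> h /=; rewrite (le_trans (psiC _))// -[C * _ * `|h|]mulrA ler_pM2l// dE.
  rewrite -[CM / r * D * `|h|]mulrA.
  apply: (multilinear_bound_slot mM r0 MC) => // i.
  by rewrite /w lerDl.
Qed.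

(** The partial expansions have finite rank, so they are small at weakly small [h]. When [J] has one
    slot, a functional norming [d g] is at most [eps / 2] at [d h], which keeps [d h] away from
    [d g]. *)
Lemma gliding_step (tau : K) (m : nat) (s : seq E) : 0 < tau -> exists h : E,
  [/\ `|h| <= rho, eps <= `|d h|, forall k, (k <= m)%N -> `|S 0 k (T h)| <= tau &
      #|J| = 1%N -> forall g, g \in s -> eps <= `|d g| -> eps / 2 <= `|d h - d g|].
Proof.
move=> tau0.
have e2 : 0 < eps / 2 by rewrite divr_gt0.
have /discont[h [[Wh1 Wh2] hr dh]] : \forall x \near nbhs (xs : weak E),
    (forall k : 'I_m.+1, `|S 0 k (T (x - xs))| <= tau) /\
    (#|J| = 1%N -> forall i : 'I_(size s), eps <= `|d (tnth (in_tuple s) i)| ->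
      eps / 2 <= `|d (x - xs) - d (tnth (in_tuple s) i)|).
  have H1 : \forall x \near nbhs (xs : weak E), forall k : 'I_m.+1,
      `|S 0 k (T (x - xs))| <= tau.
    apply: filter_forall => k.
    have /cvgrPdist_le/(_ _ tau0) := @partial_expansion_weak_continuous _ _ _ _ T A cT cA fA 0 k xs => Hk.
    apply: filterS Hk => x /= hx.
    rewrite linearB -[_ - _]addrC -scaleN1r partial_expansion_linear scaleN1r addrC.
    by rewrite distrC.
  have [J1|J1] := eqVneq #|J| 1%N; last first.
    by apply: filterS H1 => x Hx; split=> // J1'; rewrite J1' eqxx in J1.
  suff H2 : \forall x \near nbhs (xs : weak E), forall i : 'I_(size s),
      eps <= `|d (tnth (in_tuple s) i)| ->
      eps / 2 <= `|d (x - xs) - d (tnth (in_tuple s) i)|.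
    by apply: filterS2 H1 H2 => x Hx1 Hx2; split.
  apply: filter_forall => i; set g := tnth _ i.
  have [psi [cpsi psi1 psig]] := norming_functional (d g).
  have [phi phiE] := slot_form_dual J1 cpsi.
  have /cvgrPdist_le/(_ _ e2) := @dual_weak_continuous _ _ phi xs => Hphi.
  apply: filterS Hphi => x hx dg.
  have {}hx : `|psi (d (x - xs))| <= eps / 2.
    have := hx; rewrite distrC -linearB -[sval phi _]/((sval phi : E -> K^o) (x - xs)).
    by rewrite phiE.
  rewrite (le_trans _ (psi1 _))// linearB distrC (le_trans _ (lerB_dist _ _))// psig.
  by rewrite lerBrDl (le_trans (lerD hx (lexx _)))// -splitr.
rewrite addrC addKr in Wh1 Wh2.
exists h; split=> // [k km|J1 g gs dg]; first exact: (Wh1 (Ordinal (km : (k < m.+1)%N))).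
have /tnthP[i gi] : g \in in_tuple s by [].
by have := Wh2 J1 i; rewrite -gi; apply.
Qed.

Lemma gliding_hump (tau : K) : 0 < tau -> exists (h : nat -> E) (kk : nat -> nat),
  [/\ forall j, (kk j < kk j.+1)%N, forall i, `|h i| <= rho,
      forall i, eps <= `|d (h i)| &
      #|J| = 1%N -> forall i j, (i < j)%N -> eps / 2 <= `|d (h j) - d (h i)|] /\
  [/\ forall l, `|S (kk l) (kk l.+1) (T xs)| <= tau * 2^-1 ^+ l,
      forall l i, `|S (kk l) (kk l.+1) (T (h i)) - (if l == i then T (h i) else 0)| <=
        tau * 2^-1 ^+ l &
      forall i, `|S 0 N0 (T (h i))| <= tau].
Proof.
(* A block is a difference of two partial expansions, each allowed an error proportional to [t0]. *)
move=> tau0; pose t0 := tau / 2.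
have t00 : 0 < t0 by rewrite divr_gt0.
have pow0 m : 0 < 2^-1 ^+ m :> K by rewrite exprn_gt0// invr_gt0.
have pow_le a b : (a <= b)%N -> 2^-1 ^+ b <= 2^-1 ^+ a :> K.
  by move=> ab; rewrite ler_wiXn2l ?invr_ge0// invf_le1// ler1n.
have pow_le1 l : 2^-1 ^+ l <= 1 :> K by rewrite -(expr0 2^-1) pow_le.
have [h hP] := @sequence_choice E (fun k s h => [/\ `|h| <= rho, eps <= `|d h|,
   forall m, (m <= maxn N0 k)%N -> `|S 0 m (T h)| <= t0 * 2^-1 ^+ k &
   #|J| = 1%N -> forall g, g \in s -> eps <= `|d g| -> eps / 2 <= `|d h - d g|])
   (fun k s => gliding_step (maxn N0 k) s (mulr_gt0 t00 (pow0 k))).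
have tail (y : G) (e : K) : 0 < e ->
    exists N, forall k', (N <= k')%N -> `|y - S 0 k' y| <= e.
  move=> e0; have /cvgn_distP/(_ _ e0)[N yN] := @partial_expansion_cvg _ _ _ _ uA y.
  by exists N => k' /yN; rewrite distrC.
(* [g k] is a stage from which the expansions of [T xs] and of the vectors [T (h m)], [m <= k], are
   accurate. *)
have /choice[g gP] : forall k, exists gk, [/\ (k < gk)%N,
    forall m k', (m <= k)%N -> (gk <= k')%N -> `|T (h m) - S 0 k' (T (h m))| <= t0 * 2^-1 ^+ k &
    forall k', (gk <= k')%N -> `|T xs - S 0 k' (T xs)| <= t0 * 2^-1 ^+ k].
  move=> k; have e0 := mulr_gt0 t00 (pow0 k).
  have /choice[N NP] := fun m => tail (T (h m)) _ e0.
  have [N' N'P] := tail (T xs) _ e0.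
  exists (maxn k.+1 (maxn N' (\max_(m < k.+1) N m))); split=> [|m k' mk|k'].
  - by rewrite leq_max leqnn.
  - rewrite !geq_max => /andP[_ /andP[_ Nk']]; apply: NP; apply: leq_trans Nk'.
    exact: (leq_bigmax (Ordinal (mk : (m < k.+1)%N))).
  - by rewrite !geq_max => /andP[_ /andP[N'k' _]]; exact: N'P.
pose it l := iter l g 0%N.
have itS l : (it l < it l.+1)%N by have [] := gP (it l).
have it_ge l : (l <= it l)%N := block_ge itS l.
(* The shift by one starts the blocks at [it 1], where the expansion of [T xs] is already accurate,
   so that its estimate holds for [l = 0] too. *)
pose kk l := it l.+1.
have kkS l : (kk l < kk l.+1)%N by exact: itS.
have kkm := block_mono kkS.
have SB p q y : (p <= q)%N -> S p q y = S 0 q y - S 0 p y.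
  by move=> pq; rewrite /partial_expansion (@big_cat_nat _ _ _ p 0 q)//= addrAC subrr add0r.
have half l (x y : G) : `|x| <= t0 * 2^-1 ^+ l -> `|y| <= t0 * 2^-1 ^+ l ->
    `|x - y| <= tau * 2^-1 ^+ l.
  move=> hx hy; rewrite (le_trans (ler_normB _ _))// (le_trans (lerD hx hy))//.
  by rewrite -mulrDl -splitr.
(* The expansion of [T (h (kk i))] is negligible up to [kk i] and accurate from [kk i.+1] on, so it
   is concentrated on block [i]. *)
exists (h \o kk), kk; split; split=> //.
- by move=> i /=; have [] := hP (kk i).
- by move=> i /=; have [] := hP (kk i).
- move=> J1 i j ij /=; have [_ _ _ /(_ J1 (h (kk i)))] := hP (kk j); apply.
    apply/mapP; exists (kk i) => //; rewrite mem_iota add0n/=.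
    exact: leq_trans (kkS i) (kkm _ _ ij).
  by have [] := hP (kk i).
- move=> l; rewrite SB ?(ltnW (kkS l))//.
  have -> : S 0 (kk l.+1) (T xs) - S 0 (kk l) (T xs) =
      (T xs - S 0 (kk l) (T xs)) - (T xs - S 0 (kk l.+1) (T xs)).
    by rewrite opprB [RHS]addrC subrKA.
  have [_ _ gxs] := gP (it l).
  have pl : t0 * 2^-1 ^+ it l <= t0 * 2^-1 ^+ l by rewrite ler_pM2l// pow_le.
  by apply: half; rewrite (le_trans (gxs _ _))// ltnW ?kkS.
- move=> l i /=; rewrite SB ?(ltnW (kkS l))//.
  have [_ _ small _] := hP (kk i).
  have [li|il|<-] := ltngtP l i.
  + rewrite subr0.
    have pl : t0 * 2^-1 ^+ kk i <= t0 * 2^-1 ^+ l.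
      by rewrite ler_pM2l// pow_le// (leq_trans (ltnW li))// (block_ge kkS).
    by apply: half; rewrite (le_trans (small _ _))// leq_max kkm ?orbT// ltnW.
  + rewrite subr0.
    have -> : S 0 (kk l.+1) (T (h (kk i))) - S 0 (kk l) (T (h (kk i))) =
        (T (h (kk i)) - S 0 (kk l) (T (h (kk i)))) -
        (T (h (kk i)) - S 0 (kk l.+1) (T (h (kk i)))).
      by rewrite opprB [RHS]addrC subrKA.
    have [_ gh _] := gP (it l).
    have pl : t0 * 2^-1 ^+ it l <= t0 * 2^-1 ^+ l by rewrite ler_pM2l// pow_le.
    have kil : (kk i <= it l)%N by exact: (block_mono itS il).
    by apply: half; rewrite (le_trans (gh _ _ kil _))// ltnW ?kkS.
  + have -> : S 0 (kk l.+1) (T (h (kk l))) - S 0 (kk l) (T (h (kk l))) - T (h (kk l)) =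
        - S 0 (kk l) (T (h (kk l))) - (T (h (kk l)) - S 0 (kk l.+1) (T (h (kk l)))).
      by rewrite opprB [RHS]addrCA addrA.
    have [_ gh _] := gP (kk l).
    have pl : t0 * 2^-1 ^+ kk l <= t0 * 2^-1 ^+ l by rewrite ler_pM2l// pow_le// (block_ge kkS).
    have [_ _ smalll _] := hP (kk l).
    apply: half; first by rewrite normrN (le_trans (smalll _ _))// leq_max leqnn orbT.
    by rewrite (le_trans (gh _ _ (leqnn _) _)).
- move=> i /=; have [_ _ small _] := hP (kk i).
  rewrite (le_trans (small _ _)) ?leq_max ?leqnn//.
  rewrite (@le_trans _ _ t0)//; first by rewrite ler_piMr ?(ltW t00).
  by rewrite /t0 ler_pdivrMr// ler_peMr ?(ltW tau0)// ler1n.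
Qed.

End GlidingHump.

(** * Copies of c0 *)

Section C0Copy.
Variables (R : realType) (kd : scalar_kind).
Local Notation K := (scalars R kd).

Lemma c0_norm_ge (u : c0 R kd) j : `|u j| <= `|u|.
Proof.
have nat0 : [set: nat] !=set0 by exists 0%N.
exact: (sup_norm_ge nat0 (c0_bounded u) (x := j)).
Qed.

Lemma c0_norm_le (u : c0 R kd) (B : K) : (forall j, `|u j| <= B) -> `|u| <= B.
Proof.
have nat0 : [set: nat] !=set0 by exists 0%N.
by move=> uB; apply: (sup_norm_le nat0 (c0_bounded u)) => j _; exact: uB.
Qed.

Lemma c0_cvg0 (u : c0 R kd) : (u : nat -> K^o) @ \oo --> (0 : K^o).
Proof. exact/asboolP/c0_subproof. Qed.

Lemma pow2_cvgn (c e : K) : 0 <= c -> 0 < e ->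
  exists N, forall i, (N <= i)%N -> c * 2^-1 ^+ i <= e.
Proof.
move=> c0 e0; have c1 : 0 < c + 1 by rewrite ltr_wpDl.
have [|N Ne] := @pow2_archi R kd (e / (c + 1)); first by rewrite divr_gt0.
exists N => i Ni; rewrite ler_pdivlMr// in Ne; apply: le_trans Ne; rewrite mulrC.
rewrite ler_pM ?exprn_ge0 ?invr_ge0 ?lerDl//.
by rewrite ler_wiXn2l// invf_le1// ler1n.
Qed.

(** [PhiU] bounds the embedding from above. In [PhiD], with [B] the norm of [u], the error is
    absorbed in the left-hand side, which yields a bound from below. Closedness of the range then
    follows by taking limits of preimages coordinate by coordinate. *)
Lemma c0_copy (X : normedModType K) (W : set X) (Phi : (nat -> K) -> X)
    (eps C1 D : K) :
  (forall c a b B B', (forall j, `|a j| <= B) -> (forall j, `|b j| <= B') ->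
     Phi (fun j => c * a j + b j) = c *: Phi a + Phi b) ->
  0 <= C1 -> (forall a B, (forall j, `|a j| <= B) -> `|Phi a| <= C1 * B) ->
  0 < eps -> 0 <= D ->
  (forall a B, (forall j, `|a j| <= B) ->
     forall j, `|a j| * eps <= D * `|Phi a| + eps / 2 * B) ->
  (forall a : nat -> K, (a : nat -> K^o) @ \oo --> (0 : K^o) -> W (Phi a)) ->
  contains_copy (c0 R kd) W.
Proof.
move=> PhiL C10 PhiU eps0 D0 PhiD PhiW.
have lf : linear (fun u : c0 R kd => Phi (u : nat -> K)).
  move=> c u v; exact: PhiL (c0_norm_ge u) (c0_norm_ge v).
pose f : {linear c0 R kd -> X} := HB.pack (fun u : c0 R kd => Phi (u : nat -> K))
  (GRing.isLinear.Build _ _ _ _ _ lf).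
have fU u : `|f u| <= C1 * `|u| by apply: PhiU; exact: c0_norm_ge.
pose L := 2 * D / eps.
have L0 : 0 <= L by rewrite divr_ge0 ?mulr_ge0 ?(ltW eps0).
have fL u : `|u| <= L * `|f u|.
  have : `|u| <= (D * `|f u| + eps / 2 * `|u|) / eps.
    by apply: c0_norm_le => j; rewrite ler_pdivlMr// PhiD//; exact: c0_norm_ge.
  rewrite ler_pdivlMr// -lerBlDr => h; rewrite /L mulrAC ler_pdivlMr// -mulrA.
  rewrite (le_trans _ (ler_wpM2l (ler0n K 2) h))//.
  by have -> : 2 * (`|u| * eps - eps / 2 * `|u|) = `|u| * eps by field.
exists f; split.
- by move=> _ [u _ <-]; apply: PhiW; exact: c0_cvg0.
- move=> p clp.
  have /choice[u up] : forall i : nat, exists u : c0 R kd, `|f u - p| <= 2^-1 ^+ i.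
    move=> i; have e0 : 0 < 2^-1 ^+ i :> K by rewrite exprn_gt0// invr_gt0.
    have [_ [[u _ <-]] pu] := clp _ (nbhsx_ballx p _ e0).
    by exists u; move: pu; rewrite -ball_normE/= distrC => /ltW.
  have pow_le a b : (a <= b)%N -> 2^-1 ^+ b <= 2^-1 ^+ a :> K.
    by move=> ab; rewrite ler_wiXn2l// ?invr_ge0// invf_le1// ler1n.
  have uC i j : (i <= j)%N -> `|u j - u i| <= 2 * L * 2^-1 ^+ i.
    move=> ij; rewrite (le_trans (fL _))// linearB -(subrKA p).
    have -> : 2 * L * 2^-1 ^+ i = L * (2 * 2^-1 ^+ i) by ring.
    rewrite ler_wpM2l// mulr_natl mulr2n (le_trans (ler_normD _ _))// lerD//.
      by rewrite (le_trans (up j))// pow_le.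
    by rewrite distrC up.
  have uCm m i j : (i <= j)%N -> `|u j m - u i m| <= 2 * L * 2^-1 ^+ i.
    move=> ij; apply: le_trans (uC i j ij).
    by rewrite -[u j m - u i m]/((u j - u i) m) c0_norm_ge.
  have L20 : 0 <= 2 * L by rewrite mulr_ge0.
  have /choice[a ua] : forall m, exists l : K^o, (fun i => u i m) @ \oo --> l.
    move=> m; apply: scalars_cauchy_cvg => e e0.
    have [N Ne] := pow2_cvgn L20 e0; exists N => i j Ni ij.
    by rewrite (le_trans (uCm _ _ _ ij))// Ne.
  have au m i : `|a m - u i m| <= 2 * L * 2^-1 ^+ i.
    by apply: (cvgn_norm_le (@ua m) (N := i)) => j ij; exact: uCm.
  have a0 : a @ \oo --> (0 : K^o).
    apply/cvgn_distP => e e0; have e2 : 0 < e / 2 by rewrite divr_gt0.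
    have [i ie] := pow2_cvgn L20 e2.
    have /cvgn_distP/(_ _ e2)[N uN] := @c0_cvg0 (u i).
    exists N => m Nm; rewrite subr0 -(subrK (u i m) (a m)) (splitr e).
    rewrite (le_trans (ler_normD _ _))// lerD//.
      by rewrite (le_trans (au _ _))// ie.
    by rewrite -[u i m]subr0 uN.
  have aN : a \in @null_sequence R kd by apply/asboolP.
  exists (C0Seq aN) => //; apply/eqP; rewrite -subr_eq0 -normr_le0.
  have small e : 0 < e -> `|f (C0Seq aN) - p| <= e.
    move=> e0; have c0 : 0 <= C1 * (2 * L) + 1 by rewrite addr_ge0// mulr_ge0.
    have [N Ne] := pow2_cvgn c0 e0; apply: le_trans (Ne N (leqnn N)).
    rewrite -(subrKA (f (u N))) -linearB mulrDl mul1r (le_trans (ler_normD _ _))//.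
    rewrite lerD// (le_trans (fU _))// -mulrA ler_wpM2l//.
    by apply: c0_norm_le => m; exact: au.
  rewrite real_leNgt ?normr_real ?real0//; apply/negP => p0.
  have := small _ (divr_gt0 p0 (ltr0n K 2)).
  by rewrite ler_pdivlMr// mulr_natr mulr2n gerDl => /(lt_le_trans p0); rewrite ltxx.
- exact: linear_bound_continuous fU.
have injf u v : f u = f v -> u = v.
  move=> fuv; apply/eqP; rewrite -subr_eq0 -normr_le0 (le_trans (fL _))//.
  by rewrite linearB fuv subrr normr0 mulr0.
pose g x := xget 0 [set u | f u = x].
have gf : cancel f g by move=> u; rewrite /g; case: xgetP => [v _ /injf//|/(_ u)] /=.
exists g => //.
apply/subspace_continuousP => _ [u _ <-].
apply/cvgrPdist_le => e e0; rewrite near_withinE.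
have L1 : 0 < L + 1 by rewrite ltr_wpDl.
have e1 : 0 < e / (L + 1) by rewrite divr_gt0.
near=> x => -[v _ vx]; rewrite /from_subspace -vx !gf (le_trans (fL _))// linearB vx.
have : `|f u - x| <= e / (L + 1) by near: x; apply: cvgr_dist_le => //; exact: cvg_id.
by rewrite ler_pdivlMr// => /(le_trans _); apply; rewrite mulrC ler_wpM2l// lerDl.
Unshelve. all: by end_near. Qed.

End C0Copy.

(** * Almost disjoint families *)

Section AlmostDisjoint.

(** Codes of the initial segments of [g]. Distinct branches of the binary tree separate at some
    level, which yields an uncountable almost disjoint family. *)
Definition branch (g : nat -> bool) : set nat :=
  [set m | exists n, m = pickle (mkseq g n)].

Lemma branch_infinite g : infinite_set (branch g).
Proof.
move=> fin; pose f n := pickle (mkseq g n).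
have finj : injective f.
  by move=> a b /(pcan_inj pickleK)/(congr1 size); rewrite !size_mkseq.
have : finite_set (f @^-1` branch g).
  by apply: finite_preimage => // a b _ _; exact: finj.
have -> : f @^-1` branch g = setT by apply/seteqP; split=> // n _; exists n.
exact: infinite_nat.
Qed.

Lemma branch_almost_disjoint g g' : g <> g' ->
  exists N, forall m, (N <= m)%N -> branch g m -> branch g' m -> False.
Proof.
move=> gg'; have [n0 gn0] : exists n0, g n0 <> g' n0.
  by apply: contrapT => /forallNP h; apply: gg'; apply/funext => i; exact: contrapT.
exists (\max_(n < n0.+1) pickle (mkseq g n)).+1 => m Nm [n mn] [n' mn'].
have eqs : mkseq g n = mkseq g' n' by apply: (pcan_inj pickleK); rewrite -mn.
have nn' : n = n' by move/(congr1 size): eqs; rewrite !size_mkseq.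
have [nn0|n0n] := leqP n n0.
  have := @leq_bigmax _ (fun n : 'I_n0.+1 => pickle (mkseq g n)) (Ordinal (nn0 : (n < n0.+1)%N)).
  by rewrite /= -mn => /(leq_trans Nm); rewrite ltnn.
apply: gn0; rewrite -(nth_mkseq false g n0n) -(nth_mkseq false g' (_ : (n0 < n')%N)) -?nn'//.
by rewrite eqs -nn'.
Qed.

Lemma bigcup_finite_neqT (I : countType) (B : I -> set (nat -> bool)) :
  (forall i, finite_set (B i)) -> exists g, forall i, ~ B i g.
Proof.
move=> finB; apply: contrapT => /forallNP all_in.
have cB : countable (\bigcup_(i in [set: I]) B i).
  apply: bigcup_countable => [|i _]; first exact: countableP.
  exact: finite_set_countable.
have [f finj] : exists f : (nat -> bool) -> nat, injective f.
  have /countable_injP[f finj] := cB.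
  exists f => a b; apply: finj; rewrite inE.
    by have /existsNP[i /contrapT Bi] := all_in a; exists i.
  by have /existsNP[i /contrapT Bi] := all_in b; exists i.
(* Cantor's diagonal argument: [d] differs at the place [f d] from the sequence of index [f d],
   which is [d] itself. *)
pose d n := ~~ (xget (fun=> false) [set g | f g = n]) n.
have : d (f d) = ~~ d (f d).
  by rewrite {1}/d; case: xgetP => [g _ /finj -> //|/(_ d) /(_ erefl)].
by case: (d (f d)).
Qed.

End AlmostDisjoint.

Section BranchSums.
Variables (R : realType) (kd : scalar_kind).
Local Notation K := (scalars R kd).
Variable F : normedModType K.

Definition branch_indicator (g : nat -> bool) (j : nat) : K := (`[< branch g j >])%:R.

Lemma branch_indicator_le1 g j : `|branch_indicator g j| <= 1.
Proof. by rewrite /branch_indicator; case: asboolP; rewrite ?normr1 ?normr0. Qed.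

(* The averages of [s (branch_indicator g)] over [N] branches [g] are [O(1 / N)], as the
   branches are disjoint up to finite sets, on which [s] vanishes. *)
Lemma almost_disjoint_perturbation (s : (nat -> K) -> F) (C : K) (V : F) (e : K) :
  (forall c a b B B', (forall j, `|a j| <= B) -> (forall j, `|b j| <= B') ->
     s (fun j => c * a j + b j) = c *: s a + s b) ->
  (forall a, (forall j, `|a j| <= 1) -> `|s a| <= C) ->
  (forall a N, (forall j, (N <= j)%N -> a j = 0) -> s a = 0) ->
  0 < e ->
  finite_set [set g | ~ `|V| - e <= `|V - s (branch_indicator g)|].
Proof.
move=> sL sC s0 e0; apply: contrapT => inf.
have [N CN] := scalars_archi C e0.
have C0 : 0 <= C by rewrite (le_trans _ (sC (fun=> 0) _))// => j; rewrite normr0.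
have [L LB szL] := infinite_set_fset N.+1 inf.
pose l : seq (nat -> bool) := take N.+1 (finmap.enum_fset L).
have ul : uniq l by rewrite take_uniq// finmap.fset_uniq.
have lB g : g \in l -> ~ `|V| - e <= `|V - s (branch_indicator g)|.
  by move=> /mem_take gl; apply: LB.
have sumE (r : seq (nat -> bool)) :
    s (fun j => \sum_(g <- r) branch_indicator g j) = \sum_(g <- r) s (branch_indicator g)
    /\ forall j, `|\sum_(g <- r) branch_indicator g j| <= (size r)%:R.
  elim: r => [|g r [IH1 IH2]].
    split; last by move=> j; rewrite big_nil normr0.
    by rewrite big_nil; apply: (s0 _ 0%N) => j _; rewrite big_nil.
  split.
    rewrite big_cons -IH1 -[s (branch_indicator g)]scale1r.
    rewrite -(sL 1 _ _ _ _ (branch_indicator_le1 g) IH2); congr s.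
    by apply/funext => j; rewrite big_cons mul1r.
  move=> j; rewrite big_cons /= -natr1 addrC (le_trans (ler_normD _ _))// lerD//.
  exact: branch_indicator_le1.
(* The indicator of the union of the chosen branches. It can differ from the sum of their indicators
   only below [N1], so [s] takes the same value on both, and this value is at most [C] whatever the
   number of branches. *)
pose b j : K := (has (fun g => `[< branch g j >]) l)%:R.
have b1 j : `|b j| <= 1 by rewrite /b; case: has; rewrite ?normr1 ?normr0.
have /choice[D DP] : forall gg : (nat -> bool) * (nat -> bool), exists N,
    gg.1 <> gg.2 -> forall m, (N <= m)%N -> branch gg.1 m -> branch gg.2 m -> False.
  move=> [g g']; have [->|/eqP gg'] := eqVneq g g'; first by exists 0%N.
  by have [N' N'P] := branch_almost_disjoint gg'; exists N' => _.
pose N1 := (\sum_(g <- l) \sum_(g' <- l) D (g, g'))%N.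
have eqb j : (N1 <= j)%N -> \sum_(g <- l) branch_indicator g j = b j.
  move=> N1j; rewrite /b; case: hasP => [[g gl /asboolP gj]|nh].
    rewrite (bigD1_seq g)//= {1}/branch_indicator asboolT// big1_seq ?addr0// => g'.
    move=> /andP[g'g g'l]; rewrite /branch_indicator asboolF// => g'j.
    apply: (DP (g', g)) g'j gj => /=; first exact/eqP.
    rewrite (leq_trans _ N1j)// /N1 (bigD1_seq g')//= (bigD1_seq g gl ul)/=.
    by rewrite -!addnA leq_addr.
  rewrite big1_seq// => g /andP[_ gl]; rewrite /branch_indicator asboolF// => gj.
  by apply: nh; exists g => //; apply/asboolP.
have [sumS sumB] := sumE l.
have sb : \sum_(g <- l) s (branch_indicator g) = s b.
  rewrite -sumS.
  have := sL (-1) b _ _ _ b1 sumB; rewrite (s0 _ N1); last first.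
    by move=> j N1j; rewrite eqb// mulN1r addNr.
  by rewrite scaleN1r addrC => /esym/eqP; rewrite subr_eq0 => /eqP.
have lt g : g \in l -> `|V - s (branch_indicator g)| <= `|V| - e.
  move=> /lB /negP; rewrite -real_ltNge ?realB ?normr_real ?gtr0_real//.
  exact: ltW.
have sz : size l = N.+1 by rewrite size_takel.
have h1 : `|\sum_(g <- l) (V - s (branch_indicator g))| <= N.+1%:R * (`|V| - e).
  rewrite (le_trans (ler_norm_sum _ _ _))//.
  rewrite (@le_trans _ _ (\sum_(g <- l) (`|V| - e)))//.
    by rewrite big_seq [X in _ <= X]big_seq; apply: ler_sum => g; exact: lt.
  by rewrite big_const_seq count_predT iter_addr_0 sz mulr_natl.
rewrite sumrB sb big_const_seq count_predT iter_addr_0 sz in h1.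
have h2 : N.+1%:R * `|V| <= N.+1%:R * (`|V| - e) + C.
  rewrite -[X in X * _ <= _](@normr_nat K) -normrZ scaler_nat.
  rewrite -(subrK (s b) (V *+ _)) (le_trans (ler_normD _ _))// lerD//.
  exact: sC.
move: h2; rewrite mulrBr -addrA lerDl addrC subr_ge0.
rewrite -[C]ger0_norm// => /le_trans/(_ CN).
by rewrite ler_pM2r// ler_nat ltnn.
Qed.

End BranchSums.

(** * Weakly continuous polynomials on zero-sum combinations *)

Section WeakClustering.
Variables (R : realType) (kd : scalar_kind).
Local Notation K := (scalars R kd).
Variables (E F : normedModType K) (n : nat).

Definition zero_sum (M : set nat) (I : seq nat) (al : nat -> K) :=
  [/\ uniq I, forall i, i \in I -> M i, (size I <= 3)%N, forall i, `|al i| <= 2 &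
      \sum_(i <- I) al i = 0].

(** The vectors [h i] need not converge weakly. For each functional [phi] the values [phi (h i)] are
    almost constant on an infinite set of indices, and coefficients of sum zero cancel the constant,
    so the points approach [xs] weakly. *)
Lemma Pw_zero_sum (P : hpoly E F n) (xs : E) (h : nat -> E) (rho e : K) (M : set nat) :
  Pw P -> 0 < rho -> `|xs| <= rho -> (forall i, `|h i| <= rho) -> infinite_set M -> 0 < e ->
  exists M', [/\ infinite_set M', M' `<=` M & forall I al, zero_sum M' I al ->
    `|P (xs + \sum_(i <- I) al i *: h i) - P xs| <= e].
Proof.
move=> PwP rho0 xsr hr Minf e0.
(* Quantifying over all infinite subsets [M1] allows successive thinnings, which makes [Fi] stable
   under intersection. *)
pose Fi : set_system E := [set W | forall M1, infinite_set M1 -> M1 `<=` M ->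
  exists M2, [/\ infinite_set M2, M2 `<=` M1 & forall I al, zero_sum M2 I al ->
    W (xs + \sum_(i <- I) al i *: h i)]].
have FFi : Filter Fi.
  split.
  - by move=> M1 M1inf _; exists M1; split.
  - move=> W W' FW FW' M1 M1inf M1M.
    have [M2 [M2inf M21 M2W]] := FW M1 M1inf M1M.
    have [M3 [M3inf M32 M3W]] := FW' M2 M2inf (subset_trans M21 M1M).
    exists M3; split=> //; first exact: subset_trans M21.
    move=> I al zI; split; last exact: M3W.
    by apply: M2W; case: zI => ? IM ? ? ?; split=> // i /IM/M32.
  - move=> W W' WW' FW M1 M1inf M1M.
    have [M2 [M2inf M21 M2W]] := FW M1 M1inf M1M.
    by exists M2; split=> // I al zI; apply: WW'; exact: M2W.
have Fixs : Fi --> (xs : weak E).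
  apply/weak_cvgP => phi; apply/cvgrPdist_le => d d0 M1 M1inf M1M.
  have [C C0 phiC] := continuous_linear_bound (svalP phi).
  (* Three terms with coefficients at most 2 amount to [2 * (d / 6) * 3 = d]. *)
  have [||M2 [M2inf M21 M2d]] := @scalars_clustering _ _ M1 (fun i => sval phi (h i))
      (C * rho) (d / 6) M1inf.
  - by move=> i _; rewrite (le_trans (phiC _))// ler_pM2l.
  - by rewrite divr_gt0.
  exists M2; split=> // I al [uI IM szI al2 al0].
  rewrite linearD opprD addrA subrr sub0r normrN linear_sum.
  under eq_bigr do rewrite linearZ.
  case: I uI IM szI al0 => [|i0 I] uI IM szI al0.
    by rewrite big_nil normr0 ltW.
  have -> : \sum_(i <- i0 :: I) al i *: sval phi (h i) =
      \sum_(i <- i0 :: I) al i *: (sval phi (h i) - sval phi (h i0)).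
    under [RHS]eq_bigr do rewrite scalerBr.
    by rewrite sumrB -scaler_suml al0 scale0r subr0.
  rewrite big_seq (le_trans (ler_norm_sum _ _ _))// -big_seq.
  rewrite (@le_trans _ _ (\sum_(i <- i0 :: I) 2 * (d / 6)))//.
    rewrite big_seq [X in _ <= X]big_seq; apply: ler_sum => i iI.
    by rewrite normrZ ler_pM// M2d//; apply: IM; rewrite ?mem_head.
  rewrite big_const_seq count_predT iter_addr_0 -[_ *+ size _]mulr_natr.
  rewrite (@le_trans _ _ (2 * (d / 6) * 3))//; last first.
    by rewrite le_eqVlt; apply/orP; left; apply/eqP; field.
  by rewrite ler_wpM2l ?mulr_ge0 ?divr_ge0 ?(ltW d0)// ler_nat.
pose D : set E := [set x | `|x| <= 7 * rho].
have Dbdd : bounded_set D.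
  exists (7 * rho); split; first by rewrite gtr0_real// mulr_gt0.
  by move=> N rN x Dx; apply: le_trans Dx (ltW rN).
have Dxs : D xs by rewrite /D/= (le_trans xsr)// ler_peMl ?ler1n ?(ltW rho0).
have /subspace_continuousP/(_ xs Dxs)/cvgrPdist_le/(_ _ e0) := PwP D Dbdd.
rewrite near_withinE => /Fixs/(_ M Minf (@subset_refl _ M))[M' [M'inf M'M M'P]].
exists M'; split=> // I al zI; rewrite distrC; apply: (M'P I al zI).
have [uI IM szI al2 _] := zI.
rewrite /D/= (le_trans (ler_normD _ _))// (_ : 7 = 1 + 6)// mulrDl mul1r lerD//.
rewrite (le_trans (ler_norm_sum _ _ _))//.
rewrite (@le_trans _ _ (\sum_(i <- I) 2 * rho))//.
  by apply: ler_sum => i _; rewrite normrZ ler_pM.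
rewrite big_const_seq count_predT iter_addr_0 -[_ *+ size _]mulr_natl mulrA.
rewrite ler_wpM2r ?(ltW rho0)// -natrM ler_nat; exact: (leq_mul szI (leqnn 2)).
Qed.

End WeakClustering.

(** * Main result *)

Section HPolyNorm.
Variables (R : realType) (kd : scalar_kind).
Local Notation K := (scalars R kd).
Variables (E F : normedModType K) (n : nat).

Lemma hpoly_norm_le (P : hpoly E F n) (C : K) :
  (forall x, `|x| <= 1 -> `|P x| <= C) -> `|P| <= C.
Proof.
move=> PC; exact: (sup_norm_le (unit_ball_neq0 E) (hpoly_bounded P) PC).
Qed.

Lemma hpoly_norm_ball (P : hpoly E F n) (r : K) (x : E) : 0 < r -> `|x| <= r ->
  `|P x| <= r ^+ n * `|P|.
Proof.
move=> r0 xr; have [hP _] := hpolyP P.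
rewrite -[x](@scalerKV _ _ r) ?gt_eqF// (hpolyZ _ _ hP) normrZ normrX gtr0_norm//.
rewrite ler_pM2l ?exprn_gt0//; apply: (sup_norm_ge (unit_ball_neq0 E) (hpoly_bounded P)).
by rewrite /unit_ball/= normrZ normfV gtr0_norm// ler_pdivrMl// mulr1.
Qed.

End HPolyNorm.

(* For [r >= 2] the combinations with coefficients [-2, 1, 1] in some order do the job.
   They all vanish when [r = 1] and the [d i] are equal, which the last hypothesis excludes. *)
Lemma zero_sum_separation (R : realType) (kd : scalar_kind)
    (F : normedModType (scalars R kd)) (d : nat -> F) (r : nat) (eps : scalars R kd) :
  (0 < r)%N -> 0 < eps -> (forall i, eps <= `|d i|) ->
  (r = 1%N -> forall i j, (i < j)%N -> eps / 2 <= `|d j - d i|) ->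
  forall i1 i2 i3, (i1 < i2)%N -> (i2 < i3)%N ->
  exists2 al, zero_sum setT [:: i1; i2; i3] al &
    eps / 4 <= `|\sum_(i <- [:: i1; i2; i3]) al i ^+ r *: d i|.
Proof.
move=> r0 eps0 dge d1 i1 i2 i3 i12 i23.
have i21 : (i2 == i1) = false by rewrite gtn_eqF.
have i31 : (i3 == i1) = false by rewrite gtn_eqF// (ltn_trans i12).
have i32 : (i3 == i2) = false by rewrite gtn_eqF.
have uI : uniq [:: i1; i2; i3] 
  by rewrite /= !inE (ltn_eqF i12) (ltn_eqF (ltn_trans i12 i23)) (ltn_eqF i23).
pose al (a1 a2 a3 : scalars R kd) i := if i == i1 then a1 else if i == i2 then a2 else a3.
have al_sum a1 a2 a3 (V : lmodType (scalars R kd)) (g : scalars R kd -> nat -> V) :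
    \sum_(i <- [:: i1; i2; i3]) g (al a1 a2 a3 i) i = g a1 i1 + (g a2 i2 + g a3 i3).
  by rewrite !big_cons big_nil addr0 /al !eqxx i21 i31 i32.
have zs a1 a2 a3 : `|a1| <= 2 -> `|a2| <= 2 -> `|a3| <= 2 -> a1 + (a2 + a3) = 0 ->
    zero_sum setT [:: i1; i2; i3] (al a1 a2 a3).
  move=> h1 h2 h3 h0; split=> //; first by move=> i; rewrite /al; case: ifP => // _; case: ifP.
  by rewrite (al_sum a1 a2 a3 _ (fun c i => c : (scalars R kd)^o)).
have [r1|r2] : r = 1%N \/ (1 < r)%N by case: (ltngtP 1 r) r0 => //; auto.
  exists (al 1 (-1) 0).
    by apply: zs; rewrite ?normrN ?normr1 ?normr0 ?ler1n// addr0 subrr.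
  rewrite (al_sum _ _ _ _ (fun c i => c ^+ r *: d i)) r1 !expr1 scale1r scaleN1r scale0r.
  rewrite addr0 distrC (le_trans _ (d1 r1 _ _ i12))//.
  by rewrite ler_pM2l// lef_pV2 ?posrE// ler_nat.
apply: contrapT => none.
pose e : scalars R kd := (-2) ^+ r.
have ne : 4 <= `|e|.
  rewrite normrX normrN normr_nat (_ : 4 = 2 ^+ 2); last by rewrite -natrX.
  by rewrite ler_weXn2l// ler1n.
have ne2 : 2 <= `|e + 2|.
  have := lerB_dist e (-2); rewrite opprK normrN normr_nat; apply: le_trans.
  by rewrite lerBrDr -natrD.
have ne1 : 3 <= `|e - 1|.
  have := lerB_dist e 1; rewrite normr1; apply: le_trans.
  by rewrite lerBrDr natr1.
have small a1 a2 a3 : `|a1| <= 2 -> `|a2| <= 2 -> `|a3| <= 2 -> a1 + (a2 + a3) = 0 ->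
    `|a1 ^+ r *: d i1 + (a2 ^+ r *: d i2 + a3 ^+ r *: d i3)| <= eps / 4.
  move=> h1 h2 h3 h0; apply: ltW; rewrite real_ltNge ?normr_real ?gtr0_real ?divr_gt0//.
  apply/negP => big; apply: none; exists (al a1 a2 a3); first exact: zs.
  by rewrite (al_sum _ _ _ _ (fun c i => c ^+ r *: d i)).
have n2 : `|-2 : scalars R kd| <= 2 by rewrite normrN normr_nat.
have n1 : `|1 : scalars R kd| <= 2 by rewrite normr1 ler1n.
have s1 := small (-2) 1 1 n2 n1 n1; have s2 := small 1 (-2) 1 n1 n2 n1.
have s3 := small 1 1 (-2) n1 n1 n2.
rewrite !expr1n !scale1r -/e in s1 s2 s3.
have {}s1 := s1 ltac:(ring); have {}s2 := s2 ltac:(ring); have {}s3 := s3 ltac:(ring).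
set v1 := (X in `|X| <= _) in s1; set v2 := (X in `|X| <= _) in s2.
set v3 := (X in `|X| <= _) in s3.
(* The three combinations are [v_k = (e - 1) d_k + t] and sum up to [(e + 2) t]. If all were small,
   then [t] would be small, and so would [(e - 1) d_1], against [|e - 1| >= 3]. *)
pose t := d i1 + (d i2 + d i3).
have v1E : v1 = (e - 1) *: d i1 + t.
  by rewrite /v1 /t scalerBl scale1r [RHS]addrA subrK.
have v2E : v2 = (e - 1) *: d i2 + t.
  by rewrite /v2 /t scalerBl scale1r [RHS]addrCA; congr (_ + _); rewrite addrA subrK.
have v3E : v3 = (e - 1) *: d i3 + t.
  rewrite /v3 /t scalerBl scale1r [RHS]addrCA; congr (_ + _); rewrite [RHS]addrCA.
  by congr (_ + _); rewrite subrK.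
have sumv : v1 + v2 + v3 = (e + 2) *: t.
  rewrite v1E v2E v3E [X in X + _]addrACA [LHS]addrACA -!scalerDr
    -[d i1 + d i2 + d i3]addrA -/t -[t + t + t]addrA.
  rewrite (_ : e + 2 = (e - 1) + 3); last by ring.
  by rewrite [RHS]scalerDl scaler_nat !mulrS mulr0n addr0.
have h : `|t| <= eps / 4 * 3 / 2.
  rewrite ler_pdivlMr// (le_trans (ler_wpM2l (normr_ge0 _) ne2))// mulrC -normrZ -sumv.
  rewrite (_ : eps / 4 * 3 = eps / 4 + eps / 4 + eps / 4); last by ring.
  by rewrite (le_trans (ler_normD _ _))// lerD// (le_trans (ler_normD _ _))// lerD.
have : 3 * eps <= eps / 4 + eps / 4 * 3 / 2.
  rewrite (@le_trans _ _ (`|e - 1| * `|d i1|))//; first by rewrite ler_pM// ltW.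
  rewrite -normrZ (_ : (e - 1) *: d i1 = v1 - t); last by rewrite v1E addrK.
  by rewrite (le_trans (ler_normB _ _))// lerD.
rewrite -subr_ge0 (_ : _ - _ = - (19 / 8) * eps); last by field.
by rewrite mulNr oppr_ge0 => /(lt_le_trans (mulr_gt0 _ eps0)); rewrite ltxx divr_gt0// => /(_ isT).
Qed.

Section Noncomplemented.
Variables (R : realType) (kd : scalar_kind).
Local Notation K := (scalars R kd).
Variables (E F : normedModType K) (n : nat).
Variables (Phi : (nat -> K) -> hpoly E F n) (xs : E) (h : nat -> E) (d : nat -> F).
Variables (r : nat) (rho eps C1 : K).
Hypothesis PhiL : forall c a b B B', (forall j, `|a j| <= B) -> (forall j, `|b j| <= B') ->
  Phi (fun j => c * a j + b j) = c *: Phi a + Phi b.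
Hypotheses (C10 : 0 <= C1) (PhiU : forall a B, (forall j, `|a j| <= B) -> `|Phi a| <= C1 * B).
Hypothesis PhiW : forall a : nat -> K, (a : nat -> K^o) @ \oo --> (0 : K^o) -> Pw (Phi a).
Hypotheses (rho0 : 0 < rho) (eps0 : 0 < eps) (xsr : `|xs| <= rho) (hr : forall i, `|h i| <= rho).
Hypothesis dge : forall i, eps <= `|d i|.
Hypothesis Phi_test : forall a B, (forall j, `|a j| <= B) ->
  forall (I : seq nat) (al : nat -> K), uniq I -> (size I <= 3)%N -> (forall i, `|al i| <= 2) ->
  `|Phi a (xs + \sum_(i <- I) al i *: h i) - \sum_(i <- I) (a i * al i ^+ r) *: d i| <=
  eps / 100 * B.

Lemma block_contains_copy : contains_copy (c0 R kd) (@Pw R kd E F n).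
Proof.
apply: (c0_copy (eps := eps) (D := (2 * rho) ^+ n) PhiL C10 PhiU eps0 _ _ PhiW).
  by rewrite exprn_ge0// mulr_ge0// ltW.
move=> a B aB j; have B0 : 0 <= B by exact: le_trans (aB 0%N).
have n1 : `|1 : K| <= 2 by rewrite normr1 ler1n.
(* The test with the single index [j] has error [eps / 100 * B], below the [eps / 2 * B] which
   [c0_copy] tolerates. *)
have := Phi_test aB (I := [:: j]) (al := fun=> 1) isT isT (fun=> n1).
rewrite !big_seq1 expr1n mulr1 scale1r => hj.
have r2 : 0 < 2 * rho by rewrite mulr_gt0.
have h1 : `|Phi a (xs + h j)| <= (2 * rho) ^+ n * `|Phi a|.
  apply: hpoly_norm_ball => //.
  by rewrite mulr_natl mulr2n (le_trans (ler_normD _ _))// lerD.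
rewrite (@le_trans _ _ `|a j *: d j|)//; first by rewrite normrZ ler_wpM2l.
rewrite -(subrK (Phi a (xs + h j)) (a j *: d j)) addrC (le_trans (ler_normD _ _))//.
rewrite lerD// distrC (le_trans hj)// ler_wpM2r// ler_pM2l// lef_pV2 ?posrE//.
by rewrite ler_nat.
Qed.

Hypothesis r0 : (0 < r)%N.
Hypothesis d1 : r = 1%N -> forall i j, (i < j)%N -> eps / 2 <= `|d j - d i|.

Lemma block_not_complemented : ~ complemented (@Pw R kd E F n).
Proof.
move=> [p [cp pp rp]].
have [Cp Cp0 pB] := continuous_linear_bound cp.
have p_id P : Pw P -> p P = P by rewrite -rp => -[Q _ <-]; exact: pp.
(* [Sa] vanishes on finitely supported sequences, for which [Phi a] is fixed by [p]. *)
pose Sa a := Phi a - p (Phi a).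
have SL c a b B B' : (forall j, `|a j| <= B) -> (forall j, `|b j| <= B') ->
    Sa (fun j => c * a j + b j) = c *: Sa a + Sa b.
  move=> aB bB'; rewrite /Sa (PhiL _ aB bB') linearP scalerBr opprD.
  by rewrite addrACA.
have SC a : (forall j, `|a j| <= 1) -> `|Sa a| <= C1 + Cp * C1.
  move=> a1; have := PhiU a1; rewrite mulr1 => hPhi.
  rewrite (le_trans (ler_normB _ _))// lerD// (le_trans (pB _))//.
  by rewrite ler_pM2l.
have S0 a N : (forall j, (N <= j)%N -> a j = 0) -> Sa a = 0.
  move=> aN; rewrite /Sa p_id ?subrr//; apply: PhiW.
  by apply/cvgn_distP => e e0; exists N => j /aN ->; rewrite subrr normr0 ltW.
pose ordered (t : nat * nat * nat) := (t.1.1 < t.1.2)%N && (t.1.2 < t.2)%N.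
(* Coefficients are fixed once for each triple of indices: this makes the tests countably many, so
   that one branch can serve for all of them. Triples that are not increasing receive the value
   [0]. *)
have /choice[al alP] : forall t : nat * nat * nat, exists al : nat -> K, ordered t ->
    zero_sum setT [:: t.1.1; t.1.2; t.2] al /\
    eps / 4 <= `|\sum_(i <- [:: t.1.1; t.1.2; t.2]) al i ^+ r *: d i|.
  move=> [[i1 i2] i3]; case: (boolP (ordered (i1, i2, i3))) => [/andP[/= i12 i23]|].
    by have [al zal dal] := zero_sum_separation r0 eps0 dge d1 i12 i23; exists al.
  by exists (fun=> 0).
pose I (t : nat * nat * nat) := [:: t.1.1; t.1.2; t.2].
pose pt t := xs + \sum_(i <- I t) al t i *: h i.
pose V t := \sum_(i <- I t) al t i ^+ r *: d i.
pose s t (a : nat -> K) : F := Sa a (pt t) - Sa a xs.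
have e16 : 0 < eps / 16 by rewrite divr_gt0.
have finB t : finite_set [set g | ~ `|V t| - eps / 16 <=
    `|V t - s t (branch_indicator R kd g)|].
  pose q := `|pt t| + rho.
  have q0 : 0 < q by rewrite ltr_wpDl.
  have xq : `|xs| <= q by rewrite (le_trans xsr)// lerDr.
  apply: (almost_disjoint_perturbation (C := 2 * (q ^+ n * (C1 + Cp * C1)))) => //.
  - move=> c a b B B' aB bB'; rewrite /s.
    have SLx x : Sa (fun j => c * a j + b j) x = c *: Sa a x + Sa b x.
      by rewrite (SL _ _ _ _ _ aB bB').
    rewrite !SLx.
    by rewrite opprD addrACA -scalerBr.
  - move=> a a1; have qn : 0 < q ^+ n by rewrite exprn_gt0.
    rewrite mulr_natl mulr2n (le_trans (ler_normB _ _))// lerD//.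
      rewrite (le_trans (hpoly_norm_ball (Sa a) q0 (_ : `|pt t| <= q)))//; last
        by rewrite ler_pM2l// SC.
      by rewrite lerDl ltW.
    by rewrite (le_trans (hpoly_norm_ball (Sa a) q0 xq))// ler_pM2l// SC.
  - by move=> a N aN; rewrite /s (S0 _ _ aN) subrr.
(* Countably many finite sets do not exhaust the branches: for this [g], every test loses at most
   [eps / 16], whatever triple is chosen later. *)
have [g gP] := bigcup_finite_neqT finB.
pose u := branch_indicator R kd g.
have u1 := branch_indicator_le1 R kd g.
pose P := p (Phi u).
have PwP : Pw P by rewrite -rp; exists (Phi u).
(* Thinning takes place inside the branch of [g], so that [u i = 1] at the three indices. *)
have [M' [M'inf M'g M'P]] := Pw_zero_sum PwP rho0 xsr hr (@branch_infinite g) e16.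
have M'ex N : exists2 i, (N < i)%N & M' i.
  apply: contrapT => nex; apply: M'inf; apply: (@sub_finite_set _ _ `I_N.+1).
    move=> i M'i /=; rewrite ltnS leqNgt; apply/negP => Ni.
    by apply: nex; exists i.
  exact: finite_II.
have [i1 _ M1] := M'ex 0%N; have [i2 i12 M2] := M'ex i1; have [i3 i23 M3] := M'ex i2.
pose t := (i1, i2, i3).
have [zal Vt] := alP t (introT andP (conj i12 i23)).
have /M'P : zero_sum M' (I t) (al t).
  by case: zal => uI _ szI al2 al0; split=> // i; rewrite !inE => /or3P[] /eqP ->.
rewrite -/(pt t) => Psmall.
have [uI _ szI al2 al0] := zal.
have Phipt : `|Phi u (pt t) - V t| <= eps / 100.
  have := Phi_test u1 uI szI al2; rewrite mulr1 -/(pt t).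
  suff -> : \sum_(i <- [:: t.1.1; t.1.2; t.2]) (u i * al t i ^+ r) *: d i = V t by [].
  rewrite /V big_seq [RHS]big_seq; apply: eq_bigr => i iI.
  suff -> : u i = 1 by rewrite mul1r.
  rewrite /u /branch_indicator asboolT//; apply: M'g.
  by move: iI; rewrite !inE => /or3P[] /eqP ->.
have Phixs : `|Phi u xs| <= eps / 100.
  have := Phi_test u1 (I := [::]) (al := fun=> 0) isT isT; rewrite !big_nil addr0 subr0 mulr1.
  by apply=> _; rewrite normr0.
have := gP t => /contrapT; rewrite -/u.
have -> : V t - s t u = (P (pt t) - P xs) + (Phi u xs - (Phi u (pt t) - V t)).
  have SE x : Sa u x = Phi u x - P x by [].
  rewrite /s !SE !opprB (addrACA (Phi u xs)) [RHS]addrACA (addrCA (- P xs)) [RHS]addrCA.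
  by rewrite (addrC (P (pt t))).
(* [V t] has norm at least [eps / 4], while the pieces of the right-hand side are at most
   [eps / 16], [eps / 100] and [eps / 100]. *)
move=> big; have : eps / 4 - eps / 16 <= eps / 16 + (eps / 100 + eps / 100).
  rewrite (le_trans _ (le_trans big _)) ?lerD2r// (le_trans (ler_normD _ _))// lerD//.
  by rewrite (le_trans (ler_normB _ _))// lerD.
rewrite -subr_ge0 (_ : _ - _ = - (21 / 200) * eps); last by field.
by rewrite mulNr oppr_ge0 => /(lt_le_trans (mulr_gt0 _ eps0)); rewrite ltxx divr_gt0// => /(_ isT).
Qed.

End Noncomplemented.

Theorem theorem3p12 (R : realType) (k : scalar_kind)
    (E F : completeNormedModType (scalars R k)) (n : nat) (n_gt0 : (0 < n)%N)
    (P : hpoly E F n) (P_notin : ~ Pw P)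
    (G : completeNormedModType (scalars R k))
    (G_fd : has_unconditional_fd_expansion G)
    (T : {linear E -> G}) (T_cont : continuous T) (Q : hpoly G F n)
    (PQT : (P : E -> F) = Q \o T) :
  contains_copy (c0 R k) (@Pw R k E F n) /\ ~ complemented (@Pw R k E F n).
Proof.
have [A [cA fA uA]] := G_fd.
have [M [c [mM bM c0 MQ]]] := hpoly_polarization Q.
have MP x : M (fun=> T x) = c *: P x by rewrite MQ PQT.
have [J [N0 [xs [rho [eps [J0 rho0 eps0 xsr disc]]]]]] :=
  discontinuous_slots mM bM T_cont cA uA c0 MP P_notin.
have [C C0 test] := block_poly_test mM bM T_cont cA uA N0 J0 rho0.
have C1 : 0 < C + 1 by rewrite ltr_wpDl.
(* Makes the error [C * tau * B] of [block_poly_test] at most [eps / 100 * B]. *)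
pose tau := eps / 100 / (C + 1).
have tau0 : 0 < tau by rewrite divr_gt0// divr_gt0.
have [h [kk [[kkS hr dge d1] [Sxs Sh S0h]]]] :=
  gliding_hump mM bM T_cont cA fA uA eps0 disc tau0.
pose Phi := block_poly M T A J N0 kk.
have [C2 C20 PhiB] := block_poly_bound mM bM T_cont cA uA N0 J0 kkS ltr01.
have PhiU (a : nat -> scalars R k) B : (forall j, `|a j| <= B) -> `|Phi a| <= C2 * B.
  move=> aB; apply: hpoly_norm_le => x x1.
  have := PhiB a B B x 0%N aB (fun j _ => aB j) x1.
  by rewrite big_geq// subr0.
have PhiL := block_poly_linear mM bM T_cont cA uA N0 J0 kkS.
have PhiW (a : nat -> scalars R k) :=
  block_poly_Pw mM bM T_cont cA fA uA J0 kkS (N0 := N0) (a := a).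
have Phi_test (a : nat -> scalars R k) B : (forall j, `|a j| <= B) ->
    forall (I : seq nat) (al : nat -> scalars R k), uniq I -> (size I <= 3)%N ->
    (forall i, `|al i| <= 2) ->
    `|Phi a (xs + \sum_(i <- I) al i *: h i) -
      \sum_(i <- I) (a i * al i ^+ #|J|) *: slot_form M T A J N0 xs (h i)| <= eps / 100 * B.
  move=> aB I al uI sI al2.
  apply: le_trans (test kk xs h tau kkS (ltW tau0) xsr hr Sxs Sh S0h a B aB I al uI sI al2) _.
  rewrite ler_wpM2r ?(le_trans _ (aB 0%N))// /tau mulrA ler_pdivrMr// mulrC.
  by rewrite ler_pM2l ?lerDl// divr_gt0.
split.
  exact: (block_contains_copy (d := fun i => slot_form M T A J N0 xs (h i))
    PhiL C20 PhiU PhiW rho0 eps0 xsr hr dge Phi_test).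
exact: (block_not_complemented (d := fun i => slot_form M T A J N0 xs (h i))
  PhiL PhiU PhiW rho0 eps0 xsr hr dge Phi_test J0 d1).
Qed.
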